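(* Let $n\in\mathbb{N}_0$, $\alpha,\mu\in\mathbb{C}$, $\nu\in(-1/2,\infty)\setminus\{0\}$, $\rho\in(0,1)$ and, for $x\in[-1,1]$, put $R:=\sqrt{1+\rho^2-2\rho x}$. Then $$\int_{-1}^1(1-x^2)^{\nu-\mu/2-1/4}\,P_{\mu-\alpha-1/2}^{1/2-\mu}(R+\rho)\,\mathrm{P}_{\mu-\alpha-1/2}^{1/2-\mu}(R-\rho)\,C_n^\nu(x)\,dx$$ $$=\frac{\sqrt{\pi}\,2^{1/2-\mu}\,(2\nu)_n(\alpha)_n(2\mu-\alpha)_n(\mu)_n\,\Gamma(\frac12+\nu)}{(2\mu)_n\,\Gamma(\frac12+\mu+n)\,\Gamma(1+\nu+n)\,\Gamma(\frac12+\mu)\,n!}\,\rho^{n+\mu-1/2}$$ $$\times\,{}_6F_5\!\left(\begin{array}{c}\frac{\alpha+n}{2},\ \frac{\alpha+n+1}{2},\ \frac{2\mu-\alpha+n}{2},\ \frac{2\mu-\alpha+n+1}{2},\ \mu+n,\ \mu-\nu\\ \frac{2\mu+n}{2},\ \frac{2\mu+n+1}{2},\ \frac{\mu+n+\frac12}{2},\ \frac{\mu+n+\frac32}{2},\ 1+\nu+n\end{array};\rho^2\right).$$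
   Context: $\mathbb{N}_0=\{0,1,2,\dots\}$. $(z)_n:=\prod_{i=1}^n(z+i-1)$ is the Pochhammer symbol. ${}_pF_q(a_1,\dots,a_p;b_1,\dots,b_q;z):=\sum_{n=0}^\infty\frac{(a_1)_n\cdots(a_p)_n}{(b_1)_n\cdots(b_q)_n}\frac{z^n}{n!}$ (${}_2F_1$ being continued analytically to $\mathbb{C}\setminus[1,\infty)$). The Gegenbauer polynomials are $C_n^\nu(z):=\frac{(2\nu)_n}{n!}\,{}_2F_1\left(-n,n+2\nu;\nu+\frac12;\frac{1-z}{2}\right)$. The associated Legendre function of the first kind (italic $P$) on $\mathbb{C}\setminus(-\infty,1]$ is $$P_\nu^\mu(z):=\frac{1}{\Gamma(1-\mu)}\left(\frac{z+1}{z-1}\right)^{\mu/2}{}_2F_1\!\left(-\nu,\nu+1;1-\mu;\frac{1-z}{2}\right),$$ and the Ferrers function of the first kind (upright $\mathrm{P}$) on $(-1,1)$ is $$\mathrm{P}_\nu^\mu(t):=\frac{1}{\Gamma(1-\mu)}\left(\frac{1+t}{1-t}\right)^{\mu/2}{}_2F_1\!\left(-\nu,\nu+1;1-\mu;\frac{1-t}{2}\right),$$ where for $1-\mu\in\{0,-1,-2,\dots\}$ the product $\frac{1}{\Gamma(1-\mu)}{}_2F_1$ is understood by continuity in $\mu$. For exceptional $\mu$ ($2\mu\in\{0,-1,-2,\dots\}$) at which factors on the right-hand side are not individually defined, the right-hand side as a whole is understood by analytic continuation in $\mu$. *)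

(* Defs.v *)
From Stdlib Require Import Reals List Factorial ClassicalEpsilon.
From Coquelicot Require Import Coquelicot.
Import ListNotations.
Open Scope C_scope.

(* The element satisfying [P], when it exists and is unique; unspecified
   otherwise. *)
Definition Cthe (P : C -> Prop) : C := epsilon (inhabits (RtoC 0)) P.

Definition CLim_seq (u : nat -> C) : C :=
  Cthe (fun l => filterlim u eventually (locally l)).

(* Limit over the punctured neighbourhoods of [z]. *)
Definition CLim (f : C -> C) (z : C) : C :=
  Cthe (fun l => filterlim f (locally' z) (locally l)).

Definition Cex_series (a : nat -> C) : Prop :=
  ex_series (K := C_AbsRing) (V := C_NormedModule) a.

Definition CSeries (a : nat -> C) : C :=
  Cthe (fun l => is_series (K := C_AbsRing) (V := C_NormedModule) a l).

Definition holomorphic_on (U : C -> Prop) (f : C -> C) : Prop :=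
  forall z, U z -> ex_derive (K := C_AbsRing) (V := C_NormedModule) f z.

(* [f] itself on [D], and elsewhere the value of the analytic continuation of
   [f] to [U].  That value is unique as soon as [U] is open and connected and
   [D] has an interior point in [U]; it is unspecified outside [U]. *)
Definition analytic_ext (D U : C -> Prop) (f : C -> C) (z : C) : C :=
  if excluded_middle_informative (D z) then f z
  else Cthe (fun w => exists g : C -> C,
    holomorphic_on U g /\ (forall u, D u -> U u -> g u = f u) /\ g z = w).

Definition Cexp (z : C) : C :=
  RtoC (exp (Re z)) * (cos (Im z), sin (Im z)).

(* Principal argument, in (-PI, PI], for [z <> 0]. *)
Definition Carg (z : C) : R :=
  if Rle_dec 0 (Im z) then acos (Re z / Cmod z) else (- acos (Re z / Cmod z))%R.

Definition Clog (z : C) : C := (ln (Cmod z), Carg z).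

(* Principal power, for [z <> 0]; Coquelicot's [Cpow] has exponents in nat. *)
Definition Cpower (z s : C) : C := Cexp (s * Clog z).

Fixpoint poch (z : C) (n : nat) : C :=
  match n with
  | O => 1
  | S m => poch z m * (z + INR m)
  end.

Definition nonpos_int (z : C) : Prop := exists m : nat, z = - INR m.

(* Gauss's product: n! n^z / (z (z+1) ... (z+n)) tends to Gamma z, for [z] not
   a pole. *)
Definition Gamma (z : C) : C :=
  CLim_seq (fun n => INR (fact n) * Cpower (INR n) z / poch z (S n)).

Definition pochs (l : list C) (n : nat) : C :=
  fold_right (fun a p => poch a n * p) (RtoC 1) l.

Definition pFq_term (a b : list C) (z : C) (n : nat) : C :=
  pochs a n / pochs b n * (z ^ n / INR (fact n)).

Definition pFq (a b : list C) (z : C) : C := CSeries (pFq_term a b z).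

Definition slit_plane (z : C) : Prop := ~ (Im z = 0%R /\ (1 <= Re z)%R).

(* On the unit circle the sum of the series, where it converges, agrees with
   the continuation by Abel's theorem; terminating series converge for all [z].
   *)
Definition hyp2F1 (a b c z : C) : C :=
  analytic_ext (fun u => Cex_series (pFq_term [a; b] [c] u)) slit_plane
    (pFq [a; b] [c]) z.

(* 2F1(a, b; c; z) / Gamma(c), by continuity in [c] at the poles of Gamma. *)
Definition reg_hyp2F1 (a b c z : C) : C :=
  if excluded_middle_informative (nonpos_int c)
  then CLim (fun c' => / Gamma c' * hyp2F1 a b c' z) c
  else / Gamma c * hyp2F1 a b c z.

Definition gegenbauer (n : nat) (nu z : C) : C :=
  poch (2 * nu) n / INR (fact n)
  * hyp2F1 (- INR n) (INR n + 2 * nu) (nu + 1 / 2) ((1 - z) / 2).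

(* Associated Legendre function of the first kind, degree [nu] and order [mu],
   for [z] off the cut (-oo, 1]. *)
Definition legendreP (nu mu z : C) : C :=
  Cpower ((z + 1) / (z - 1)) (mu / 2)
  * reg_hyp2F1 (- nu) (nu + 1) (1 - mu) ((1 - z) / 2).

(* Ferrers function of the first kind, for -1 < t < 1. *)
Definition ferrersP (nu mu : C) (t : R) : C :=
  Cpower ((1 + t) / (1 - t)) (mu / 2)
  * reg_hyp2F1 (- nu) (nu + 1) (1 - mu) ((1 - t) / 2).

Definition integrand (n : nat) (alpha mu : C) (nu rho x : R) : C :=
  let r := sqrt (1 + rho ^ 2 - 2 * rho * x) in
  Cpower (1 - x ^ 2)%R (nu - mu / 2 - 1 / 4)
  * legendreP (mu - alpha - 1 / 2) (1 / 2 - mu) (r + rho)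
  * ferrersP (mu - alpha - 1 / 2) (1 / 2 - mu) (r - rho)
  * gegenbauer n nu x.

Definition rhs_formula (n : nat) (alpha : C) (nu rho : R) (mu : C) : C :=
  RtoC (sqrt PI) * Cpower 2 (1 / 2 - mu)
  * poch (2 * nu) n * poch alpha n * poch (2 * mu - alpha) n * poch mu n
  * Gamma (1 / 2 + nu)
  / (poch (2 * mu) n * Gamma (1 / 2 + mu + INR n) * Gamma (1 + nu + INR n)
     * Gamma (1 / 2 + mu) * INR (fact n))
  * Cpower rho (INR n + mu - 1 / 2)
  * pFq [ (alpha + INR n) / 2; (alpha + INR n + 1) / 2;
          (2 * mu - alpha + INR n) / 2; (2 * mu - alpha + INR n + 1) / 2;
          mu + INR n; mu - nu ]
        [ (2 * mu + INR n) / 2; (2 * mu + INR n + 1) / 2;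
          (mu + INR n + 1 / 2) / 2; (mu + INR n + 3 / 2) / 2;
          1 + nu + INR n ]
        (rho ^ 2)%R.

(* [rhs_formula], continued analytically in [mu] to the points where [2 * mu]
   is a nonpositive integer. *)
Definition rhs (n : nat) (alpha : C) (nu rho : R) (mu : C) : C :=
  analytic_ext (fun m => ~ nonpos_int (2 * m)) (fun _ => True)
    (rhs_formula n alpha nu rho) mu.

(* Main.v *)
Require Import Defs.
From Stdlib Require Import Reals Lra Lia ZArith List ClassicalEpsilon.
From Coquelicot Require Import Coquelicot.
Import ListNotations.

(** Put [c = mu + 1/2], [a = alpha], [b = 2 mu - alpha], [s = (1 - R - rho) / 2]
    and [t = (1 - R + rho) / 2], and let [F] be the hypergeometric series in
    [a, b; c] divided by [Gamma c].  Euler's transformation turns both Legendre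
    functions into algebraic factors times [F(s)] and [F(t)].  All algebraic
    factors combine into a constant and the Gegenbauer weight
    [(1 - x^2)^(nu - 1/2)] ([integrand_reduced]), so what has to be computed is
    the Gegenbauer coefficient of [F(s) F(t)] as a function of [x].

    Here [a + b + 1 = 2c], [t - s = rho], [s (1 - t) = - rho (1 - x) / 2] and
    [t (1 - s) = rho (1 + x) / 2].  Bailey's product formula ([bailey]) states
    that [F(s) F(t)] is then a series in [N] of [(a)_N (b)_N rho^N] times a
    Jacobi polynomial in [x] of degree [N] with both parameters equal to
    [c - 1].  Expanding these polynomials into powers of [s] and [t] gives a
    double series that need not converge absolutely for [rho] close to 1, so the
    formula is not read off from coefficients.  Instead, the partial sums satisfy the
    hypergeometric equation in [s] up to an error given by the last term
    ([bsum_ode]); that error tends to 0 by an exponential bound on the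
    polynomials obtained from their three-term recurrence ([jac_bound]); and the
    solutions of the equation that are regular at its singular point [s = 0]
    depend continuously on the value there and on the error
    ([ode_stability], an energy estimate).  At [s = 0] both sides are known.

    The Jacobi polynomials are integrated against the Gegenbauer polynomial by
    parts: Rodrigues' formula lowers the degree of the latter to 0
    ([Iw_jpoly_gpoly]), and a contiguous relation links the remaining integrals
    in steps of two in [N] ([Iw_jpoly]), so that only [N = n + 2k] contributes.
    The total mass of the weight follows from Wallis' product ([wint_rgamma]).
    Summing over [k] gives the closed form whenever [2 mu] is not a nonpositive
    integer ([generic_integral]).

    At the remaining [mu] the left-hand side is still defined, because [1 / Gamma]
    is entire.  It is holomorphic in [mu], hence is the analytic continuation of
    the closed form ([rhs_lhs_value]).  Holomorphy of the series and integrals is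
    obtained from the explicit second-order remainder bounds [tay], which are
    closed under products, limits and integration; the reciprocal Gamma function
    is built with them as Gauss's product. *)

Local Open Scope C_scope.

(** * Complex numbers *)

Lemma Cmod_Im_le (z : C) : (Rabs (Im z) <= Cmod z)%R.
Proof.
  apply Rle_trans with (2 := Rmax_Cmod z). apply Rmax_r.
Qed.

Lemma Cmod_le_ReIm (z : C) : (Cmod z <= Rabs (Re z) + Rabs (Im z))%R.
Proof.
  destruct z as [a b]; simpl.
  replace (a, b) with (RtoC a + RtoC b * Ci) by (apply injective_projections; simpl; ring).
  apply Rle_trans with (1 := Cmod_triangle _ _).
  rewrite Cmod_mult, !Cmod_R, Cmod_Ci. lra.
Qed.

Lemma Cmod_RtoC_pos (x : R) : (0 <= x)%R -> Cmod (RtoC x) = x.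
Proof. intros; rewrite Cmod_R; apply Rabs_pos_eq; assumption. Qed.

Lemma Cmod_INR n : Cmod (INR n) = INR n.
Proof. apply Cmod_RtoC_pos, pos_INR. Qed.

Lemma Cmod_sub_sym (a b : C) : Cmod (a - b) = Cmod (b - a).
Proof. rewrite <- Cmod_opp. f_equal; ring. Qed.

Lemma Cmod_rev_triangle (a b : C) : (Cmod a - Cmod b <= Cmod (a + b))%R.
Proof.
  pose proof (Cmod_triangle (a + b) (- b)) as H. rewrite Cmod_opp in H.
  replace (a + b + - b) with a in H by ring. lra.
Qed.

Lemma Cmod_triangle3 (a b c : C) : (Cmod (a - c) <= Cmod (a - b) + Cmod (b - c))%R.
Proof. replace (a - c) with ((a - b) + (b - c)) by ring. apply Cmod_triangle. Qed.

Lemma Cmod_zero_le (z : C) : (Cmod z <= 0)%R -> z = 0.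
Proof. intros. apply Cmod_eq_0. pose proof (Cmod_ge_0 z). lra. Qed.

Lemma Cmod_pos_neq (z : C) : (0 < Cmod z)%R -> z <> 0.
Proof. intros H E. rewrite E, Cmod_0 in H. lra. Qed.

Lemma RtoC_neq (x : R) : x <> 0%R -> RtoC x <> 0.
Proof. intros H E. apply H. apply RtoC_inj. exact E. Qed.

Lemma Cinv_neq_0 (z : C) : z <> 0 -> / z <> 0.
Proof.
  intros H E. apply (RtoC_neq 1); [lra|]. replace (RtoC 1) with (z * / z) by (field; auto). rewrite E. ring.
Qed.

Lemma Csub_eq (a b : C) : a - b = 0 -> a = b.
Proof. intros H. replace a with ((a - b) + b) by ring. rewrite H. ring. Qed.

Lemma RtoC_S n : RtoC (INR (S n)) = RtoC (INR n) + 1.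
Proof. rewrite S_INR. apply RtoC_plus. Qed.

Lemma RtoC_INR_add m n : RtoC (INR (m + n)) = RtoC (INR m) + RtoC (INR n).
Proof. rewrite plus_INR. apply RtoC_plus. Qed.

Lemma INR_S_neq n : RtoC (INR n) + 1 <> 0.
Proof. rewrite <- RtoC_S. apply RtoC_neq, not_0_INR. lia. Qed.

Lemma fact_neq n : RtoC (INR (fact n)) <> 0.
Proof. apply RtoC_neq, INR_fact_neq_0. Qed.

Lemma nonpos_int_neq (z : C) (k : nat) : ~ nonpos_int z -> z + INR k <> 0.
Proof.
  intros H E. apply H. exists k. replace z with (z + INR k - INR k) by ring. rewrite E. ring.
Qed.

Lemma nonpos_int_shift (z : C) : ~ nonpos_int z -> ~ nonpos_int (z + 1).
Proof.
  intros H [m Hm]. apply H. exists (S m). rewrite RtoC_S.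
  replace z with (z + 1 - 1) by ring. rewrite Hm. ring.
Qed.

Lemma nonpos_int_shiftn (z : C) n : ~ nonpos_int z -> ~ nonpos_int (z + INR n).
Proof.
  intros H [m Hm]. apply H. exists (m + n)%nat. rewrite RtoC_INR_add.
  replace z with (z + INR n - INR n) by ring. rewrite Hm. ring.
Qed.

Lemma Re_not_nonpos_int (z : C) : (0 < Re z)%R -> ~ nonpos_int z.
Proof.
  intros H [m Hm]. rewrite Hm in H. simpl in H. pose proof (pos_INR m). lra.
Qed.

(** * Limits of complex sequences *)

Definition cvg (u : nat -> C) (l : C) : Prop :=
  forall eps, (0 < eps)%R -> exists N, forall n, (N <= n)%nat -> (Cmod (u n - l) < eps)%R.

Lemma cvg_ext (u v : nat -> C) l : (forall n, u n = v n) -> cvg u l -> cvg v l.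
Proof. intros E H eps He. destruct (H eps He) as [N HN]. exists N. intros. rewrite <- E. auto. Qed.

Lemma cvg_ext_ev (u v : nat -> C) l N :
  (forall n, (N <= n)%nat -> u n = v n) -> cvg u l -> cvg v l.
Proof.
  intros E H eps He. destruct (H eps He) as [M HM]. exists (max M N).
  intros. rewrite <- E by lia. apply HM. lia.
Qed.

Lemma cvg_const l : cvg (fun _ => l) l.
Proof.
  intros eps He. exists 0%nat. intros. replace (l - l) with (RtoC 0) by ring. now rewrite Cmod_0.
Qed.

Lemma cvg_unique u l l' : cvg u l -> cvg u l' -> l = l'.
Proof.
  intros H H'. apply Csub_eq, Cmod_eq_0. destruct (Req_dec (Cmod (l - l')) 0) as [E|E]; auto.
  exfalso. pose proof (Cmod_ge_0 (l - l')).
  destruct (H (Cmod (l - l') / 2)%R) as [N HN]; [lra|].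
  destruct (H' (Cmod (l - l') / 2)%R) as [N' HN']; [lra|].
  specialize (HN (max N N') ltac:(lia)). specialize (HN' (max N N') ltac:(lia)).
  pose proof (Cmod_triangle3 l (u (max N N')) l') as T. rewrite (Cmod_sub_sym l (u _)) in T. lra.
Qed.

Lemma cvg_plus u v l m : cvg u l -> cvg v m -> cvg (fun n => u n + v n) (l + m).
Proof.
  intros H K eps He. destruct (H (eps/2)%R) as [N HN]; [lra|]. destruct (K (eps/2)%R) as [M HM]; [lra|].
  exists (max N M). intros n Hn.
  replace (u n + v n - (l + m)) with ((u n - l) + (v n - m)) by ring.
  specialize (HN n ltac:(lia)). specialize (HM n ltac:(lia)).
  pose proof (Cmod_triangle (u n - l) (v n - m)). lra.
Qed.

Lemma cvg_scal k u l : cvg u l -> cvg (fun n => k * u n) (k * l).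
Proof.
  intros H eps He. destruct (H (eps / (Cmod k + 1))%R) as [N HN].
  { pose proof (Cmod_ge_0 k). apply Rdiv_lt_0_compat; lra. }
  exists N. intros n Hn. replace (k * u n - k * l) with (k * (u n - l)) by ring.
  rewrite Cmod_mult. specialize (HN n Hn). pose proof (Cmod_ge_0 k). pose proof (Cmod_ge_0 (u n - l)).
  apply Rle_lt_trans with ((Cmod k) * (eps / (Cmod k + 1)))%R; [apply Rmult_le_compat_l; lra|].
  apply Rlt_le_trans with ((Cmod k + 1) * (eps / (Cmod k + 1)))%R.
  - assert (0 < eps / (Cmod k + 1))%R by (apply Rdiv_lt_0_compat; lra). nra.
  - right. field. lra.
Qed.

Lemma cvg_opp u l : cvg u l -> cvg (fun n => - u n) (- l).
Proof.
  intros H. apply (cvg_scal (-(1))) in H. replace (- l) with (- (1) * l) by ring.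
  eapply cvg_ext; [|exact H]. intros; simpl; ring.
Qed.

Lemma cvg_minus u v l m : cvg u l -> cvg v m -> cvg (fun n => u n - v n) (l - m).
Proof. intros. apply cvg_plus; auto. now apply cvg_opp. Qed.

Lemma cvg_dom u l (e : nat -> R) :
  (forall n, (Cmod (u n - l) <= e n)%R) -> is_lim_seq e 0%R -> cvg u l.
Proof.
  intros H K eps He. apply is_lim_seq_spec in K. destruct (K (mkposreal eps He)) as [N HN].
  exists N. intros n Hn. specialize (HN n Hn). simpl in HN. specialize (H n).
  rewrite Rminus_0_r in HN. pose proof (Rle_abs (e n)). lra.
Qed.

Lemma cvg_Cmod u l : cvg u l -> is_lim_seq (fun n => Cmod (u n)) (Cmod l).
Proof.
  intros H. apply is_lim_seq_spec. intros eps. destruct (H eps (cond_pos eps)) as [N HN].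
  exists N. intros n Hn. specialize (HN n Hn).
  apply Rle_lt_trans with (2 := HN). apply Rabs_le.
  pose proof (Cmod_triangle (u n - l) l). replace (u n - l + l) with (u n) in H0 by ring.
  pose proof (Cmod_triangle (l - u n) (u n)). replace (l - u n + u n) with l in H1 by ring.
  rewrite (Cmod_sub_sym l (u n)) in H1. lra.
Qed.

Lemma cvg_le u l (b : R) : cvg u l -> (forall n, (Cmod (u n) <= b)%R) -> (Cmod l <= b)%R.
Proof.
  intros H Hb. apply (is_lim_seq_le (fun n => Cmod (u n)) (fun _ => b) (Cmod l) b); auto.
  - now apply cvg_Cmod.
  - apply is_lim_seq_const.
Qed.

Lemma cvg_mult u v l m : cvg u l -> cvg v m -> cvg (fun n => u n * v n) (l * m).
Proof.
  intros H K.
  assert (A : is_lim_seq (fun n => Cmod (u n - l)) 0%R).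
  { replace 0%R with (Cmod (l - l)).
    apply cvg_Cmod. apply cvg_minus; auto using cvg_const. replace (l - l) with (RtoC 0) by ring. apply Cmod_0. }
  assert (B : is_lim_seq (fun n => Cmod (v n - m)) 0%R).
  { replace 0%R with (Cmod (m - m)).
    apply cvg_Cmod. apply cvg_minus; auto using cvg_const. replace (m - m) with (RtoC 0) by ring. apply Cmod_0. }
  apply cvg_dom with (fun n => Cmod (u n - l) * Cmod (v n) + Cmod l * Cmod (v n - m))%R.
  - intros n. replace (u n * v n - l * m) with ((u n - l) * v n + l * (v n - m)) by ring.
    rewrite <- !Cmod_mult. apply Cmod_triangle.
  - replace 0%R with (0 * Cmod m + Cmod l * 0)%R by ring.
    apply is_lim_seq_plus'; apply is_lim_seq_mult'; auto using cvg_Cmod, is_lim_seq_const.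
Qed.

Lemma cvg_shift u l k : cvg u l -> cvg (fun n => u (n + k)%nat) l.
Proof.
  intros H eps He. destruct (H eps He) as [N HN]. exists N. intros. apply HN. lia.
Qed.

Lemma cvg_unshift u l k : cvg (fun n => u (n + k)%nat) l -> cvg u l.
Proof.
  intros H eps He. destruct (H eps He) as [N HN]. exists (N + k)%nat. intros n Hn.
  replace n with (n - k + k)%nat by lia. apply HN. lia.
Qed.

Lemma cvg_bounded u l : cvg u l -> exists B, (0 <= B)%R /\ forall n, (Cmod (u n) <= B)%R.
Proof.
  intros H. destruct (H 1%R Rlt_0_1) as [N HN].
  assert (F : exists B, (0 <= B)%R /\ forall n, (n < N)%nat -> (Cmod (u n) <= B)%R).
  { clear HN. induction N as [|N [B [HB IH]]].
    - exists 0%R. split; [lra|]. intros; lia.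
    - exists (Rmax B (Cmod (u N))). split; [eapply Rle_trans; [exact HB|apply Rmax_l]|].
      intros n Hn. destruct (Nat.eq_dec n N) as [->|E]; [apply Rmax_r|].
      eapply Rle_trans; [apply IH; lia|apply Rmax_l]. }
  destruct F as [B [HB F]]. exists (B + Cmod l + 1)%R. pose proof (Cmod_ge_0 l). split; [lra|].
  intros n. destruct (Nat.lt_ge_cases n N) as [Hn|Hn].
  - specialize (F n Hn). lra.
  - specialize (HN n Hn). pose proof (Cmod_triangle (u n - l) l).
    replace (u n - l + l) with (u n) in H1 by ring. lra.
Qed.

(** The uniform structure of [C] is that of the product, so its balls are
    squares; both lemmas below only change squares into discs. *)
Lemma locally_Cmod (l : C) (P : C -> Prop) :
  locally l P <-> exists eps, (0 < eps)%R /\ forall z, (Cmod (z - l) < eps)%R -> P z.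
Proof.
  split.
  - intros [e He]. exists e. split; [apply cond_pos|]. intros z Hz. apply He.
    apply C_NormedModule_mixin_compat1. exact Hz.
  - intros [e [He H]]. assert (Hs : (0 < sqrt 2)%R) by (apply sqrt_lt_R0; lra).
    assert (P' : (0 < e / sqrt 2)%R) by (apply Rdiv_lt_0_compat; auto).
    exists (mkposreal _ P'). intros z Hz. apply H.
    apply C_NormedModule_mixin_compat2 in Hz. simpl in Hz.
    replace (sqrt 2 * (e / sqrt 2))%R with e in Hz by (field; lra). exact Hz.
Qed.

Lemma cvg_filterlim u l : cvg u l <-> filterlim u eventually (locally (l : C)).
Proof.
  split.
  - intros H P HP. apply locally_Cmod in HP. destruct HP as [e [He HP]].
    destruct (H e He) as [N HN]. exists N. intros n Hn. apply HP, HN, Hn.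
  - intros H eps He. apply (H (fun z => (Cmod (z - l) < eps)%R)).
    apply locally_Cmod. exists eps; auto.
Qed.

Lemma Cthe_unique (P : C -> Prop) l : P l -> (forall l', P l' -> l' = l) -> Cthe P = l.
Proof. intros H U. apply U. unfold Cthe. apply epsilon_spec. now exists l. Qed.

Lemma CLim_seq_eq u l : cvg u l -> CLim_seq u = l.
Proof.
  intros H. apply Cthe_unique. now apply cvg_filterlim.
  intros l' H'. apply cvg_filterlim in H'. eapply cvg_unique; eauto.
Qed.

Lemma CLim_eq (f : C -> C) (z l : C) :
  (forall eps, (0 < eps)%R -> exists d, (0 < d)%R /\
     forall u, u <> z -> (Cmod (u - z) < d)%R -> (Cmod (f u - l) < eps)%R) ->
  CLim f z = l.
Proof.
  intros H. assert (L : filterlim f (locally' z) (locally l)).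
  { intros P HP. apply locally_Cmod in HP. destruct HP as [e [He HP]].
    destruct (H e He) as [d [Hd K]]. unfold filtermap, locally', within.
    apply locally_Cmod. exists d. split; auto. }
  apply Cthe_unique; auto. intros l' H'.
  apply is_C_lim_unique in L. apply is_C_lim_unique in H'. congruence.
Qed.

(** * Finite sums and series *)

Fixpoint csum (f : nat -> C) (n : nat) : C :=
  match n with O => 0 | S m => csum f m + f m end.

Lemma csum_ext f g n : (forall i, (i < n)%nat -> f i = g i) -> csum f n = csum g n.
Proof.
  induction n as [|n IH]; intros H; simpl; auto. rewrite IH, H; auto.
Qed.

Lemma csum_plus f g n : csum (fun i => f i + g i) n = csum f n + csum g n.
Proof. induction n as [|n IH]; simpl. ring. rewrite IH. ring. Qed.

Lemma csum_scal k f n : csum (fun i => k * f i) n = k * csum f n.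
Proof. induction n as [|n IH]; simpl. ring. rewrite IH. ring. Qed.

Lemma csum_minus f g n : csum (fun i => f i - g i) n = csum f n - csum g n.
Proof. induction n as [|n IH]; simpl. ring. rewrite IH. ring. Qed.

Lemma csum_S0 f n : csum f (S n) = f O + csum (fun i => f (S i)) n.
Proof. induction n as [|n IH]; simpl. ring. simpl in IH. rewrite IH. ring. Qed.

Lemma csum_telescope f n : csum (fun i => f (S i) - f i) n = f n - f O.
Proof. induction n as [|n IH]; simpl. ring. rewrite IH. ring. Qed.

Lemma csum_zero (f : nat -> C) n : (forall i, (i < n)%nat -> f i = 0) -> csum f n = 0.
Proof.
  induction n as [|n IH]; intros H; simpl; auto. rewrite IH, H; auto. ring.
Qed.

Lemma Cmod_csum_le f (M : nat -> R) n :
  (forall i, (i < n)%nat -> (Cmod (f i) <= M i)%R) ->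
  (Cmod (csum f (S n)) <= sum_n M n + (Cmod (f n) - M n))%R.
Proof.
  induction n as [|n IH]; intros H.
  - rewrite sum_O. simpl. replace (0 + f 0%nat) with (f 0%nat) by ring. lra.
  - rewrite sum_Sn. unfold plus; simpl Hierarchy.plus.
    change (csum f (S (S n))) with (csum f (S n) + f (S n)).
    pose proof (Cmod_triangle (csum f (S n)) (f (S n))).
    specialize (IH (fun i Hi => H i (Nat.lt_lt_succ_r _ _ Hi))).
    specialize (H n ltac:(lia)). change AbelianMonoid.sort with AbelianMonoid.sort in *. simpl in *. lra.
Qed.

Lemma csum_sum_n f n : csum f (S n) = sum_n (G := C_AbelianMonoid) f n.
Proof.
  induction n as [|n IH].
  - rewrite sum_O. simpl. ring.
  - rewrite sum_Sn. rewrite <- IH. reflexivity.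
Qed.

Definition cseries (a : nat -> C) (l : C) : Prop := cvg (csum a) l.

Lemma cseries_is_series a l :
  cseries a l <-> is_series (K := C_AbsRing) (V := C_NormedModule) a l.
Proof.
  split; intros H.
  - apply (proj1 (cvg_filterlim (sum_n (G := C_AbelianMonoid) a) l)).
    apply (cvg_shift _ _ 1) in H. eapply cvg_ext; [|exact H].
    intros n; simpl. rewrite Nat.add_1_r. apply csum_sum_n.
  - apply (proj2 (cvg_filterlim (sum_n (G := C_AbelianMonoid) a) l)) in H.
    apply (cvg_unshift _ _ 1). eapply cvg_ext; [|exact H].
    intros n; simpl. rewrite Nat.add_1_r. symmetry. apply csum_sum_n.
Qed.

Lemma cseries_unique a l l' : cseries a l -> cseries a l' -> l = l'.
Proof. apply cvg_unique. Qed.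

Lemma CSeries_eq a l : cseries a l -> CSeries a = l.
Proof.
  intros H. apply Cthe_unique. now apply cseries_is_series.
  intros l' H'. apply cseries_is_series in H'. eapply cseries_unique; eauto.
Qed.

Lemma cseries_Cex a l : cseries a l -> Cex_series a.
Proof. intros H. exists l. now apply cseries_is_series. Qed.

Lemma cseries_ext a b l : (forall n, a n = b n) -> cseries a l -> cseries b l.
Proof. intros E. apply cvg_ext. intros n. apply csum_ext. auto. Qed.

Lemma cseries_scal k a l : cseries a l -> cseries (fun n => k * a n) (k * l).
Proof.
  intros H. eapply cvg_ext; [|apply cvg_scal; exact H]. intros n; simpl. now rewrite csum_scal.
Qed.

Lemma cseries_minus a b l m : cseries a l -> cseries b m -> cseries (fun n => a n - b n) (l - m).
Proof.
  intros H K. eapply cvg_ext; [|apply cvg_minus; [exact H|exact K]].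
  intros n; simpl. now rewrite csum_minus.
Qed.

Lemma cseries_finite (a : nat -> C) n : (forall k, (n <= k)%nat -> a k = 0) -> cseries a (csum a n).
Proof.
  intros H. apply cvg_ext_ev with (u := fun _ => csum a n) (N := n); [|apply cvg_const].
  intros m Hm. induction Hm as [|m Hm IH]; auto. simpl. rewrite <- IH, H by lia. ring.
Qed.

Lemma cseries_drop a l n : cseries a l -> cseries (fun k => a (n + k)%nat) (l - csum a n).
Proof.
  intros H. assert (E : forall m, csum a (m + n) - csum a n = csum (fun k => a (n + k)%nat) m).
  { induction m as [|m IH]; simpl. ring. rewrite <- IH. rewrite (Nat.add_comm n m). ring. }
  eapply cvg_ext; [exact E|]. apply cvg_minus; [|apply cvg_const]. now apply cvg_shift.
Qed.

Lemma series_dom a (M : nat -> R) :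
  (forall n, (Cmod (a n) <= M n)%R) -> ex_series M ->
  exists l, cseries a l /\ (Cmod l <= Series M)%R.
Proof.
  intros H HM. destruct (ex_series_le (V := C_CompleteNormedModule) a M H HM) as [l Hl].
  assert (L : cseries a l) by (apply cseries_is_series; exact Hl).
  exists l. split; auto. apply cvg_le with (csum a); auto.
  assert (P : forall n, (0 <= M n)%R) by (intros n; eapply Rle_trans; [apply Cmod_ge_0|apply H]).
  intros [|n].
  - simpl. rewrite Cmod_0. apply Rle_trans with (sum_n M 0).
    + rewrite sum_O. apply P.
    + pose proof (Series_correct _ HM) as SM.
      apply (is_lim_seq_incr_compare (sum_n M) (Series M) SM). intros k; rewrite sum_Sn; unfold plus; simpl.
      specialize (P (S k)); lra.
  - apply Rle_trans with (sum_n M n).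
    + pose proof (Cmod_csum_le a M n (fun i _ => H i)). specialize (H n). lra.
    + pose proof (Series_correct _ HM) as SM.
      apply (is_lim_seq_incr_compare (sum_n M) (Series M) SM). intros k; rewrite sum_Sn; unfold plus; simpl.
      specialize (P (S k)); lra.
Qed.

(** * Complex-valued functions of a real variable *)

Definition cder (f : R -> C) (t : R) (l : C) : Prop :=
  is_derive (fun t => Re (f t)) t (Re l) /\ is_derive (fun t => Im (f t)) t (Im l).

Lemma cder_ext f g t l : (forall x, f x = g x) -> cder f t l -> cder g t l.
Proof.
  intros E [H K]. split; (eapply is_derive_ext; [intros x; rewrite <- E; reflexivity|assumption]).
Qed.

Lemma cder_eq f t l l' : l = l' -> cder f t l -> cder f t l'.
Proof. intros ->; auto. Qed.

Lemma cder_unique f t l l' : cder f t l -> cder f t l' -> l = l'.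
Proof.
  intros [H1 H2] [K1 K2]. apply is_derive_unique in H1, H2, K1, K2.
  apply injective_projections; [unfold Re in *|unfold Im in *]; congruence.
Qed.

Lemma cder_const k t : cder (fun _ => k) t 0.
Proof. split; apply (is_derive_const (V := R_NormedModule)). Qed.

Lemma cder_plus f g t l m : cder f t l -> cder g t m -> cder (fun t => f t + g t) t (l + m).
Proof. intros [H1 H2] [K1 K2]. split; simpl; apply (is_derive_plus (V := R_NormedModule)); assumption. Qed.

Lemma is_derive_mult_R f g t l m : is_derive f t l -> is_derive g t m ->
  is_derive (fun t => f t * g t)%R t (l * g t + f t * m)%R.
Proof. intros H K. apply (is_derive_mult f g t l m H K). intros; apply Rmult_comm. Qed.

Lemma cder_mult f g t l m : cder f t l -> cder g t m ->
  cder (fun t => f t * g t) t (l * g t + f t * m).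
Proof.
  intros [H1 H2] [K1 K2]. split; simpl.
  - eapply is_derive_ext_loc; [apply filter_forall; intros; reflexivity|].
    evar_last. apply (is_derive_minus (V := R_NormedModule)).
    + apply is_derive_mult_R; [exact H1|exact K1].
    + apply is_derive_mult_R; [exact H2|exact K2].
    + unfold minus, plus, opp; simpl. unfold Re, Im. ring.
  - evar_last. apply (is_derive_plus (V := R_NormedModule)).
    + apply is_derive_mult_R; [exact H1|exact K2].
    + apply is_derive_mult_R; [exact H2|exact K1].
    + unfold plus; simpl. unfold Re, Im. ring.
Qed.

Lemma cder_scal k f t l : cder f t l -> cder (fun t => k * f t) t (k * l).
Proof.
  intros H. eapply cder_eq; [|apply cder_mult; [apply cder_const|exact H]]. simpl; ring.
Qed.

Lemma cder_minus f g t l m : cder f t l -> cder g t m -> cder (fun t => f t - g t) t (l - m).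
Proof.
  intros H K. apply cder_plus; auto. apply (cder_scal (-(1))) in K.
  eapply cder_eq; [|eapply cder_ext; [|exact K]]. ring. intros; simpl; ring.
Qed.

Lemma cder_RtoC f t l : is_derive f t l -> cder (fun t => RtoC (f t)) t (RtoC l).
Proof. intros H. split; simpl; auto. apply (is_derive_const (V := R_NormedModule)). Qed.

Lemma cder_id t : cder (fun t => RtoC t) t 1.
Proof. apply cder_RtoC. apply (is_derive_id (K := R_AbsRing)). Qed.

Lemma cder_csum f f' n t : (forall i, (i < n)%nat -> cder (f i) t (f' i)) ->
  cder (fun t => csum (fun i => f i t) n) t (csum f' n).
Proof.
  induction n as [|n IH]; intros H; simpl. apply cder_const.
  apply cder_plus; auto.
Qed.

Lemma Re_conj_mult_le (a b : C) : (Re a * Re b + Im a * Im b <= Cmod a * Cmod b)%R.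
Proof.
  rewrite <- (Cmod_conj a), <- Cmod_mult. eapply Rle_trans; [|apply re_le_Cmod]. eapply Rle_trans; [|apply Rle_abs].
  right. destruct a, b; simpl; ring.
Qed.

(** Sharp, unlike a componentwise estimate: project on the direction of the
    increment and apply the real theorem. *)
Lemma cder_MVI f f' a b D : (a <= b)%R ->
  (forall t, (a <= t <= b)%R -> cder f t (f' t)) ->
  (forall t, (a <= t <= b)%R -> (Cmod (f' t) <= D)%R) ->
  (Cmod (f b - f a) <= D * (b - a))%R.
Proof.
  intros Hab Hf HD. set (w := f b - f a).
  destruct (MVT_gen (fun t => Re w * Re (f t) + Im w * Im (f t))%R a b
     (fun t => Re w * Re (f' t) + Im w * Im (f' t))%R) as [c [Hc E]].
  - rewrite Rmin_left, Rmax_right by auto. intros x Hx.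
    destruct (Hf x ltac:(lra)) as [H1 H2].
    apply (is_derive_plus (V := R_NormedModule)); apply (is_derive_scal (fun t => _) x); assumption.
  - rewrite Rmin_left, Rmax_right by auto. intros x Hx.
    destruct (Hf x ltac:(lra)) as [H1 H2].
    apply continuity_pt_filterlim.
    apply (ex_derive_continuous (V := R_NormedModule) (fun t => Re w * Re (f t) + Im w * Im (f t))%R).
    eexists. apply (is_derive_plus (V := R_NormedModule)); apply (is_derive_scal (fun t => _) x); eassumption.
  - rewrite Rmin_left, Rmax_right in Hc by auto.
    assert (E1 : (Re w * Re (f b) + Im w * Im (f b) - (Re w * Re (f a) + Im w * Im (f a)) = Cmod w ^ 2)%R).
    { rewrite Cmod2_alt. unfold w. simpl. unfold Re, Im; simpl. ring. }
    pose proof (Re_conj_mult_le w (f' c)) as E2.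
    rewrite E1 in E. specialize (HD c Hc). pose proof (Cmod_ge_0 w) as Hw.
    assert (P : (Cmod w * Cmod w <= Cmod w * (D * (b - a)))%R).
    { apply Rle_trans with (Cmod w ^ 2)%R; [right; ring|]. rewrite E.
      apply Rle_trans with (Cmod w * Cmod (f' c) * (b - a))%R; [nra|].
      rewrite <- Rmult_assoc. apply Rmult_le_compat_r; [lra|]. apply Rmult_le_compat_l; auto. }
    destruct (Req_dec (Cmod w) 0) as [Z|Z].
    + rewrite Z. pose proof (Cmod_ge_0 (f' c)). apply Rmult_le_pos; lra.
    + apply Rmult_le_reg_l with (Cmod w); lra.
Qed.

(** * The complex exponential *)

Lemma Cexp_plus a b : Cexp (a + b) = Cexp a * Cexp b.
Proof.
  destruct a as [a1 a2], b as [b1 b2]. unfold Cexp; simpl. rewrite exp_plus, cos_plus, sin_plus.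
  apply injective_projections; simpl; ring.
Qed.

Lemma Cexp_0 : Cexp 0 = 1.
Proof. unfold Cexp; simpl. rewrite exp_0, cos_0, sin_0. apply injective_projections; simpl; ring. Qed.

Lemma Cexp_RtoC x : Cexp (RtoC x) = RtoC (exp x).
Proof. unfold Cexp; simpl. rewrite cos_0, sin_0. apply injective_projections; simpl; ring. Qed.

Lemma Cmod_Cexp z : Cmod (Cexp z) = exp (Re z).
Proof.
  unfold Cexp. rewrite Cmod_mult, Cmod_R, (Rabs_pos_eq (exp _)) by (left; apply exp_pos).
  unfold Cmod; simpl. pose proof (sin2_cos2 (Im z)) as H. unfold Rsqr in H.
  replace (_ + _)%R with 1%R by lra. rewrite sqrt_1. ring.
Qed.

Lemma Cexp_neq_0 z : Cexp z <> 0.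
Proof. apply Cmod_pos_neq. rewrite Cmod_Cexp. apply exp_pos. Qed.

Lemma Cexp_opp z : Cexp (- z) = / Cexp z.
Proof.
  assert (H : Cexp (- z) * Cexp z = 1).
  { rewrite <- Cexp_plus, <- Cexp_0. f_equal; ring. }
  pose proof (Cexp_neq_0 z). replace (/ Cexp z) with (Cexp (- z) * Cexp z * / Cexp z) by (rewrite H; ring).
  field. auto.
Qed.

Lemma Cmod_Cexp_le z : (Cmod (Cexp z) <= exp (Cmod z))%R.
Proof.
  rewrite Cmod_Cexp. destruct (Rle_lt_or_eq_dec (Re z) (Cmod z)) as [H|H].
  - eapply Rle_trans; [apply Rle_abs|apply re_le_Cmod].
  - left. now apply exp_increasing.
  - rewrite H. lra.
Qed.

Lemma exp_le x y : (x <= y)%R -> (exp x <= exp y)%R.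
Proof. intros [H| ->]; [left; now apply exp_increasing|lra]. Qed.

Lemma cder_Cexp f t l : cder f t l -> cder (fun t => Cexp (f t)) t (l * Cexp (f t)).
Proof.
  intros [H K]. set (F1 := fun t => Re (f t)) in *. set (F2 := fun t => Im (f t)) in *.
  unfold Cexp. split; simpl.
  - apply (is_derive_ext (fun t => exp (F1 t) * cos (F2 t))%R).
    { intros x; unfold F1, F2; simpl; ring. }
    evar_last. apply is_derive_mult_R.
    + apply (is_derive_comp (V := R_NormedModule) exp F1); [apply is_derive_Reals, derivable_pt_lim_exp|exact H].
    + apply (is_derive_comp (V := R_NormedModule) cos F2); [apply is_derive_Reals, derivable_pt_lim_cos|exact K].
    + unfold scal; simpl. unfold mult; simpl. unfold F1, F2, Re, Im. ring.
  - apply (is_derive_ext (fun t => exp (F1 t) * sin (F2 t))%R).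
    { intros x; unfold F1, F2; simpl; ring. }
    evar_last. apply is_derive_mult_R.
    + apply (is_derive_comp (V := R_NormedModule) exp F1); [apply is_derive_Reals, derivable_pt_lim_exp|exact H].
    + apply (is_derive_comp (V := R_NormedModule) sin F2); [apply is_derive_Reals, derivable_pt_lim_sin|exact K].
    + unfold scal; simpl. unfold mult; simpl. unfold F1, F2, Re, Im. ring.
Qed.

Lemma cder_Cexp_line w t : cder (fun t => Cexp (RtoC t * w)) t (w * Cexp (RtoC t * w)).
Proof.
  apply cder_Cexp. eapply cder_eq; [|apply cder_mult; [apply cder_id|apply cder_const]]. simpl; ring.
Qed.

Lemma Cexp_line_le w t : (0 <= t <= 1)%R -> (Cmod (Cexp (RtoC t * w)) <= exp (Cmod w))%R.
Proof.
  intros Ht. eapply Rle_trans; [apply Cmod_Cexp_le|]. apply exp_le.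
  rewrite Cmod_mult, Cmod_RtoC_pos by lra. pose proof (Cmod_ge_0 w). nra.
Qed.

Lemma Cexp_sub1_line w t : (0 <= t <= 1)%R ->
  (Cmod (Cexp (RtoC t * w) - 1) <= Cmod w * exp (Cmod w))%R.
Proof.
  intros Ht. pose proof (cder_MVI (fun t => Cexp (RtoC t * w)) (fun t => w * Cexp (RtoC t * w)) 0 t
    (Cmod w * exp (Cmod w)) (proj1 Ht) (fun t _ => cder_Cexp_line w t)) as H. cbv beta in H.
  replace (RtoC 0 * w)%C with (RtoC 0) in H by ring. rewrite Cexp_0 in H.
  eapply Rle_trans; [apply H|].
  - intros x Hx. rewrite Cmod_mult. apply Rmult_le_compat_l; [apply Cmod_ge_0|].
    apply Cexp_line_le. lra.
  - pose proof (Cmod_ge_0 w). pose proof (exp_pos (Cmod w)).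
    assert (0 <= Cmod w * exp (Cmod w))%R by (apply Rmult_le_pos; lra). nra.
Qed.

Lemma Cexp_sub1_le w : (Cmod (Cexp w - 1) <= Cmod w * exp (Cmod w))%R.
Proof.
  pose proof (Cexp_sub1_line w 1 ltac:(lra)) as H. now replace (RtoC 1 * w) with w in H by ring.
Qed.

Lemma Cexp_sub1w_le w : (Cmod (Cexp w - 1 - w) <= Cmod w ^ 2 * exp (Cmod w))%R.
Proof.
  pose proof (cder_MVI (fun t => Cexp (RtoC t * w) - 1 - RtoC t * w) (fun t => w * (Cexp (RtoC t * w) - 1)) 0 1
    (Cmod w ^ 2 * exp (Cmod w)) Rle_0_1) as H. cbv beta in H.
  replace (RtoC 1 * w) with w in H by ring. replace (RtoC 0 * w)%C with (RtoC 0) in H by ring.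
  rewrite Cexp_0 in H. replace (Cexp w - 1 - w - (1 - 1 - 0)) with (Cexp w - 1 - w) in H by ring.
  eapply Rle_trans; [apply H|simpl; lra].
  - intros t _. eapply cder_eq; [|apply cder_minus; [apply cder_minus; [apply cder_Cexp_line|apply cder_const]|]].
    2: apply cder_mult; [apply cder_id|apply cder_const]. simpl; ring.
  - intros t Ht. rewrite Cmod_mult. pose proof (Cexp_sub1_line w t Ht). pose proof (Cmod_ge_0 w).
    replace (Cmod w ^ 2 * exp (Cmod w))%R with (Cmod w * (Cmod w * exp (Cmod w)))%R by ring.
    apply Rmult_le_compat_l; auto.
Qed.

Lemma Cpower_pos x s : (0 < x)%R -> Cpower (RtoC x) s = Cexp (s * RtoC (ln x)).
Proof.
  intros Hx. unfold Cpower, Clog, Carg. f_equal. f_equal.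
  rewrite Cmod_RtoC_pos by lra. simpl.
  destruct (Rle_dec 0 0) as [_|H]; [|exfalso; lra].
  replace (x / x)%R with 1%R by (field; lra). rewrite acos_1. reflexivity.
Qed.

Lemma Cpower_real x y : (0 < x)%R -> Cpower (RtoC x) (RtoC y) = RtoC (Rpower x y).
Proof.
  intros Hx. rewrite Cpower_pos by auto. rewrite <- RtoC_mult, Cexp_RtoC. reflexivity.
Qed.

Lemma Cpower_plus x s s' : (0 < x)%R -> Cpower (RtoC x) (s + s') = Cpower (RtoC x) s * Cpower (RtoC x) s'.
Proof. intros Hx. rewrite !Cpower_pos by auto. rewrite <- Cexp_plus. f_equal. ring. Qed.

Lemma Cpower_0 x : (0 < x)%R -> Cpower (RtoC x) 0 = 1.
Proof. intros. rewrite Cpower_pos by auto. replace (0 * RtoC (ln x)) with (RtoC 0) by ring. apply Cexp_0. Qed.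

Lemma Cpower_neq_0 x s : (0 < x)%R -> Cpower (RtoC x) s <> 0.
Proof. intros. rewrite Cpower_pos by auto. apply Cexp_neq_0. Qed.

Lemma Cpower_1 x : (0 < x)%R -> Cpower (RtoC x) 1 = RtoC x.
Proof. intros. rewrite Cpower_real by auto. now rewrite Rpower_1. Qed.

Lemma Cpower_nat x n : (0 < x)%R -> Cpower (RtoC x) (INR n) = RtoC x ^ n.
Proof. intros. rewrite Cpower_real by auto. rewrite Rpower_pow by auto. apply RtoC_pow. Qed.

(** * Geometric majorants *)

Lemma ex_series_geom_scal K q : (0 <= q < 1)%R -> ex_series (fun k => K * q ^ k)%R.
Proof.
  intros H. apply (ex_series_scal (V := R_NormedModule) K). apply ex_series_geom.
  rewrite Rabs_pos_eq; lra.
Qed.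

(** The constant absorbs the terms of small index. *)
Lemma geom_of_ratio (b : nat -> R) (q : R) (n0 : nat) : (0 < q)%R ->
  (forall n, (n0 <= n)%nat -> (b (S n) <= q * b n)%R) ->
  exists K, (0 <= K)%R /\ forall n, (b n <= K * q ^ n)%R.
Proof.
  intros Hq H.
  assert (F : forall m, exists K, (0 <= K)%R /\ forall n, (n <= m)%nat -> (b n <= K * q ^ n)%R).
  { induction m as [|m [K [HK IH]]].
    - exists (Rabs (b 0%nat)). split; [apply Rabs_pos|]. intros n Hn. replace n with 0%nat by lia.
      simpl. rewrite Rmult_1_r. apply Rle_abs.
    - exists (Rmax K (Rabs (b (S m)) / q ^ S m)). split; [eapply Rle_trans; [exact HK|apply Rmax_l]|].
      assert (Hp : forall n, (0 < q ^ n)%R) by (intros; now apply pow_lt).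
      intros n Hn. destruct (Nat.eq_dec n (S m)) as [->|E].
      + apply Rle_trans with (Rabs (b (S m)) / q ^ S m * q ^ S m)%R.
        * unfold Rdiv. rewrite Rmult_assoc, Rinv_l by (specialize (Hp (S m)); lra).
          rewrite Rmult_1_r. apply Rle_abs.
        * apply Rmult_le_compat_r; [left; apply Hp|apply Rmax_r].
      + eapply Rle_trans; [apply IH; lia|]. apply Rmult_le_compat_r; [left; apply Hp|apply Rmax_l]. }
  destruct (F n0) as [K [HK HF]]. exists K. split; auto.
  intros n. destruct (Nat.le_gt_cases n n0) as [Hn|Hn]; auto.
  induction n as [|n IH]; [lia|]. destruct (Nat.eq_dec n n0) as [->|E].
  - eapply Rle_trans; [apply H; lia|]. simpl. specialize (HF n0 (Nat.le_refl _)). nra.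
  - eapply Rle_trans; [apply H; lia|]. simpl. specialize (IH ltac:(lia)). nra.
Qed.

(** Every ratio met below is a product of such quotients. *)
Lemma ratio_eventually (A D q : R) : (1 < q)%R ->
  exists n0, forall n, (n0 <= n)%nat -> (A + INR n <= q * (INR n - D) /\ 1 <= INR n - D)%R.
Proof.
  intros Hq. set (x := ((Rabs A + q * (Rabs D + 1)) / (q - 1) + Rabs D + 1)%R).
  exists (Z.to_nat (up x)). intros n Hn.
  assert (Hx : (x <= INR n)%R).
  { apply le_INR in Hn. apply Rle_trans with (2 := Hn). rewrite INR_IZR_INZ.
    assert (0 <= x)%R. { unfold x. pose proof (Rabs_pos A). pose proof (Rabs_pos D).
      assert (0 <= (Rabs A + q * (Rabs D + 1)) / (q - 1))%R; [|lra].
      apply Rmult_le_pos; [nra|left; apply Rinv_0_lt_compat; lra]. }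
    pose proof (archimed x) as [H1 _].
    rewrite Z2Nat.id. lra. apply le_IZR. lra. }
  pose proof (Rle_abs A). pose proof (Rle_abs D). pose proof (Rabs_pos A). pose proof (Rabs_pos D).
  assert (Hy : (0 <= (Rabs A + q * (Rabs D + 1)) / (q - 1))%R).
  { apply Rmult_le_pos; [nra|left; apply Rinv_0_lt_compat; lra]. }
  assert (E : ((Rabs A + q * (Rabs D + 1)) / (q - 1) * (q - 1) = Rabs A + q * (Rabs D + 1))%R) by (field; lra).
  unfold x in Hx. split; [|lra]. nra.
Qed.

(** A bound [K q^n] is often split between two factors. *)
Lemma exists_sqrt q : (1 < q)%R -> exists r, (1 < r)%R /\ (r * r = q)%R.
Proof.
  intros Hq. exists (sqrt q). split; [|apply sqrt_sqrt; lra]. rewrite <- sqrt_1. apply sqrt_lt_1; lra.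
Qed.

(** * Quantitative complex differentiability *)

(** [M] bounds the sum of the value, the derivative and the second-order
    remainder on the unit disc.  That sum is submultiplicative and passes to
    limits, so it stands in for Cauchy's estimates: a series of holomorphic
    terms is differentiated by adding up their constants [M]. *)
Definition tay (f : C -> C) (z d : C) (M : R) : Prop :=
  (Cmod (f z) + Cmod d <= M)%R /\
  forall h, (Cmod h <= 1)%R ->
    (Cmod (f (z + h)%C - f z - h * d) <= (M - Cmod (f z) - Cmod d) * Cmod h ^ 2)%R.

Lemma tay_ext f g z d M : (forall u, f u = g u) -> tay f z d M -> tay g z d M.
Proof.
  intros E [H K]. split. now rewrite <- E. intros h Hh. rewrite <- !E. auto.
Qed.

Lemma tay_deq f z d d' M : d = d' -> tay f z d M -> tay f z d' M.
Proof. intros ->; auto. Qed.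

Lemma tay_weaken f z d M M' : (M <= M')%R -> tay f z d M -> tay f z d M'.
Proof.
  intros L [H K]. split. lra. intros h Hh. eapply Rle_trans; [apply K; auto|].
  apply Rmult_le_compat_r; [apply pow2_ge_0|lra].
Qed.

Lemma tay_incr_bound f z d M h : tay f z d M -> (Cmod h <= 1)%R ->
  (Cmod (f (z + h)%C - f z) <= (M - Cmod (f z)) * Cmod h)%R.
Proof.
  intros [H K] Hh. specialize (K h Hh).
  replace (f (z + h) - f z) with ((f (z + h) - f z - h * d) + h * d) by ring.
  eapply Rle_trans; [apply Cmod_triangle|]. rewrite Cmod_mult.
  pose proof (Cmod_ge_0 h). pose proof (Cmod_ge_0 d).
  assert (Cmod h ^ 2 <= Cmod h)%R by nra.
  assert ((M - Cmod (f z) - Cmod d) * Cmod h ^ 2 <= (M - Cmod (f z) - Cmod d) * Cmod h)%R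
    by (apply Rmult_le_compat_l; lra). lra.
Qed.

Lemma tay_bound f z d M h : tay f z d M -> (Cmod h <= 1)%R -> (Cmod (f (z + h)%C) <= M)%R.
Proof.
  intros T Hh. pose proof (tay_incr_bound _ _ _ _ _ T Hh) as K. destruct T as [H _].
  pose proof (Cmod_triangle (f (z + h) - f z) (f z)) as L.
  replace (f (z + h) - f z + f z) with (f (z + h)) in L by ring.
  pose proof (Cmod_ge_0 h). pose proof (Cmod_ge_0 d). nra.
Qed.

Lemma tay_bound0 f z d M : tay f z d M -> (Cmod (f z) <= M)%R.
Proof. intros [H _]. pose proof (Cmod_ge_0 d). lra. Qed.

Lemma tay_pos f z d M : tay f z d M -> (0 <= M)%R.
Proof. intros H. apply tay_bound0 in H. pose proof (Cmod_ge_0 (f z)). lra. Qed.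

Lemma tay_const k z : tay (fun _ => k) z 0 (Cmod k).
Proof.
  split; rewrite Cmod_0. lra. intros h Hh.
  replace (k - k - h * 0) with (RtoC 0) by ring. rewrite Cmod_0. lra.
Qed.

Lemma tay_lin a b z : tay (fun u => a * u + b) z a (Cmod (a * z + b) + Cmod a).
Proof.
  split. lra. intros h Hh.
  replace (a * (z + h) + b - (a * z + b) - h * a) with (RtoC 0) by ring. rewrite Cmod_0. lra.
Qed.

Lemma tay_plus f g z d e M N : tay f z d M -> tay g z e N -> tay (fun u => f u + g u) z (d + e) (M + N).
Proof.
  intros [H K] [H' K']. pose proof (Cmod_triangle (f z) (g z)). pose proof (Cmod_triangle d e).
  split. lra. intros h Hh. specialize (K h Hh). specialize (K' h Hh).
  replace (f (z + h) + g (z + h) - (f z + g z) - h * (d + e)) with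
    ((f (z + h) - f z - h * d) + (g (z + h) - g z - h * e)) by ring.
  eapply Rle_trans; [apply Cmod_triangle|].
  pose proof (pow2_ge_0 (Cmod h)). nra.
Qed.

(** The product of the two increments is of second order, and the three
    remainders together use exactly what [M * N] leaves over the value and the
    derivative. *)
Lemma tay_mult f g z d e M N : tay f z d M -> tay g z e N ->
  tay (fun u => f u * g u) z (d * g z + f z * e) (M * N).
Proof.
  intros Tf Tg. pose proof Tf as [H K]. pose proof Tg as [H' K'].
  pose proof (Cmod_ge_0 (f z)) as F0. pose proof (Cmod_ge_0 (g z)) as G0.
  pose proof (Cmod_ge_0 d) as D0. pose proof (Cmod_ge_0 e) as E0.
  pose proof (Cmod_triangle (d * g z) (f z * e)) as T. rewrite !Cmod_mult in T.
  split. rewrite Cmod_mult. nra.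
  intros h Hh. specialize (K h Hh). specialize (K' h Hh).
  pose proof (tay_incr_bound _ _ _ _ _ Tf Hh) as L. pose proof (tay_incr_bound _ _ _ _ _ Tg Hh) as L'.
  set (x := Cmod h) in *. assert (X0 : (0 <= x)%R) by apply Cmod_ge_0.
  replace (f (z + h) * g (z + h) - f z * g z - h * (d * g z + f z * e)) with
    (f z * (g (z + h) - g z - h * e) + g z * (f (z + h) - f z - h * d)
     + (f (z + h) - f z) * (g (z + h) - g z)) by ring.
  eapply Rle_trans; [apply Cmod_triangle|].
  eapply Rle_trans; [apply Rplus_le_compat_r; apply Cmod_triangle|].
  rewrite !Cmod_mult.
  assert (P : (Cmod (f (z + h)%C - f z) * Cmod (g (z + h)%C - g z) <=
     ((M - Cmod (f z)) * x) * ((N - Cmod (g z)) * x))%R).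
  { apply Rmult_le_compat; auto using Cmod_ge_0. }
  assert (P1 : (Cmod (f z) * Cmod (g (z + h)%C - g z - h * e) <= Cmod (f z) * ((N - Cmod (g z) - Cmod e) * x ^ 2))%R)
    by (apply Rmult_le_compat_l; auto).
  assert (P2 : (Cmod (g z) * Cmod (f (z + h)%C - f z - h * d) <= Cmod (g z) * ((M - Cmod (f z) - Cmod d) * x ^ 2))%R)
    by (apply Rmult_le_compat_l; auto).
  assert (Q : ((Cmod (d * g z + f z * e)) * x ^ 2 <= (Cmod d * Cmod (g z) + Cmod (f z) * Cmod e) * x ^ 2)%R)
    by (apply Rmult_le_compat_r; auto; apply pow2_ge_0).
  rewrite <- Cmod_mult. rewrite Cmod_mult.
  ring_simplify. ring_simplify in P1. ring_simplify in P2. ring_simplify in P. ring_simplify in Q. lra.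
Qed.

Lemma tay_scal k f z d M : tay f z d M -> tay (fun u => k * f u) z (k * d) (Cmod k * M).
Proof.
  intros H. eapply tay_deq; [|apply tay_mult; [apply tay_const|exact H]]. simpl; ring.
Qed.

(** The value, the derivative and the remainder are bounded by the terms of the
    geometric series of [/ (a - 1)] in powers of [/ a], [a = Cmod (z + w)]. *)
Lemma tay_inv w z : (1 < Cmod (z + w))%R ->
  tay (fun u => / (u + w)) z (- / ((z + w) * (z + w))) (/ (Cmod (z + w) - 1)).
Proof.
  intros H. assert (Hz : z + w <> 0) by (apply Cmod_pos_neq; lra).
  set (a := Cmod (z + w)) in *.
  assert (E : (/ (a - 1) - / a - / (a * a) = / (a * a) * / (a - 1))%R) by (field; lra).
  assert (P : (0 < / (a * a) * / (a - 1))%R).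
  { apply Rmult_lt_0_compat; apply Rinv_0_lt_compat; [nra|lra]. }
  split; rewrite Cmod_opp, !Cmod_inv, Cmod_mult by (auto; apply Cmult_neq_0; auto); fold a.
  - lra.
  - intros h Hh. rewrite E. assert (Hzh : z + h + w <> 0).
    { apply Cmod_pos_neq. replace (z + h + w) with ((z + w) + h) by ring.
      pose proof (Cmod_rev_triangle (z + w) h). fold a in H0. lra. }
    replace (/ (z + h + w) - / (z + w) - h * - / ((z + w) * (z + w))) with
      (/ ((z + w) * (z + w)) * / (z + h + w) * (h * h)) by (field; auto).
    rewrite !Cmod_mult, !Cmod_inv, Cmod_mult by (auto; apply Cmult_neq_0; auto). fold a.
    replace (Cmod h ^ 2)%R with (Cmod h * Cmod h)%R by ring.
    apply Rmult_le_compat_r; [apply Rmult_le_pos; apply Cmod_ge_0|].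
    apply Rmult_le_compat_l; [left; apply Rinv_0_lt_compat; nra|].
    apply Rinv_le_contravar; [lra|]. replace (z + h + w) with ((z + w) + h) by ring.
    pose proof (Cmod_rev_triangle (z + w) h). fold a in H0. lra.
Qed.

Lemma tay_comp_shift f z w d M : tay f (z + w) d M -> tay (fun u => f (u + w)) z d M.
Proof.
  intros [H K]. split; auto. intros h Hh. replace (z + h + w) with (z + w + h) by ring. auto.
Qed.

Lemma tay_Cexp a b z :
  tay (fun u => Cexp (a * u + b)) z (a * Cexp (a * z + b))
    (Cmod (Cexp (a * z + b)) * (1 + Cmod a + Cmod a ^ 2 * exp (Cmod a))).
Proof.
  pose proof (Cmod_ge_0 (Cexp (a * z + b))) as E0. pose proof (Cmod_ge_0 a) as A0.
  pose proof (exp_pos (Cmod a)) as EA. pose proof (pow2_ge_0 (Cmod a)) as A2.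
  assert (Q : (0 <= Cmod a ^ 2 * exp (Cmod a))%R) by (apply Rmult_le_pos; lra).
  split; rewrite Cmod_mult. nra.
  intros h Hh. replace (a * (z + h) + b) with ((a * z + b) + a * h) by ring. rewrite Cexp_plus.
  replace (Cexp (a * z + b) * Cexp (a * h) - Cexp (a * z + b) - h * (a * Cexp (a * z + b))) with
    (Cexp (a * z + b) * (Cexp (a * h) - 1 - a * h)) by ring.
  rewrite Cmod_mult. pose proof (Cexp_sub1w_le (a * h)) as L. rewrite Cmod_mult in L.
  assert (L' : (Cmod (Cexp (a * h) - 1 - a * h) <= Cmod a ^ 2 * exp (Cmod a) * Cmod h ^ 2)%R).
  { eapply Rle_trans; [apply L|].
    assert (exp (Cmod a * Cmod h) <= exp (Cmod a))%R by (apply exp_le; pose proof (Cmod_ge_0 h); nra).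
    replace (Cmod a ^ 2 * exp (Cmod a) * Cmod h ^ 2)%R with ((Cmod a * Cmod h) ^ 2 * exp (Cmod a))%R by ring.
    apply Rmult_le_compat_l; auto. apply pow2_ge_0. }
  apply Rle_trans with (Cmod (Cexp (a * z + b)) * (Cmod a ^ 2 * exp (Cmod a) * Cmod h ^ 2))%R.
  apply Rmult_le_compat_l; auto. right; ring.
Qed.

Lemma tay_limit (F : nat -> C -> C) (D : nat -> C) G E z M :
  (forall n, tay (F n) z (D n) M) ->
  (forall h, (Cmod h <= 1)%R -> cvg (fun n => F n (z + h)) (G (z + h))) ->
  cvg D E -> tay G z E M.
Proof.
  intros T CF CD.
  assert (C0 : cvg (fun n => F n z) (G z)).
  { specialize (CF 0). rewrite Cmod_0 in CF. replace (z + 0) with z in CF by ring. apply CF; lra. }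
  split.
  - apply (is_lim_seq_le (fun n => Cmod (F n z) + Cmod (D n))%R (fun _ => M) (Cmod (G z) + Cmod E)%R M).
    + intros n. apply T.
    + apply is_lim_seq_plus'; now apply cvg_Cmod.
    + apply is_lim_seq_const.
  - intros h Hh.
    apply (is_lim_seq_le (fun n => Cmod (F n (z + h)%C - F n z - h * D n))
      (fun n => (M - Cmod (F n z) - Cmod (D n)) * Cmod h ^ 2)%R
      (Cmod (G (z + h)%C - G z - h * E)) ((M - Cmod (G z) - Cmod E) * Cmod h ^ 2)%R).
    + intros n. now apply T.
    + apply (cvg_Cmod (fun n => F n (z + h)%C - F n z - h * D n)).
      apply cvg_minus; [apply cvg_minus; auto|]. now apply cvg_scal.
    + apply is_lim_seq_mult'; [|apply is_lim_seq_const].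
      apply is_lim_seq_minus'; [apply is_lim_seq_minus'|]; try apply is_lim_seq_const; now apply cvg_Cmod.
Qed.

Lemma tay_csum (f : nat -> C -> C) d (M : nat -> R) z n :
  (forall k, tay (f k) z (d k) (M k)) ->
  tay (fun u => csum (fun k => f k u) (S n)) z (csum d (S n)) (sum_n M n).
Proof.
  intros H. induction n as [|n IH].
  - rewrite sum_O. eapply tay_ext; [|eapply tay_deq; [|apply H]]; intros; simpl; ring.
  - rewrite sum_Sn. apply tay_plus; [exact IH|apply H].
Qed.

Lemma sum_n_le_Series (M : nat -> R) n : (forall k, (0 <= M k)%R) -> ex_series M -> (sum_n M n <= Series M)%R.
Proof.
  intros P H. pose proof (Series_correct _ H) as SM.
  apply (is_lim_seq_incr_compare (sum_n M) (Series M) SM).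
  intros k; rewrite sum_Sn; unfold plus; simpl. specialize (P (S k)); lra.
Qed.

Lemma tay_series (f : nat -> C -> C) d (M : nat -> R) z F :
  (forall k, tay (f k) z (d k) (M k)) -> ex_series M ->
  (forall h, (Cmod h <= 1)%R -> cseries (fun k => f k (z + h)) (F (z + h))) ->
  exists D, cseries d D /\ tay F z D (Series M).
Proof.
  intros T HM HF.
  assert (P : forall k, (0 <= M k)%R) by (intros k; eapply tay_pos; apply T).
  destruct (series_dom d M) as [D [HD _]]; auto.
  { intros n. destruct (T n) as [H _]. pose proof (Cmod_ge_0 (f n z)). lra. }
  exists D. split; auto.
  apply tay_limit with (F := fun n u => csum (fun k => f k u) (S n)) (D := fun n => csum d (S n)).
  - intros n. apply tay_weaken with (sum_n M n). now apply sum_n_le_Series. now apply tay_csum.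
  - intros h Hh. specialize (HF h Hh). apply (cvg_shift _ _ 1) in HF.
    eapply cvg_ext; [|exact HF]. intros n. cbv beta. now rewrite Nat.add_1_r.
  - apply (cvg_shift _ _ 1) in HD. eapply cvg_ext; [|exact HD]. intros n. cbv beta. now rewrite Nat.add_1_r.
Qed.

Lemma tay_is_derive f z d M : tay f z d M ->
  is_derive (K := C_AbsRing) (V := C_NormedModule) f z d.
Proof.
  intros [H K]. split.
  - apply is_linear_scal_l.
  - intros x Hx. assert (E : z = x).
    { apply (is_filter_lim_locally_unique (K := C_AbsRing) (V := AbsRing_NormedModule C_AbsRing)). exact Hx. }
    subst x. intros eps.
    set (B := (M - Cmod (f z) - Cmod d)%R) in *.
    assert (HB : (0 <= B)%R) by (unfold B; lra).
    assert (Hd : (0 < Rmin 1 (eps / (B + 1)))%R).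
    { apply Rmin_glb_lt; [lra|]. apply Rdiv_lt_0_compat; [apply cond_pos|lra]. }
    assert (L : forall y : C, (Cmod (y - z) < Rmin 1 (eps / (B + 1)))%R ->
      (Cmod (f y - f z - (y - z) * d) <= eps * Cmod (y - z))%R).
    { intros y Hy.
      assert (Hy1 : (Cmod (y - z) <= 1)%R) by (left; eapply Rlt_le_trans; [exact Hy|apply Rmin_l]).
      assert (Hy2 : (Cmod (y - z) <= eps / (B + 1))%R) by (left; eapply Rlt_le_trans; [exact Hy|apply Rmin_r]).
      specialize (K (y - z) Hy1). replace (z + (y - z)) with y in K by ring.
      eapply Rle_trans; [exact K|].
      apply (Rmult_le_compat_r (B + 1)) in Hy2; [|lra].
      replace (eps / (B + 1) * (B + 1))%R with (pos eps) in Hy2 by (field; lra).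
      pose proof (Cmod_ge_0 (y - z)). pose proof (cond_pos eps). nra. }
    exists (mkposreal _ Hd). intros y Hy. exact (L y Hy).
Qed.

Lemma tay_continuity f z d M : tay f z d M ->
  forall eps, (0 < eps)%R -> exists del, (0 < del)%R /\
    forall u, (Cmod (u - z) < del)%R -> (Cmod (f u - f z) < eps)%R.
Proof.
  intros T eps He. pose proof (tay_pos _ _ _ _ T) as HM.
  exists (Rmin 1 (eps / (M + 1))). split.
  - apply Rmin_glb_lt; [lra|]. apply Rdiv_lt_0_compat; lra.
  - intros u Hu.
    assert (H1 : (Cmod (u - z) <= 1)%R) by (left; eapply Rlt_le_trans; [exact Hu|apply Rmin_l]).
    assert (H2 : (Cmod (u - z) < eps / (M + 1))%R) by (eapply Rlt_le_trans; [exact Hu|apply Rmin_r]).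
    pose proof (tay_incr_bound _ _ _ _ _ T H1) as L. replace (z + (u - z)) with u in L by ring.
    eapply Rle_lt_trans; [exact L|]. apply (Rmult_lt_compat_r (M + 1)) in H2; [|lra].
    replace (eps / (M + 1) * (M + 1))%R with eps in H2 by (field; lra).
    pose proof (Cmod_ge_0 (f z)). pose proof (Cmod_ge_0 (u - z)). nra.
Qed.

(** * Infinite products *)

Section Product.
Variables (G U : nat -> C -> C) (dU : nat -> C) (d0 z : C) (M0 : R) (q : nat -> R).
Hypothesis HG0 : tay (G 0) z d0 M0.
Hypothesis HG : forall m u, G (S m) u = G m u * (1 + U m u).
Hypothesis HU : forall m, tay (U m) z (dU m) (q m).
Hypothesis Hq : ex_series q.

Let q_pos m : (0 <= q m)%R. Proof. eapply tay_pos; apply HU. Qed.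

Fixpoint dprod (m : nat) : C :=
  match m with O => d0 | S m => dprod m + (dprod m * U m z + G m z * dU m) end.

Let prod_bound := (M0 * exp (Series q))%R.

(** By submultiplicativity each factor costs at most [1 + q m <= exp (q m)]. *)
Lemma tay_partial_product m : tay (G m) z (dprod m) prod_bound.
Proof.
  assert (M0pos : (0 <= M0)%R) by (eapply tay_pos; apply HG0).
  assert (T : forall m, tay (G m) z (dprod m) (M0 * exp (match m with O => 0 | S m => sum_n q m end))).
  { clear m. induction m as [|m IH].
    - rewrite exp_0, Rmult_1_r. exact HG0.
    - eapply tay_ext; [intros u; symmetry; rewrite HG; instantiate (1 := fun u => G m u + G m u * U m u); simpl; ring|].
      eapply tay_weaken; [|apply tay_plus; [exact IH|apply tay_mult; [exact IH|apply HU]]].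
      set (e := match m with O => 0%R | S m => sum_n q m end).
      assert (E : sum_n q m = (e + q m)%R).
      { unfold e. destruct m as [|m]; [rewrite sum_O; symmetry; apply Rplus_0_l|rewrite sum_Sn; reflexivity]. }
      rewrite E, exp_plus. pose proof (exp_ineq1_le (q m)). pose proof (exp_pos e).
      assert (0 <= M0 * exp e)%R by (apply Rmult_le_pos; lra). nra. }
  eapply tay_weaken; [|apply T]. unfold prod_bound. apply Rmult_le_compat_l; auto.
  apply exp_le. destruct m as [|m].
  - apply Rle_trans with (sum_n q 0); [rewrite sum_O; auto|]. now apply sum_n_le_Series.
  - now apply sum_n_le_Series.
Qed.

Lemma product_cvg h : (Cmod h <= 1)%R -> exists l, cvg (fun m => G m (z + h)) l.
Proof.
  intros Hh.
  destruct (series_dom (fun m => G (S m) (z + h) - G m (z + h)) (fun m => prod_bound * q m)%R) as [l [Hl _]].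
  - intros m. rewrite HG. replace (G m (z + h) * (1 + U m (z + h)) - G m (z + h)) with (G m (z + h) * U m (z + h)) by ring.
    rewrite Cmod_mult. apply Rmult_le_compat; auto using Cmod_ge_0.
    + eapply tay_bound; eauto using tay_partial_product.
    + eapply tay_bound; [apply HU|auto].
  - now apply (ex_series_scal (V := R_NormedModule) prod_bound).
  - exists (l + G 0 (z + h)). eapply cvg_ext; [|apply cvg_plus; [exact Hl|apply (cvg_const (G 0 (z + h)))]].
    intros n. cbv beta. rewrite (csum_telescope (fun m => G m (z + h))). ring.
Qed.

Lemma tay_product F : (forall h, (Cmod h <= 1)%R -> cvg (fun m => G m (z + h)) (F (z + h))) ->
  exists D, tay F z D prod_bound.
Proof.
  intros HF.
  destruct (series_dom (fun m => dprod (S m) - dprod m) (fun m => prod_bound * q m)%R) as [l [Hl _]].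
  - intros m. simpl. pose proof (tay_mult _ _ _ _ _ _ _ (tay_partial_product m) (HU m)) as [T _].
    replace (dprod m + (dprod m * U m z + G m z * dU m) - dprod m) with (dprod m * U m z + G m z * dU m) by ring.
    eapply Rle_trans; [|exact T]. pose proof (Cmod_ge_0 (G m z * U m z)). lra.
  - now apply (ex_series_scal (V := R_NormedModule) prod_bound).
  - exists (l + dprod 0). apply tay_limit with (F := G) (D := dprod); auto using tay_partial_product.
    eapply cvg_ext; [|apply cvg_plus; [exact Hl|apply (cvg_const (dprod 0))]].
    intros n. cbv beta. rewrite (csum_telescope dprod). ring.
Qed.
End Product.

Lemma product_cvg_scalar (g u : nat -> C) (q : nat -> R) :
  (forall m, g (S m) = g m * (1 + u m)) -> (forall m, (Cmod (u m) <= q m)%R) -> ex_series q ->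
  exists l, cvg g l.
Proof.
  intros Hg Hu Hq.
  destruct (product_cvg (fun m _ => g m) (fun m _ => u m) (fun _ => 0) 0 0 (Cmod (g 0%nat)) q
    (tay_const _ _) (fun m _ => Hg m) (fun m => tay_weaken _ _ _ _ _ (Hu m) (tay_const _ _)) Hq 0) as [l Hl].
  rewrite Cmod_0; lra. now exists l.
Qed.

Lemma ex_series_inv_sq K : ex_series (fun m => K / (INR (S m) * INR (S (S m))))%R.
Proof.
  exists (K * 1)%R. apply (is_series_ext (fun m => K * / (INR (S m) * INR (S (S m))))%R); [reflexivity|].
  apply (is_series_scal (V := R_NormedModule) K).
  change (is_lim_seq (sum_n (fun m => / (INR (S m) * INR (S (S m))))%R) 1%R).
  apply (is_lim_seq_ext (fun n => 1 - / INR (S (S n)))%R).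
  - induction n as [|n IH].
    + rewrite sum_O. simpl. field.
    + rewrite sum_Sn. rewrite <- IH. unfold plus. cbn -[INR]. rewrite !S_INR. pose proof (pos_INR n). field. lra.
  - assert (L : is_lim_seq (fun n => 1 - / INR (S (S n)))%R (1 - 0)%R).
    { apply is_lim_seq_minus'. apply is_lim_seq_const.
      apply (is_lim_seq_incr_1 (fun n => / INR (S n))%R). apply (is_lim_seq_incr_1 (fun n => / INR n)%R).
      apply (is_lim_seq_inv INR p_infty). apply is_lim_seq_INR. discriminate. }
    rewrite Rminus_0_r in L. exact L.
Qed.

(** * Pochhammer symbols *)

Lemma poch_S z n : poch z (S n) = poch z n * (z + INR n).
Proof. reflexivity. Qed.

Lemma poch_S_l z n : poch z (S n) = z * poch (z + 1) n.
Proof.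
  induction n as [|n IH]. simpl. ring.
  change (poch z (S (S n))) with (poch z (S n) * (z + INR (S n))). rewrite IH. rewrite RtoC_S. simpl. ring.
Qed.

Lemma poch_add z m n : poch z (m + n) = poch z m * poch (z + INR m) n.
Proof.
  induction n as [|n IH].
  - rewrite Nat.add_0_r. simpl. ring.
  - rewrite Nat.add_succ_r. simpl. rewrite IH, RtoC_INR_add. ring.
Qed.

Lemma poch_neq_0 z n : (forall k, (k < n)%nat -> z + INR k <> 0) -> poch z n <> 0.
Proof.
  induction n as [|n IH]; intros H; simpl. apply RtoC_neq; lra.
  apply Cmult_neq_0; auto.
Qed.

Lemma poch_nonpole z n : ~ nonpos_int z -> poch z n <> 0.
Proof. intros H. apply poch_neq_0. intros. now apply nonpos_int_neq. Qed.

Lemma poch_nonpos_zero n k : (n < k)%nat -> poch (- INR n) k = 0.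
Proof.
  intros H. replace k with (S n + (k - S n))%nat by lia. rewrite poch_add. simpl.
  replace (- INR n + INR n) with (RtoC 0) by ring. ring.
Qed.

(** * The reciprocal Gamma function *)

(** Gauss's product inverted: it converges everywhere, poles of Gamma included. *)
Definition rgauss (z : C) (n : nat) : C := poch z (S n) / (INR (fact n) * Cpower (INR n) z).

Definition rgamma (z : C) : C := CLim_seq (rgauss z).

Definition logstep (m : nat) : R := (ln (INR (S (S m))) - ln (INR (S m)))%R.

Lemma ln_le_sub1 x : (0 < x)%R -> (ln x <= x - 1)%R.
Proof. intros H. pose proof (exp_ineq1_le (ln x)). rewrite exp_ln in H0 by auto. lra. Qed.

Lemma logstep_bounds m : (/ INR (S (S m)) <= logstep m <= / INR (S m))%R.
Proof.
  assert (H1 : (0 < INR (S m))%R) by (apply lt_0_INR; lia).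
  assert (H2 : (0 < INR (S (S m)))%R) by (apply lt_0_INR; lia).
  assert (E : (INR (S (S m)) = INR (S m) + 1)%R) by (rewrite (S_INR (S m)); ring).
  unfold logstep. split.
  - pose proof (ln_le_sub1 (INR (S m) / INR (S (S m)))) as L.
    rewrite ln_div in L by auto.
    assert (P : (0 < INR (S m) / INR (S (S m)))%R) by (apply Rdiv_lt_0_compat; auto). specialize (L P).
    assert (Q : (INR (S m) / INR (S (S m)) - 1 = - / INR (S (S m)))%R) by (rewrite E; field; lra). lra.
  - pose proof (ln_le_sub1 (INR (S (S m)) / INR (S m))) as L.
    rewrite ln_div in L by auto.
    assert (P : (0 < INR (S (S m)) / INR (S m))%R) by (apply Rdiv_lt_0_compat; auto). specialize (L P).
    assert (Q : (INR (S (S m)) / INR (S m) - 1 = / INR (S m))%R) by (rewrite E; field; lra). lra.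
Qed.

(** Both bounds are multiples of [/ (m + 1) - / (m + 2)], hence summable. *)
Lemma logstep_sq m : (0 <= logstep m <= 1)%R /\
  (logstep m ^ 2 <= 2 / (INR (S m) * INR (S (S m))))%R /\
  (Rabs (/ INR (S (S m)) - logstep m) <= 1 / (INR (S m) * INR (S (S m))))%R.
Proof.
  destruct (logstep_bounds m) as [L1 L2].
  assert (H1 : (1 <= INR (S m))%R) by (rewrite S_INR; pose proof (pos_INR m); lra).
  assert (E : (INR (S (S m)) = INR (S m) + 1)%R) by (rewrite (S_INR (S m)); ring).
  rewrite E in *. set (a := INR (S m)) in *.
  assert (0 < / (a + 1))%R by (apply Rinv_0_lt_compat; lra).
  assert (A1 : (/ a <= 1)%R) by (rewrite <- Rinv_1; apply Rinv_le_contravar; lra).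
  split; [lra|]. split.
  - apply Rle_trans with ((/ a) ^ 2)%R. apply pow_incr; lra.
    apply Rmult_le_reg_r with (a * a * (a + 1))%R. nra.
    replace ((/ a) ^ 2 * (a * a * (a + 1)))%R with (a + 1)%R by (field; lra).
    replace (2 / (a * (a + 1)) * (a * a * (a + 1)))%R with (2 * a)%R by (field; lra). lra.
  - rewrite Rabs_left1 by lra. replace (1 / (a * (a + 1)))%R with (/ a - / (a + 1))%R by (field; lra). lra.
Qed.

(** With [l = logstep m], the quotient of consecutive products is
    [(1 + z / (m + 2)) exp (- l z)].  Subtracting 1 and factoring out
    [exp (- l z)] leaves a linear term of size [/ (m + 2) - l] and the remainder
    [exp (l z) - 1 - l z], both of second order in [/ m]. *)
Definition gauss_factor (m : nat) (z : C) : C :=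
  Cexp (RtoC (- logstep m) * z + 0)
  * ((RtoC (/ INR (S (S m)) - logstep m) * z + 0)
     + - (1) * (Cexp (RtoC (logstep m) * z + 0) + (RtoC (- logstep m) * z + - (1)))).

Lemma rgauss_step z m : rgauss z (S (S m)) = rgauss z (S m) * (1 + gauss_factor m z).
Proof.
  assert (P1 : (0 < INR (S m))%R) by (apply lt_0_INR; lia).
  assert (P2 : (0 < INR (S (S m)))%R) by (apply lt_0_INR; lia).
  assert (F : 1 + gauss_factor m z = (1 + z / INR (S (S m))) * Cexp (- (z * RtoC (logstep m)))).
  { unfold gauss_factor.
    replace (RtoC (- logstep m) * z + 0) with (- (z * RtoC (logstep m))) by (rewrite RtoC_opp; ring).
    replace (RtoC (logstep m) * z + 0) with (z * RtoC (logstep m)) by ring.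
    rewrite Cexp_opp. pose proof (Cexp_neq_0 (z * RtoC (logstep m))).
    rewrite RtoC_minus, RtoC_opp, RtoC_inv. field. all: repeat split; auto; try apply RtoC_neq; lra. }
  rewrite F. unfold rgauss. rewrite !Cpower_pos by auto.
  change (poch z (S (S (S m)))) with (poch z (S (S m)) * (z + INR (S (S m)))).
  rewrite (fact_simpl (S m)), mult_INR, RtoC_mult.
  replace (Cexp (z * ln (INR (S (S m))))) with (Cexp (z * ln (INR (S m))) * / Cexp (- (z * logstep m))).
  2:{ rewrite <- Cexp_opp, <- Cexp_plus. f_equal. unfold logstep. rewrite RtoC_minus. ring. }
  pose proof (Cexp_neq_0 (z * ln (INR (S m)))). pose proof (Cexp_neq_0 (- (z * logstep m))).
  pose proof (fact_neq (S m)). assert (RtoC (INR (S (S m))) <> 0) by (apply RtoC_neq; lra).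
  field. auto.
Qed.

Lemma tay_gauss_factor z : exists K, exists d : nat -> C,
  forall m, tay (gauss_factor m) z (d m) (K / (INR (S m) * INR (S (S m)))).
Proof.
  set (K1 := (exp (Cmod z) * (2 + exp 1))%R).
  set (K2 := (Cmod z + 1)%R).
  set (K3 := (2 * (exp (Cmod z) * (Cmod z ^ 2 + Cmod z + exp 1)))%R).
  pose proof (Cmod_ge_0 z) as Z0. pose proof (exp_pos (Cmod z)) as EZ. pose proof (exp_pos 1) as E1.
  assert (S3 : forall m, exists d, tay (fun u => Cexp (RtoC (logstep m) * u + 0) + (RtoC (- logstep m) * u + - (1))) z d
     (K3 / (INR (S m) * INR (S (S m))))).
  { intros m. destruct (logstep_sq m) as [[L0 L1] [L2 _]]. set (l := logstep m) in *.
    set (s := (2 / (INR (S m) * INR (S (S m))))%R) in *.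
    exists (RtoC l * (Cexp (RtoC l * z) - 1)).
    assert (X : (Cmod (Cexp (RtoC l * z + 0) + (RtoC (- l) * z + - (1))) <= s * (exp (Cmod z) * Cmod z ^ 2))%R).
    { replace (Cexp (RtoC l * z + 0) + (RtoC (- l) * z + - (1))) with (Cexp (RtoC l * z) - 1 - RtoC l * z).
      2:{ replace (RtoC l * z + 0) with (RtoC l * z) by ring. rewrite RtoC_opp. ring. }
      eapply Rle_trans; [apply Cexp_sub1w_le|]. rewrite Cmod_mult, Cmod_RtoC_pos by lra.
      replace ((l * Cmod z) ^ 2 * exp (l * Cmod z))%R with (l ^ 2 * (Cmod z ^ 2 * exp (l * Cmod z)))%R by ring.
      apply Rmult_le_compat; auto using pow2_ge_0.
      - apply Rmult_le_pos; [apply pow2_ge_0|left; apply exp_pos].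
      - rewrite Rmult_comm. apply Rmult_le_compat_r; [apply pow2_ge_0|]. apply exp_le. nra. }
    assert (Y : (Cmod (RtoC l * (Cexp (RtoC l * z) - 1)) <= s * (exp (Cmod z) * Cmod z))%R).
    { rewrite Cmod_mult, Cmod_RtoC_pos by lra.
      apply Rle_trans with (l * (l * Cmod z * exp (l * Cmod z)))%R.
      - apply Rmult_le_compat_l; auto. eapply Rle_trans; [apply Cexp_sub1_le|].
        rewrite Cmod_mult, Cmod_RtoC_pos by lra. lra.
      - replace (l * (l * Cmod z * exp (l * Cmod z)))%R with (l ^ 2 * (Cmod z * exp (l * Cmod z)))%R by ring.
        apply Rmult_le_compat; auto using pow2_ge_0.
        + apply Rmult_le_pos; [auto|left; apply exp_pos].
        + rewrite Rmult_comm. apply Rmult_le_compat_r; [auto|]. apply exp_le. nra. }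
    assert (EQ : (K3 / (INR (S m) * INR (S (S m))) = s * (exp (Cmod z) * Cmod z ^ 2) + s * (exp (Cmod z) * Cmod z) + s * (exp (Cmod z) * exp 1))%R).
    { unfold K3, s. field. split; apply not_0_INR; lia. }
    assert (s0 : (0 <= s)%R) by (pose proof (pow2_ge_0 l); lra).
    split.
    - assert (0 <= s * (exp (Cmod z) * exp 1))%R by (apply Rmult_le_pos; auto; apply Rmult_le_pos; lra). lra.
    - intros h Hh. rewrite EQ.
      replace (Cexp (RtoC l * (z + h) + 0) + (RtoC (- l) * (z + h) + - (1)) - (Cexp (RtoC l * z + 0) + (RtoC (- l) * z + - (1))) - h * (RtoC l * (Cexp (RtoC l * z) - 1)))
        with (Cexp (RtoC l * z) * (Cexp (RtoC l * h) - 1 - RtoC l * h)).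
      2:{ replace (RtoC l * (z + h) + 0) with (RtoC l * z + RtoC l * h) by ring. replace (RtoC l * z + 0) with (RtoC l * z) by ring.
          rewrite Cexp_plus, RtoC_opp. ring. }
      rewrite Cmod_mult.
      apply Rle_trans with (exp (Cmod z) * ((l * Cmod h) ^ 2 * exp 1))%R.
      + apply Rmult_le_compat; try apply Cmod_ge_0.
        * eapply Rle_trans; [apply Cmod_Cexp_le|]. apply exp_le. rewrite Cmod_mult, Cmod_RtoC_pos by lra. nra.
        * eapply Rle_trans; [apply Cexp_sub1w_le|]. rewrite Cmod_mult, Cmod_RtoC_pos by lra.
          apply Rmult_le_compat_l; [apply pow2_ge_0|]. apply exp_le. pose proof (Cmod_ge_0 h). nra.
      + apply Rle_trans with (s * (exp (Cmod z) * exp 1) * Cmod h ^ 2)%R.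
        * replace (exp (Cmod z) * ((l * Cmod h) ^ 2 * exp 1))%R with (l ^ 2 * (exp (Cmod z) * exp 1) * Cmod h ^ 2)%R by ring.
          apply Rmult_le_compat_r; [apply pow2_ge_0|]. apply Rmult_le_compat_r; auto. apply Rmult_le_pos; lra.
        * apply Rmult_le_compat_r; [apply pow2_ge_0|]. lra. }
  exists (K1 * (K2 + K3))%R.
  assert (T : forall m, exists d, tay (gauss_factor m) z d (K1 * (K2 + K3) / (INR (S m) * INR (S (S m))))).
  { intros m. destruct (S3 m) as [d3 T3]. destruct (logstep_sq m) as [[L0 L1] [_ L3]].
    eexists. eapply tay_weaken; [|apply tay_mult; [apply tay_Cexp|apply tay_plus; [apply tay_lin|apply tay_scal; exact T3]]].
    set (s := (INR (S m) * INR (S (S m)))%R) in *.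
    assert (s0 : (0 < s)%R) by (apply Rmult_lt_0_compat; apply lt_0_INR; lia).
    replace (K1 * (K2 + K3) / s)%R with (K1 * (K2 / s + K3 / s))%R by (field; lra).
    replace (Cmod (- (1))) with 1%R by (rewrite Cmod_opp, Cmod_1; auto). rewrite Rmult_1_l.
    assert (K3pos : (0 <= K3 / s)%R).
    { apply Rmult_le_pos; [|left; now apply Rinv_0_lt_compat]. unfold K3.
      pose proof (pow2_ge_0 (Cmod z)). assert (0 <= exp (Cmod z) * (Cmod z ^ 2 + Cmod z + exp 1))%R by (apply Rmult_le_pos; lra). lra. }
    assert (M2 : (Cmod (RtoC (/ INR (S (S m)) - logstep m)%R * z + 0) + Cmod (RtoC (/ INR (S (S m)) - logstep m)%R) <= K2 / s)%R).
    { replace (RtoC (/ INR (S (S m)) - logstep m)%R * z + 0) with (RtoC (/ INR (S (S m)) - logstep m)%R * z) by ring.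
      rewrite Cmod_mult, Cmod_R. unfold K2.
      replace ((Cmod z + 1) / s)%R with (1 / s * Cmod z + 1 / s)%R by (field; lra).
      apply Rplus_le_compat; auto. apply Rmult_le_compat_r; auto. }
    apply Rmult_le_compat.
    - apply Rmult_le_pos; [apply Cmod_ge_0|]. pose proof (Cmod_ge_0 (RtoC (- logstep m))).
      pose proof (pow2_ge_0 (Cmod (RtoC (- logstep m)))). pose proof (exp_pos (Cmod (RtoC (- logstep m)))).
      assert (0 <= Cmod (RtoC (- logstep m)) ^ 2 * exp (Cmod (RtoC (- logstep m))))%R by (apply Rmult_le_pos; lra). lra.
    - apply Rplus_le_le_0_compat; auto. apply Rplus_le_le_0_compat; apply Cmod_ge_0.
    - replace (Cmod (RtoC (- logstep m))) with (logstep m) by (rewrite Cmod_R, Rabs_Ropp, Rabs_pos_eq; lra).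
      unfold K1. apply Rmult_le_compat.
      + apply Cmod_ge_0.
      + pose proof (exp_pos (logstep m)). pose proof (pow2_ge_0 (logstep m)).
        assert (0 <= logstep m ^ 2 * exp (logstep m))%R by (apply Rmult_le_pos; lra). lra.
      + eapply Rle_trans; [apply Cmod_Cexp_le|]. apply exp_le.
        replace (RtoC (- logstep m) * z + 0) with (RtoC (- logstep m) * z) by ring.
        rewrite Cmod_mult, Cmod_R, Rabs_Ropp, Rabs_pos_eq by lra. nra.
      + assert (exp (logstep m) <= exp 1)%R by (apply exp_le; auto). pose proof (exp_pos (logstep m)).
        assert (logstep m ^ 2 <= 1)%R by nra. pose proof (pow2_ge_0 (logstep m)).
        assert (logstep m ^ 2 * exp (logstep m) <= 1 * exp 1)%R by (apply Rmult_le_compat; lra). lra.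
    - lra. }
  exists (fun m => epsilon (inhabits (RtoC 0)) (fun d => tay (gauss_factor m) z d (K1 * (K2 + K3) / (INR (S m) * INR (S (S m)))))).
  intros m. apply epsilon_spec. apply T.
Qed.

Lemma tay_rgauss_1 z : exists d M, tay (fun u => rgauss u 1) z d M.
Proof.
  eexists. eexists. eapply tay_ext; [|apply tay_mult; [apply (tay_lin 1 0)|apply (tay_lin 1 1)]].
  intros u. unfold rgauss. rewrite Cpower_pos by (simpl; lra). simpl INR. rewrite ln_1. simpl poch.
  replace (u * RtoC 0) with (RtoC 0) by ring. rewrite Cexp_0. simpl. field.
Qed.

Lemma rgamma_cvg z : cvg (rgauss z) (rgamma z).
Proof.
  destruct (tay_gauss_factor z) as [K [d T]]. destruct (tay_rgauss_1 z) as [d1 [M1 T1]].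
  destruct (product_cvg (fun m u => rgauss u (S m)) gauss_factor d d1 z M1 _ T1 (fun m u => rgauss_step u m) T
    (ex_series_inv_sq K) 0) as [l Hl]. { rewrite Cmod_0; lra. }
  replace (z + 0) with z in Hl by ring.
  assert (L : cvg (rgauss z) l).
  { apply (cvg_unshift _ _ 1). eapply cvg_ext; [|exact Hl]. intros n. cbv beta. now rewrite Nat.add_1_r. }
  unfold rgamma. now rewrite (CLim_seq_eq _ _ L).
Qed.

Lemma tay_rgamma z : exists d M, tay rgamma z d M.
Proof.
  destruct (tay_gauss_factor z) as [K [d T]]. destruct (tay_rgauss_1 z) as [d1 [M1 T1]].
  destruct (tay_product (fun m u => rgauss u (S m)) gauss_factor d d1 z M1 _ T1 (fun m u => rgauss_step u m) T
    (ex_series_inv_sq K) rgamma) as [D HD]; [|eauto].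
  intros h Hh. pose proof (rgamma_cvg (z + h)) as L. apply (cvg_shift _ _ 1) in L.
  eapply cvg_ext; [|exact L]. intros n. cbv beta. now rewrite Nat.add_1_r.
Qed.

Lemma cvg_inv_INR (a : C) : cvg (fun n => a / INR (S n)) 0.
Proof.
  apply cvg_dom with (fun n => Cmod a * / INR (S n))%R.
  - intros n. replace (a / INR (S n) - 0) with (a / INR (S n)) by ring.
    rewrite Cmod_div by (apply RtoC_neq, not_0_INR; lia). rewrite Cmod_INR. unfold Rdiv. lra.
  - replace 0%R with (Cmod a * 0)%R by ring. apply is_lim_seq_mult'; [apply is_lim_seq_const|].
    apply (is_lim_seq_incr_1 (fun n => / INR n)%R).
    apply (is_lim_seq_inv INR p_infty). apply is_lim_seq_INR. discriminate.
Qed.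

Lemma rgamma_rec z : rgamma z = z * rgamma (z + 1).
Proof.
  apply cvg_unique with (fun n => z * rgauss (z + 1) (S n)).
  - pose proof (rgamma_cvg z) as L. apply (cvg_shift _ _ 1) in L.
    pose proof (cvg_mult _ _ _ _ L (cvg_plus _ _ _ _ (cvg_const 1) (cvg_inv_INR (z + 1)))) as K.
    replace (rgamma z * (1 + 0)) with (rgamma z) in K by ring.
    eapply cvg_ext; [|exact K]. intros n. cbv beta. rewrite Nat.add_1_r. unfold rgauss.
    assert (P1 : (0 < INR (S n))%R) by (apply lt_0_INR; lia).
    rewrite Cpower_plus, Cpower_1 by auto.
    assert (E : z * poch (z + 1) (S (S n)) = poch z (S (S n)) * (z + INR (S (S n)))).
    { rewrite <- poch_S_l. reflexivity. }
    pose proof (Cpower_neq_0 (INR (S n)) z P1). pose proof (fact_neq (S n)).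
    assert (RtoC (INR (S n)) <> 0) by (apply RtoC_neq; lra).
    unfold Cdiv at 3. rewrite Cmult_assoc, E, (RtoC_S (S n)). field. auto.
  - apply cvg_scal. pose proof (rgamma_cvg (z + 1)) as L. apply (cvg_shift _ _ 1) in L.
    eapply cvg_ext; [|exact L]. intros n. cbv beta. now rewrite Nat.add_1_r.
Qed.

Lemma rgamma_poch z k : rgamma z = poch z k * rgamma (z + INR k).
Proof.
  induction k as [|k IH]. simpl. replace (z + 0) with z by ring. ring.
  rewrite IH, rgamma_rec, RtoC_S. simpl. rewrite Cplus_assoc. ring.
Qed.

(** The factors of the product are invertible off the poles, and their inverses
    differ from 1 by a summable amount, so the product of the inverses
    converges as well. *)
Lemma Gamma_rgamma z : ~ nonpos_int z -> Gamma z * rgamma z = 1.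
Proof.
  intros Hz.
  assert (NZ : forall n, rgauss z (S n) <> 0).
  { intros n. unfold rgauss. apply Cmult_neq_0. now apply poch_nonpole.
    apply Cinv_neq_0. apply Cmult_neq_0. apply fact_neq. apply Cpower_neq_0, lt_0_INR. lia. }
  destruct (tay_gauss_factor z) as [K [d T]].
  set (q := (fun m => K / (INR (S m) * INR (S (S m))))%R) in *.
  assert (HU : forall m, (Cmod (gauss_factor m z) <= q m)%R) by (intros; eapply tay_bound0; apply T).
  pose proof (ex_series_inv_sq K) as Hq. change (ex_series q) in Hq.
  assert (HN : exists N, forall n, (N <= n)%nat -> (q n <= 1 / 2)%R).
  { pose proof (ex_series_lim_0 _ Hq) as L. apply is_lim_seq_spec in L.
    destruct (L (mkposreal (1/2) ltac:(lra))) as [N H]. exists N. intros n Hn. specialize (H n Hn).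
    simpl in H. rewrite Rminus_0_r in H. pose proof (Rle_abs (q n)). unfold q in *. lra. }
  destruct HN as [N HN].
  assert (NF : forall m, 1 + gauss_factor m z <> 0).
  { intros m E. apply (NZ (S m)). rewrite rgauss_step, E. ring. }
  destruct (product_cvg_scalar (fun m => / rgauss z (S (N + m))) (fun m => / (1 + gauss_factor (N + m) z) - 1)
    (fun m => 2 * q (N + m)%nat)%R) as [l Hl].
  - intros m. rewrite Nat.add_succ_r, rgauss_step. field. auto.
  - intros m. set (u := gauss_factor (N + m) z).
    assert (Hu : (Cmod u <= q (N + m)%nat)%R) by apply HU. specialize (HN (N + m)%nat ltac:(lia)).
    replace (/ (1 + u) - 1) with (- u * / (1 + u)) by (field; apply NF).
    rewrite Cmod_mult, Cmod_opp, Cmod_inv by apply NF. rewrite (Rmult_comm 2).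
    apply Rmult_le_compat; auto using Cmod_ge_0.
    + left. apply Rinv_0_lt_compat. apply Cmod_gt_0. apply NF.
    + replace 2%R with (/ (1 / 2))%R by field. apply Rinv_le_contravar; [lra|].
      pose proof (Cmod_rev_triangle 1 u). rewrite Cmod_1 in H. lra.
  - apply (ex_series_scal (V := R_NormedModule) 2%R). now apply (ex_series_incr_n (V := R_NormedModule) q N).
  - assert (L : cvg (fun n => / rgauss z (n + S N)) l).
    { eapply cvg_ext; [|exact Hl]. intros n. cbv beta. do 2 f_equal. lia. }
    assert (G : Gamma z = l).
    { unfold Gamma. apply CLim_seq_eq. apply (cvg_unshift _ _ (S N)). eapply cvg_ext; [|exact L].
      intros n. cbv beta. assert (P : rgauss z (n + S N) <> 0) by (rewrite Nat.add_succ_r; apply NZ).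
      unfold rgauss in *. assert (Q1 : poch z (S (n + S N)) <> 0) by now apply poch_nonpole.
      assert (Q2 : INR (fact (n + S N)) * Cpower (INR (n + S N)) z <> 0).
      { apply Cmult_neq_0. apply fact_neq. apply Cpower_neq_0, lt_0_INR. lia. }
      set (a := poch z (S (n + S N))) in *. set (b := INR (fact (n + S N)) * Cpower (INR (n + S N)) z) in *.
      field. auto. }
    rewrite G. apply cvg_unique with (fun n => / rgauss z (n + S N) * rgauss z (n + S N)).
    + apply cvg_mult; auto. apply cvg_shift. apply rgamma_cvg.
    + eapply cvg_ext; [|apply (cvg_const 1)]. intros n. cbv beta. rewrite Nat.add_succ_r. field. apply NZ.
Qed.

Lemma rgamma_neq_0 z : ~ nonpos_int z -> rgamma z <> 0.
Proof.
  intros H E. apply Gamma_rgamma in H. rewrite E in H.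
  replace (Gamma z * 0) with (RtoC 0) in H by ring. apply RtoC_inj in H. lra.
Qed.

Lemma inv_Gamma z : ~ nonpos_int z -> / Gamma z = rgamma z.
Proof.
  intros H. pose proof (Gamma_rgamma z H) as E.
  assert (Gamma z <> 0). { intros Z. rewrite Z in E. replace (0 * rgamma z) with (RtoC 0) in E by ring. apply RtoC_inj in E. lra. }
  replace (rgamma z) with (/ Gamma z * (Gamma z * rgamma z)) by (field; auto). rewrite E. ring.
Qed.

Lemma Gamma_inv z : ~ nonpos_int z -> Gamma z = / rgamma z.
Proof.
  intros H. pose proof (Gamma_rgamma z H) as E. pose proof (rgamma_neq_0 z H).
  replace (Gamma z) with ((Gamma z * rgamma z) * / rgamma z) by (field; auto). rewrite E. ring.
Qed.

Lemma tay_ext_disc f g z d M : (forall h, (Cmod h <= 1)%R -> f (z + h) = g (z + h)) -> tay f z d M -> tay g z d M.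
Proof.
  intros E [H K]. assert (E0 : f z = g z).
  { specialize (E 0). rewrite Cmod_0 in E. replace (z + 0) with z in E by ring. apply E; lra. }
  split. now rewrite <- E0. intros h Hh. rewrite <- E, <- E0 by auto. auto.
Qed.

(** The analogue of [geom_of_ratio] for the constants of [tay]. *)
Lemma tay_geom (f : nat -> C -> C) z q n0 : (0 < q)%R ->
  (forall k, exists d M, tay (f k) z d M) ->
  (forall k, (n0 <= k)%nat -> forall d M, tay (f k) z d M -> exists d', tay (f (S k)) z d' (q * M)) ->
  exists d K, (0 <= K)%R /\ forall k, tay (f k) z (d k) (K * q ^ k).
Proof.
  intros Hq HE HS.
  assert (Hp : forall n, (0 < q ^ n)%R) by (intros; now apply pow_lt).
  assert (F : forall m, exists K, (0 <= K)%R /\ forall k, (k <= m)%nat -> exists d, tay (f k) z d (K * q ^ k)).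
  { induction m as [|m [K [HK IH]]].
    - destruct (HE 0%nat) as [d [M T]]. exists M. split; [eapply tay_pos; eauto|].
      intros k Hk. replace k with 0%nat by lia. exists d. eapply tay_weaken; [|exact T]. simpl; lra.
    - destruct (HE (S m)) as [d [M T]]. exists (Rmax K (M / q ^ S m)).
      split; [eapply Rle_trans; [exact HK|apply Rmax_l]|].
      intros k Hk. destruct (Nat.eq_dec k (S m)) as [->|E].
      + exists d. eapply tay_weaken; [|exact T].
        apply Rle_trans with (M / q ^ S m * q ^ S m)%R.
        * right. field. specialize (Hp (S m)); lra.
        * apply Rmult_le_compat_r; [left; apply Hp|apply Rmax_r].
      + destruct (IH k ltac:(lia)) as [e Te]. exists e. eapply tay_weaken; [|exact Te].
        apply Rmult_le_compat_r; [left; apply Hp|apply Rmax_l]. }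
  destruct (F n0) as [K [HK HF]].
  assert (G : forall k, exists d, tay (f k) z d (K * q ^ k)).
  { induction k as [|k IH]; [apply HF; lia|].
    destruct (Nat.le_gt_cases (S k) n0) as [Hn|Hn]; auto.
    destruct IH as [d T]. destruct (HS k ltac:(lia) d _ T) as [d' T']. exists d'.
    eapply tay_weaken; [|exact T']. simpl. right; ring. }
  exists (fun k => epsilon (inhabits (RtoC 0)) (fun d => tay (f k) z d (K * q ^ k))), K.
  split; auto. intros k. apply epsilon_spec, G.
Qed.

Lemma tay_poch_lin a b z k : exists d M, tay (fun u => poch (a * u + b) k) z d M.
Proof.
  induction k as [|k [d [M T]]].
  - do 2 eexists. apply (tay_const 1).
  - do 2 eexists. eapply tay_ext; [|apply tay_mult; [exact T|apply (tay_lin a (b + INR k))]].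
    intros u. simpl. ring.
Qed.

(** * The regularized hypergeometric series *)

Definition hcoef (a b c : C) (k : nat) : C :=
  poch a k * poch b k * rgamma (c + INR k) / INR (fact k).

Definition hreg (a b c w : C) : C := CSeries (fun k => hcoef a b c k * w ^ k).

(** The order of a Legendre function enters all three parameters, so they move
    together along affine functions.  Each step multiplies a coefficient by a
    rational function whose [tay] constant tends to 1. *)
Lemma tay_hcoef a1 a0 b1 b0 c0 z q : (1 < q)%R -> exists d K, (0 <= K)%R /\
  forall k, tay (fun u => hcoef (a1 * u + a0) (b1 * u + b0) (u + c0) k) z (d k) (K * q ^ k).
Proof.
  intros Hq. destruct (exists_sqrt q ltac:(auto)) as [r [Hr Hr2]].
  set (A := (Cmod (a1 * z + a0) + Cmod a1)%R). set (B := (Cmod (b1 * z + b0) + Cmod b1)%R).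
  set (D := (Cmod (z + c0) + 1)%R).
  destruct (ratio_eventually A D r Hr) as [n1 H1]. destruct (ratio_eventually B (-1) r Hr) as [n2 H2].
  apply tay_geom with (n0 := max n1 n2); [lra| |].
  - intros k. destruct (tay_poch_lin a1 a0 z k) as [d1 [M1 T1]]. destruct (tay_poch_lin b1 b0 z k) as [d2 [M2 T2]].
    destruct (tay_rgamma (z + (c0 + INR k))) as [d3 [M3 T3]].
    do 2 eexists. eapply tay_ext; [|apply tay_mult; [apply tay_mult; [apply tay_mult; [exact T1|exact T2]|apply tay_comp_shift; exact T3]|apply (tay_const (/ INR (fact k)))]].
    intros u. unfold hcoef, Cdiv. do 3 f_equal. ring.
  - intros k Hk d M T. destruct (H1 k ltac:(lia)) as [L1 L1']. destruct (H2 k ltac:(lia)) as [L2 L2'].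
    assert (HD : (INR k - D <= Cmod (z + (c0 + INR k)) - 1)%R).
    { replace (z + (c0 + INR k)) with (INR k + (z + c0)) by ring.
      pose proof (Cmod_rev_triangle (INR k) (z + c0)) as L. rewrite Cmod_INR in L. unfold D. lra. }
    eexists. eapply tay_ext_disc; [|eapply tay_weaken; [|apply tay_mult; [apply tay_mult; [apply tay_mult; [exact T|apply (tay_lin a1 (a0 + INR k))]|apply (tay_lin (b1 / INR (S k)) ((b0 + INR k) / INR (S k)))]|apply (tay_inv (c0 + INR k)); lra]]].
    + intros h Hh. unfold hcoef. cbv beta.
      rewrite (rgamma_rec (z + h + c0 + INR k)).
      replace (z + h + c0 + INR k + 1) with (z + h + c0 + INR (S k)) by (rewrite RtoC_S; ring).
      rewrite fact_simpl, mult_INR, RtoC_mult. simpl poch.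
      assert (N1 : RtoC (INR (S k)) <> 0) by (apply RtoC_neq, not_0_INR; lia). pose proof (fact_neq k).
      assert (N2 : z + h + (c0 + INR k) <> 0).
      { apply Cmod_pos_neq. replace (z + h + (c0 + INR k)) with ((z + (c0 + INR k)) + h) by ring.
        pose proof (Cmod_rev_triangle (z + (c0 + INR k)) h). lra. }
      field. auto.
    + pose proof (tay_pos _ _ _ _ T) as M0.
      assert (X1 : (Cmod (a1 * z + (a0 + INR k)) + Cmod a1 <= A + INR k)%R).
      { replace (a1 * z + (a0 + INR k)) with (a1 * z + a0 + INR k) by ring.
        pose proof (Cmod_triangle (a1 * z + a0) (INR k)) as L. rewrite Cmod_INR in L. unfold A. lra. }
      assert (N1 : RtoC (INR (S k)) <> 0) by (apply RtoC_neq, not_0_INR; lia).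
      assert (P : (0 < INR (S k))%R) by (apply lt_0_INR; lia).
      assert (X2 : (Cmod (b1 / INR (S k) * z + (b0 + INR k) / INR (S k)) + Cmod (b1 / INR (S k)) <= r)%R).
      { replace (b1 / INR (S k) * z + (b0 + INR k) / INR (S k)) with ((b1 * z + b0 + INR k) / INR (S k)) by (field; auto).
        rewrite !Cmod_div, !Cmod_INR by auto.
        pose proof (Cmod_triangle (b1 * z + b0) (INR k)) as L. rewrite Cmod_INR in L.
        apply Rmult_le_reg_r with (INR (S k)); auto. unfold Rdiv. rewrite Rmult_plus_distr_r, !Rmult_assoc, Rinv_l, !Rmult_1_r by lra.
        unfold B in L2. rewrite S_INR. lra. }
      assert (X3 : (/ (Cmod (z + (c0 + INR k)) - 1) <= / (INR k - D))%R) by (apply Rinv_le_contravar; lra).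
      apply Rle_trans with (M * (A + INR k) * r * / (INR k - D))%R.
      * assert (Y1 : (0 <= Cmod (a1 * z + (a0 + INR k)) + Cmod a1)%R) by (apply Rplus_le_le_0_compat; apply Cmod_ge_0).
        assert (Y2 : (0 <= Cmod (b1 / INR (S k) * z + (b0 + INR k) / INR (S k)) + Cmod (b1 / INR (S k)))%R) by (apply Rplus_le_le_0_compat; apply Cmod_ge_0).
        assert (Y3 : (0 <= / (Cmod (z + (c0 + INR k)) - 1))%R) by (left; apply Rinv_0_lt_compat; lra).
        repeat apply Rmult_le_compat; auto; repeat apply Rmult_le_pos; auto; lra.
      * rewrite <- Hr2. apply Rmult_le_reg_r with (INR k - D)%R; [lra|].
        rewrite Rmult_assoc, Rinv_l, Rmult_1_r by lra.
        replace (r * r * M * (INR k - D))%R with (M * (r * (INR k - D)) * r)%R by ring.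
        apply Rmult_le_compat_r; [lra|]. apply Rmult_le_compat_l; auto.
Qed.

Lemma hcoef_bound a b c q : (1 < q)%R -> exists K, (0 <= K)%R /\
  forall k, (Cmod (hcoef a b c k) <= K * q ^ k)%R.
Proof.
  intros Hq. destruct (tay_hcoef 0 a 0 b 0 c q Hq) as [d [K [HK T]]]. exists K. split; auto.
  intros k. specialize (T k). apply tay_bound0 in T.
  replace (0 * c + a) with a in T by ring. replace (0 * c + b) with b in T by ring.
  replace (c + 0) with c in T by ring. exact T.
Qed.

(** Room between [q] and the radius of convergence. *)
Lemma exists_ratio (r : R) : (0 <= r < 1)%R -> exists q, (1 < q)%R /\ (q * r < 1)%R.
Proof.
  intros H. exists (2 / (1 + r))%R. split.
  - apply Rmult_lt_reg_r with (1 + r)%R; [lra|]. unfold Rdiv. rewrite Rmult_assoc, Rinv_l by lra. lra.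
  - apply Rmult_lt_reg_r with (1 + r)%R; [lra|].
    replace (2 / (1 + r) * r * (1 + r))%R with (2 * r)%R by (field; lra). lra.
Qed.

Lemma pow_term_bound (c w : C) K q r k : (Cmod c <= K * q ^ k)%R -> (0 <= K)%R -> (0 <= q)%R -> (Cmod w <= r)%R ->
  (Cmod (c * w ^ k) <= K * (q * r) ^ k)%R.
Proof.
  intros Hc HK Hq Hw. rewrite Cmod_mult, Cmod_pow, Rpow_mult_distr, <- Rmult_assoc.
  apply Rmult_le_compat; auto using Cmod_ge_0.
  - apply pow_le, Cmod_ge_0.
  - apply pow_incr. split; auto using Cmod_ge_0.
Qed.

Lemma pow_series_cvg (c : nat -> C) K q w : (forall k, (Cmod (c k) <= K * q ^ k)%R) -> (0 <= K)%R -> (0 <= q)%R ->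
  (q * Cmod w < 1)%R -> exists l, cseries (fun k => c k * w ^ k) l.
Proof.
  intros Hc HK Hq Hw. destruct (series_dom (fun k => c k * w ^ k) (fun k => K * (q * Cmod w) ^ k)%R) as [l [Hl _]].
  - intros k. apply pow_term_bound; auto; lra.
  - apply ex_series_geom_scal. split; auto. apply Rmult_le_pos; auto. apply Cmod_ge_0.
  - now exists l.
Qed.

Lemma hreg_series a b c w : (Cmod w < 1)%R -> cseries (fun k => hcoef a b c k * w ^ k) (hreg a b c w).
Proof.
  intros Hw. destruct (exists_ratio (Cmod w)) as [q [Hq Hqr]]. { split; auto. apply Cmod_ge_0. }
  destruct (hcoef_bound a b c q Hq) as [K [HK HB]].
  destruct (pow_series_cvg _ K q w HB HK) as [l Hl]; [lra|auto|].
  unfold hreg. now rewrite (CSeries_eq _ _ Hl).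
Qed.

Lemma pow_diff_bound (w w' : C) r r' k : (0 <= r < r')%R -> (Cmod w <= r)%R -> (Cmod w' <= r)%R ->
  (Cmod (w ^ k - w' ^ k) * (r' - r) <= Cmod (w - w') * r' ^ k)%R.
Proof.
  intros Hr Hw Hw'. pose proof (Cmod_ge_0 (w - w')) as D0.
  induction k as [|k IH].
  - simpl. replace (1 - 1) with (RtoC 0) by ring. rewrite Cmod_0. lra.
  - replace (w ^ S k - w' ^ S k) with (w * (w ^ k - w' ^ k) + (w - w') * w' ^ k) by (simpl; ring).
    assert (P : (Cmod w' ^ k <= r' ^ k)%R) by (apply pow_incr; split; [apply Cmod_ge_0|lra]).
    assert (Q : (Cmod (w * (w ^ k - w' ^ k) + (w - w') * w' ^ k) <= r * Cmod (w ^ k - w' ^ k) + Cmod (w - w') * r' ^ k)%R).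
    { eapply Rle_trans; [apply Cmod_triangle|]. rewrite !Cmod_mult, Cmod_pow.
      apply Rplus_le_compat; [apply Rmult_le_compat_r; auto; apply Cmod_ge_0|apply Rmult_le_compat_l; auto]. }
    apply Rle_trans with ((r * Cmod (w ^ k - w' ^ k) + Cmod (w - w') * r' ^ k) * (r' - r))%R.
    + apply Rmult_le_compat_r; lra.
    + simpl. apply Rle_trans with (r * (Cmod (w - w') * r' ^ k) + Cmod (w - w') * r' ^ k * (r' - r))%R; [|right; ring].
      rewrite Rmult_plus_distr_r, Rmult_assoc. apply Rplus_le_compat_r. apply Rmult_le_compat_l; lra.
Qed.

Lemma pow_series_lipschitz (c : nat -> C) K q r (F : C -> C) :
  (forall k, (Cmod (c k) <= K * q ^ k)%R) -> (0 <= K)%R -> (0 < q)%R -> (0 <= r)%R -> (q * r < 1)%R ->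
  (forall w, (Cmod w <= r)%R -> cseries (fun k => c k * w ^ k) (F w)) ->
  exists L, (0 <= L)%R /\ forall w w', (Cmod w <= r)%R -> (Cmod w' <= r)%R -> (Cmod (F w - F w') <= L * Cmod (w - w'))%R.
Proof.
  intros Hc HK Hq Hr Hqr HF.
  set (r' := ((r + / q) / 2)%R).
  assert (Hi : (r < / q)%R). { apply Rmult_lt_reg_l with q; auto. rewrite Rinv_r by lra. auto. }
  assert (Hr' : (r < r')%R) by (unfold r'; lra).
  assert (Hqr' : (q * r' < 1)%R). { unfold r'. apply Rle_lt_trans with ((q * r + 1) / 2)%R; [right; field; lra|lra]. }
  assert (HG : (0 <= q * r' < 1)%R) by (split; auto; apply Rmult_le_pos; lra).
  assert (ES : ex_series (fun k => K * (q * r') ^ k)%R) by now apply ex_series_geom_scal.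
  exists (Series (fun k => K * (q * r') ^ k) / (r' - r))%R. split.
  - apply Rmult_le_pos; [|left; apply Rinv_0_lt_compat; lra].
    rewrite Series_scal_l. apply Rmult_le_pos; auto. rewrite Series_geom by (rewrite Rabs_pos_eq; lra).
    left; apply Rinv_0_lt_compat; lra.
  - intros w w' Hw Hw'.
    destruct (series_dom (fun k => c k * w ^ k - c k * w' ^ k) (fun k => (Cmod (w - w') / (r' - r)) * (K * (q * r') ^ k))%R) as [l [Hl HB]].
    + intros k. replace (c k * w ^ k - c k * w' ^ k) with (c k * (w ^ k - w' ^ k)) by ring.
      rewrite Cmod_mult. pose proof (pow_diff_bound w w' r r' k ltac:(lra) Hw Hw') as P.
      assert (P' : (Cmod (w ^ k - w' ^ k) <= Cmod (w - w') * r' ^ k / (r' - r))%R).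
      { apply Rmult_le_reg_r with (r' - r)%R; [lra|]. unfold Rdiv. rewrite Rmult_assoc, Rinv_l, Rmult_1_r by lra. exact P. }
      apply Rle_trans with (K * q ^ k * (Cmod (w - w') * r' ^ k / (r' - r)))%R.
      apply Rmult_le_compat; auto using Cmod_ge_0.
      rewrite Rpow_mult_distr. right. field. lra.
    + now apply (ex_series_scal (V := R_NormedModule)).
    + replace (F w - F w') with l.
      * eapply Rle_trans; [exact HB|]. rewrite Series_scal_l. right. field. lra.
      * eapply cseries_unique; [exact Hl|]. apply cseries_minus; auto.
Qed.

Lemma hreg_lipschitz a b c r : (0 <= r < 1)%R ->
  exists L, (0 <= L)%R /\ forall w w', (Cmod w <= r)%R -> (Cmod w' <= r)%R ->
    (Cmod (hreg a b c w - hreg a b c w') <= L * Cmod (w - w'))%R.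
Proof.
  intros Hr. destruct (exists_ratio r Hr) as [q [Hq Hqr]]. destruct (hcoef_bound a b c q Hq) as [K [HK HB]].
  apply (pow_series_lipschitz (hcoef a b c) K q r); auto; try lra.
  intros w Hw. apply hreg_series. lra.
Qed.

(** The derivative in the parameter is again Lipschitz in the variable, which
    makes it a legitimate integrand later on. *)
Lemma tay_hreg a1 a0 b1 b0 c0 z r : (0 <= r < 1)%R ->
  exists (D : C -> C) M L, (0 <= L)%R /\
   (forall w, (Cmod w <= r)%R -> tay (fun u => hreg (a1 * u + a0) (b1 * u + b0) (u + c0) w) z (D w) M) /\
   (forall w w', (Cmod w <= r)%R -> (Cmod w' <= r)%R -> (Cmod (D w - D w') <= L * Cmod (w - w'))%R).
Proof.
  intros Hr. destruct (exists_ratio r Hr) as [q [Hq Hqr]].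
  destruct (tay_hcoef a1 a0 b1 b0 c0 z q Hq) as [d [K [HK T]]].
  assert (HG : (0 <= q * r < 1)%R) by (split; auto; apply Rmult_le_pos; lra).
  set (M := Series (fun k => K * (q * r) ^ k)%R).
  assert (X : forall w, (Cmod w <= r)%R -> exists D, cseries (fun k => d k * w ^ k) D /\
     tay (fun u => hreg (a1 * u + a0) (b1 * u + b0) (u + c0) w) z D M).
  { intros w Hw.
    apply (tay_series (fun k u => hcoef (a1 * u + a0) (b1 * u + b0) (u + c0) k * w ^ k) (fun k => d k * w ^ k) (fun k => K * (q * r) ^ k)%R).
    - intros k. eapply tay_deq; [|eapply tay_weaken; [|apply tay_mult; [apply T|apply (tay_const (w ^ k))]]].
      simpl. ring. rewrite Cmod_pow, Rpow_mult_distr, <- Rmult_assoc. apply Rmult_le_compat_l.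
      + eapply tay_pos; apply (T k).
      + apply pow_incr. split; auto. apply Cmod_ge_0.
    - now apply ex_series_geom_scal.
    - intros h Hh. apply hreg_series. lra. }
  exists (fun w => CSeries (fun k => d k * w ^ k)), M.
  assert (DS : forall w, (Cmod w <= r)%R -> cseries (fun k => d k * w ^ k) (CSeries (fun k => d k * w ^ k))).
  { intros w Hw. destruct (X w Hw) as [D [HD _]]. now rewrite (CSeries_eq _ _ HD). }
  destruct (pow_series_lipschitz d K q r (fun w => CSeries (fun k => d k * w ^ k))) as [L [HL Lip]]; auto; try lra.
  { intros k. destruct (T k) as [H _]. pose proof (Cmod_ge_0 (hcoef (a1 * z + a0) (b1 * z + b0) (z + c0) k)). lra. }
  exists L. split; auto. split; auto.
  intros w Hw. destruct (X w Hw) as [D [HD TD]]. now rewrite (CSeries_eq _ _ HD).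
Qed.

Lemma pFq21_series a b c w : ~ nonpos_int c -> (Cmod w < 1)%R ->
  cseries (pFq_term (cons a (cons b nil)) (cons c nil) w) (hreg a b c w / rgamma c).
Proof.
  intros Hc Hw. pose proof (rgamma_neq_0 c Hc) as N.
  pose proof (cseries_scal (/ rgamma c) _ _ (hreg_series a b c w Hw)) as H.
  unfold Cdiv. rewrite Cmult_comm. eapply cseries_ext; [|exact H].
  intros k. unfold hcoef, pFq_term, pochs; simpl. rewrite (rgamma_poch c k) in *.
  pose proof (poch_nonpole c k Hc). pose proof (fact_neq k).
  assert (rgamma (c + INR k) <> 0) by (intros E; apply N; rewrite E; ring).
  field. auto.
Qed.

Lemma hyp2F1_series a b c w l : cseries (pFq_term (cons a (cons b nil)) (cons c nil) w) l -> hyp2F1 a b c w = l.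
Proof.
  intros H. unfold hyp2F1, analytic_ext.
  destruct (excluded_middle_informative _) as [_|F].
  - unfold pFq. now apply CSeries_eq.
  - exfalso. apply F. eapply cseries_Cex; eauto.
Qed.

(** At a pole of Gamma, the limit is reached because the series with entire
    coefficients is continuous in [c]. *)
Lemma reg_hyp2F1_hreg a b c w : (Cmod w < 1)%R -> reg_hyp2F1 a b c w = hreg a b c w.
Proof.
  intros Hw.
  assert (G : forall c, ~ nonpos_int c -> / Gamma c * hyp2F1 a b c w = hreg a b c w).
  { intros c' Hc'. rewrite inv_Gamma by auto. rewrite (hyp2F1_series _ _ _ _ _ (pFq21_series a b c' w Hc' Hw)).
    field. now apply rgamma_neq_0. }
  unfold reg_hyp2F1. destruct (excluded_middle_informative _) as [P|P]; auto.
  apply CLim_eq. intros eps He.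
  destruct (tay_hreg 0 a 0 b 0 c (Cmod w)) as [D [M [L [_ [T _]]]]]. { split; auto. apply Cmod_ge_0. }
  specialize (T w (Rle_refl _)). destruct (tay_continuity _ _ _ _ T eps He) as [del [Hd HT]].
  exists (Rmin 1 del). split. { apply Rmin_glb_lt; lra. }
  intros u Hu Hn. rewrite G.
  - specialize (HT u (Rlt_le_trans _ _ _ Hn (Rmin_r _ _))).
    replace (0 * u + a) with a in HT by ring. replace (0 * u + b) with b in HT by ring. replace (u + 0) with u in HT by ring.
    replace (0 * c + a) with a in HT by ring. replace (0 * c + b) with b in HT by ring. replace (c + 0) with c in HT by ring.
    exact HT.
  - (* two distinct nonpositive integers are at distance at least 1 *)
    intros [m Hm]. destruct P as [n Hc]. rewrite Hm, Hc in *.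
    assert (Hl : (Cmod (- INR m - - INR n) < 1)%R) by (eapply Rlt_le_trans; [exact Hn|apply Rmin_l]).
    replace (- INR m - - INR n) with (RtoC (IZR (Z.of_nat n - Z.of_nat m))) in Hl.
    2:{ rewrite minus_IZR, <- !INR_IZR_INZ, RtoC_minus. ring. }
    rewrite Cmod_R, <- abs_IZR in Hl. apply lt_IZR in Hl. apply Hu. do 3 f_equal. lia.
Qed.

(** * Euler's transformation *)

Lemma cvg_ReIm u l : cvg u l <-> is_lim_seq (fun n => Re (u n)) (Re l) /\ is_lim_seq (fun n => Im (u n)) (Im l).
Proof.
  split.
  - intros H. split; apply is_lim_seq_spec; intros e; destruct (H e (cond_pos e)) as [N HN]; exists N; intros n Hn;
      specialize (HN n Hn); eapply Rle_lt_trans; try exact HN.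
    + exact (re_le_Cmod (u n - l)).
    + exact (Cmod_Im_le (u n - l)).
  - intros [H K]. apply cvg_dom with (fun n => Rabs (Re (u n) - Re l) + Rabs (Im (u n) - Im l))%R.
    + intros n. exact (Cmod_le_ReIm (u n - l)).
    + replace 0%R with (Rabs (Re l - Re l) + Rabs (Im l - Im l))%R by (rewrite !Rminus_diag_eq, Rabs_R0 by auto; ring).
      apply is_lim_seq_plus'; apply is_lim_seq_abs with (l := Finite _); (apply is_lim_seq_minus'; [assumption|apply is_lim_seq_const]).
Qed.

Lemma Re_csum f n : Re (csum f (S n)) = sum_n (fun k => Re (f k)) n.
Proof.
  induction n as [|n IH]. rewrite sum_O. simpl. apply Rplus_0_l.
  change (csum f (S (S n))) with (csum f (S n) + f (S n)). rewrite sum_Sn, <- IH. reflexivity.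
Qed.

Lemma Im_csum f n : Im (csum f (S n)) = sum_n (fun k => Im (f k)) n.
Proof.
  induction n as [|n IH]. rewrite sum_O. simpl. apply Rplus_0_l.
  change (csum f (S (S n))) with (csum f (S n) + f (S n)). rewrite sum_Sn, <- IH. reflexivity.
Qed.

Lemma cseries_ReIm a l : cseries a l <-> is_series (fun k => Re (a k)) (Re l) /\ is_series (fun k => Im (a k)) (Im l).
Proof.
  split.
  - intros H. apply (cvg_shift _ _ 1) in H. apply cvg_ReIm in H. destruct H as [H K]. split.
    + apply (is_lim_seq_ext _ (sum_n (fun k => Re (a k)))) in H; [exact H|]. intros n. rewrite Nat.add_1_r. apply Re_csum.
    + apply (is_lim_seq_ext _ (sum_n (fun k => Im (a k)))) in K; [exact K|]. intros n. rewrite Nat.add_1_r. apply Im_csum.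
  - intros [H K]. apply (cvg_unshift _ _ 1). apply cvg_ReIm. split.
    + apply (is_lim_seq_ext (sum_n (fun k => Re (a k)))); [|exact H]. intros n. rewrite Nat.add_1_r. now rewrite <- Re_csum.
    + apply (is_lim_seq_ext (sum_n (fun k => Im (a k)))); [|exact K]. intros n. rewrite Nat.add_1_r. now rewrite <- Im_csum.
Qed.

Lemma csum_Re_lin h (f g : nat -> R) s n : (forall k, Re (h k) = f k + s * g k)%R ->
  Re (csum h (S n)) = (sum_f_R0 f n + s * sum_f_R0 g n)%R.
Proof.
  intros E. induction n as [|n IH].
  - simpl. rewrite E. ring.
  - change (csum h (S (S n))) with (csum h (S n) + h (S n)). simpl sum_f_R0.
    rewrite re_plus, IH, E. ring.
Qed.

Lemma csum_Im_lin h (f g : nat -> R) n : (forall k, Im (h k) = f k + g k)%R ->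
  Im (csum h (S n)) = (sum_f_R0 f n + sum_f_R0 g n)%R.
Proof.
  intros E. induction n as [|n IH].
  - simpl. rewrite E. ring.
  - change (csum h (S (S n))) with (csum h (S n) + h (S n)). simpl sum_f_R0.
    change (Im (csum h (S n) + h (S n))) with (Im (csum h (S n)) + Im (h (S n)))%R. rewrite IH, E. ring.
Qed.

(** Apply the real theorem to the four products of real and imaginary parts. *)
Lemma cauchy_product a b la lb (Ma Mb : nat -> R) :
  cseries a la -> cseries b lb -> (forall k, (Cmod (a k) <= Ma k)%R) -> (forall k, (Cmod (b k) <= Mb k)%R) ->
  ex_series Ma -> ex_series Mb ->
  cseries (fun n => csum (fun i => a i * b (n - i)%nat) (S n)) (la * lb).
Proof.
  intros Ha Hb HMa HMb EMa EMb. apply cseries_ReIm in Ha, Hb. destruct Ha as [A1 A2], Hb as [B1 B2].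
  assert (X : forall (c : nat -> C) (M : nat -> R), (forall k, (Cmod (c k) <= M k)%R) -> ex_series M ->
     ex_series (fun k => Rabs (Re (c k))) /\ ex_series (fun k => Rabs (Im (c k)))).
  { intros c M HM EM. split; apply (ex_series_le (V := R_CompleteNormedModule) _ M); auto; intros k;
      (eapply Rle_trans; [|apply HM]); unfold norm; simpl; unfold abs; simpl; rewrite Rabs_Rabsolu.
    apply re_le_Cmod. apply Cmod_Im_le. }
  destruct (X a Ma HMa EMa) as [XA1 XA2]. destruct (X b Mb HMb EMb) as [XB1 XB2].
  pose proof (is_series_mult _ _ _ _ A1 B1 XA1 XB1) as P11. pose proof (is_series_mult _ _ _ _ A2 B2 XA2 XB2) as P22.
  pose proof (is_series_mult _ _ _ _ A1 B2 XA1 XB2) as P12. pose proof (is_series_mult _ _ _ _ A2 B1 XA2 XB1) as P21.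
  apply cseries_ReIm. split.
  - eapply is_series_ext; [|exact (is_series_minus (V := R_NormedModule) _ _ _ _ P11 P22)].
    intros n. cbv beta. symmetry. unfold plus, opp; simpl Hierarchy.plus.
    rewrite (csum_Re_lin _ (fun k => Re (a k) * Re (b (n - k)%nat))%R (fun k => Im (a k) * Im (b (n - k)%nat))%R (-1)).
    + simpl. ring.
    + intros k. simpl. unfold Re, Im. ring.
  - eapply is_series_ext; [|exact (is_series_plus (V := R_NormedModule) _ _ _ _ P12 P21)].
    intros n. cbv beta. symmetry.
    rewrite (csum_Im_lin _ (fun k => Re (a k) * Im (b (n - k)%nat))%R (fun k => Im (a k) * Re (b (n - k)%nat))%R).
    + reflexivity.
    + intros k. simpl. unfold Re, Im. ring.
Qed.

Definition binc (beta : C) (k : nat) : C := poch beta k / INR (fact k).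

Lemma binc_S beta k : RtoC (INR (S k)) * binc beta (S k) = (beta + INR k) * binc beta k.
Proof.
  unfold binc. rewrite fact_simpl, mult_INR, RtoC_mult. simpl poch.
  assert (RtoC (INR (S k)) <> 0) by (apply RtoC_neq, not_0_INR; lia). pose proof (fact_neq k). field. auto.
Qed.

Lemma binc_bound beta q : (1 < q)%R -> exists K, (0 <= K)%R /\ forall k, (Cmod (binc beta k) <= K * q ^ k)%R.
Proof.
  intros Hq. destruct (ratio_eventually (Cmod beta) (-1) q Hq) as [n0 H0].
  apply geom_of_ratio with n0; [lra|]. intros n Hn. destruct (H0 n Hn) as [H _].
  assert (P : (0 < INR (S n))%R) by (apply lt_0_INR; lia).
  apply Rmult_le_reg_l with (INR (S n)); auto. rewrite <- Cmod_INR at 1. rewrite <- Cmod_mult, binc_S, Cmod_mult.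
  pose proof (Cmod_triangle beta (INR n)) as T. rewrite Cmod_INR in T.
  replace (INR (S n) * (q * Cmod (binc beta n)))%R with (q * INR (S n) * Cmod (binc beta n))%R by ring.
  apply Rmult_le_compat_r; [apply Cmod_ge_0|]. rewrite S_INR. lra.
Qed.

Lemma cder_pow k t : cder (fun t => RtoC t ^ k) t (RtoC (INR k) * RtoC t ^ (pred k)).
Proof.
  induction k as [|k IH].
  - eapply cder_eq; [|apply (cder_const 1)]. simpl. ring.
  - eapply cder_eq; [|apply (cder_mult (fun t => RtoC t) (fun t => RtoC t ^ k)); [apply cder_id|exact IH]].
    rewrite RtoC_S. destruct k; simpl; ring.
Qed.

(** The truncated binomial series times the inverse power has derivative equal
    to the last term times a bounded factor, so it stays close to 1. *)
Lemma binomial_series beta (w : R) : (Rabs w < 1)%R ->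
  cseries (fun k => binc beta k * RtoC w ^ k) (Cpower (RtoC (1 - w)) (- beta)).
Proof.
  intros Hw. set (r := Rabs w) in *. assert (R0 : (0 <= r)%R) by apply Rabs_pos.
  destruct (exists_ratio r (conj R0 Hw)) as [q [Hq Hqr]].
  destruct (binc_bound (beta + 1) q Hq) as [K [HK HB]].
  set (Lam := exp (Cmod beta * - ln (1 - r))).
  assert (HP : forall t, (Rabs t <= r)%R -> (Cmod (Cpower (RtoC (1 - t)) beta) <= Lam)%R).
  { intros t Ht. assert (B : (1 - r <= 1 - t <= 1 + r)%R) by (apply Rabs_le_between in Ht; lra).
    rewrite Cpower_pos by lra. eapply Rle_trans; [apply Cmod_Cexp_le|]. apply exp_le.
    rewrite Cmod_mult, Cmod_R. apply Rmult_le_compat_l; [apply Cmod_ge_0|].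
    assert (L1 : (ln (1 - r) <= ln (1 - t))%R) by (apply ln_le; lra).
    assert (L2 : (ln (1 - t) <= ln (1 + r))%R) by (apply ln_le; lra).
    assert (L3 : (ln (1 + r) + ln (1 - r) <= 0)%R).
    { rewrite <- ln_mult by lra. rewrite <- ln_1. apply ln_le; [|nra]. nra. }
    apply Rabs_le. lra. }
  set (B := fun (M : nat) (t : R) => csum (fun k => binc beta k * RtoC t ^ k) M).
  assert (DB : forall M t, cder (B M) t (csum (fun k => binc beta k * (RtoC (INR k) * RtoC t ^ pred k)) M)).
  { intros M t. apply (cder_csum (fun k t => binc beta k * RtoC t ^ k)). intros i _. apply cder_scal, cder_pow. }
  assert (ODE : forall M t, (1 - RtoC t) * csum (fun k => binc beta k * (RtoC (INR k) * RtoC t ^ pred k)) (S M) - beta * B (S M) t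
     = - (RtoC (INR (S M)) * binc beta (S M) * RtoC t ^ M)).
  { intros M t. unfold B. induction M as [|M IH].
    - rewrite binc_S. simpl. ring.
    - rewrite binc_S. rewrite binc_S in IH.
      change (csum ?f (S (S M))) with (csum f (S M) + f (S M)). cbv beta.
      transitivity (- ((beta + INR M) * binc beta M * RtoC t ^ M) + (1 - RtoC t) * (binc beta (S M) * (RtoC (INR (S M)) * RtoC t ^ M)) - beta * (binc beta (S M) * (RtoC t ^ S M))).
      + rewrite <- IH. simpl pred. ring.
      + rewrite <- binc_S. simpl. ring. }
  set (g := fun M t => Cpower (RtoC (1 - t)) beta * B (S M) t).
  set (dg := fun (M : nat) (t : R) => - Cpower (RtoC (1 - t)) beta * / RtoC (1 - t) * (RtoC (INR (S M)) * binc beta (S M) * RtoC t ^ M)).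
  assert (DG : forall M t, (Rabs t <= r)%R -> cder (g M) t (dg M t)).
  { unfold dg. intros M t Ht. assert (Pt : (0 < 1 - t)%R) by (apply Rabs_le_between in Ht; lra).
    assert (DP : cder (fun t => Cpower (RtoC (1 - t)) beta) t (- beta * / RtoC (1 - t) * Cpower (RtoC (1 - t)) beta)).
    { apply (cder_ext (fun t => Cexp (beta * Clog (RtoC (1 - t))))); [reflexivity|].
      assert (DC : cder (fun t => Cexp (beta * RtoC (ln (1 - t)))) t (- beta * / RtoC (1 - t) * Cpower (RtoC (1 - t)) beta)).
      { rewrite Cpower_pos by auto. apply cder_Cexp.
        eapply cder_eq; [|apply cder_scal; apply cder_RtoC].
        2:{ evar_last. apply (is_derive_comp (V := R_NormedModule) ln (fun t => 1 - t)%R).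
            apply is_derive_Reals, derivable_pt_lim_ln; auto.
            auto_derive; auto. reflexivity. }
        unfold scal; simpl; unfold mult; simpl. rewrite <- (RtoC_inv (1 - t)), RtoC_mult, RtoC_opp by lra. ring. }
      destruct DC as [D1 D2].
      assert (EV : locally t (fun y => Cexp (beta * RtoC (ln (1 - y))) = Cexp (beta * Clog (RtoC (1 - y))))).
      { exists (mkposreal _ Pt). intros y Hy. change (Rabs (y - t) < 1 - t)%R in Hy.
        rewrite <- Cpower_pos; auto. apply Rabs_lt_between in Hy. lra. }
      split; (eapply is_derive_ext_loc; [|eassumption]); (eapply filter_imp; [|exact EV]); intros y Hy; cbv beta; now rewrite Hy. }
    eapply cder_eq; [|apply cder_mult; [exact DP|apply DB]].
    assert (N : RtoC (1 - t) <> 0) by (apply RtoC_neq; lra).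
    pose proof (ODE M t) as E. apply (f_equal (fun u => Cpower (RtoC (1 - t)) beta * / RtoC (1 - t) * u)) in E.
    cbv beta; symmetry. transitivity (Cpower (RtoC (1 - t)) beta * / RtoC (1 - t) * - (RtoC (INR (S M)) * binc beta (S M) * RtoC t ^ M)); [ring|].
    rewrite <- E. replace (1 - RtoC t) with (RtoC (1 - t)) by (rewrite RtoC_minus; ring). field. auto. }
  assert (G0 : forall M, g M 0%R = 1).
  { intros M. unfold g, B. rewrite Rminus_0_r. rewrite Cpower_pos, ln_1 by lra. replace (beta * RtoC 0) with (RtoC 0) by ring.
    rewrite Cexp_0, csum_S0. cbv beta.
    assert (Z : csum (fun i => binc beta (S i) * RtoC 0 ^ S i) M = 0) by (apply csum_zero; intros i _; simpl; ring).
    rewrite Z. unfold binc; simpl; field. }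
  set (e := fun M => ((Lam * / (1 - r) * (Cmod beta * K)) * (q * r) ^ M * r)%R).
  assert (EST : forall M, (Cmod (g M w - 1) <= e M)%R).
  { intros M.
    assert (DBD : forall t, (Rabs t <= r)%R -> (Cmod (dg M t) <= (Lam * / (1 - r) * (Cmod beta * K)) * (q * r) ^ M)%R).
    { intros t Ht. unfold dg. assert (Pt : (1 - r <= 1 - t)%R) by (apply Rabs_le_between in Ht; lra).
      replace (RtoC (INR (S M)) * binc beta (S M)) with (beta * binc (beta + 1) M).
      2:{ unfold binc. rewrite poch_S_l, fact_simpl, mult_INR, RtoC_mult.
          assert (RtoC (INR (S M)) <> 0) by (apply RtoC_neq, not_0_INR; lia). pose proof (fact_neq M). field. auto. }
      rewrite !Cmod_mult, Cmod_opp, Cmod_inv by (apply RtoC_neq; lra).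
      rewrite (Cmod_RtoC_pos (1 - t)), Cmod_pow, Cmod_R by lra. rewrite Rpow_mult_distr.
      apply Rle_trans with (Lam * / (1 - r) * (Cmod beta * (K * q ^ M) * r ^ M))%R; [|right; ring].
      assert (Pi : (0 <= / (1 - t))%R) by (left; apply Rinv_0_lt_compat; lra).
      apply Rmult_le_compat.
      - apply Rmult_le_pos; auto. apply Cmod_ge_0.
      - repeat apply Rmult_le_pos; try apply Cmod_ge_0. apply pow_le, Rabs_pos.
      - apply Rmult_le_compat; auto using Cmod_ge_0. apply Rinv_le_contravar; lra.
      - apply Rmult_le_compat.
        + apply Rmult_le_pos; apply Cmod_ge_0.
        + apply pow_le, Rabs_pos.
        + apply Rmult_le_compat_l; auto using Cmod_ge_0.
        + apply pow_incr. split; auto using Rabs_pos. }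
    rewrite <- (G0 M). unfold e. destruct (Rle_lt_dec 0 w) as [W|W].
    - assert (Er : r = w) by (unfold r; now apply Rabs_pos_eq).
      eapply Rle_trans; [apply (cder_MVI (g M) (dg M) 0 w (Lam * / (1 - r) * (Cmod beta * K) * (q * r) ^ M)); [exact W| |]|].
      + intros t Ht. apply DG. rewrite Rabs_pos_eq; lra.
      + intros t Ht. apply DBD. rewrite Rabs_pos_eq; lra.
      + right. rewrite Rminus_0_r. now rewrite <- Er.
    - assert (Er : r = (- w)%R) by (unfold r; now apply Rabs_left).
      rewrite Cmod_sub_sym.
      eapply Rle_trans; [apply (cder_MVI (g M) (dg M) w 0 (Lam * / (1 - r) * (Cmod beta * K) * (q * r) ^ M)); [exact (Rlt_le _ _ W)| |]|].
      + intros t Ht. apply DG. rewrite Rabs_left1; lra.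
      + intros t Ht. apply DBD. rewrite Rabs_left1; lra.
      + right. replace (0 - w)%R with r by lra. reflexivity. }
  assert (LE : is_lim_seq e 0%R).
  { unfold e. replace 0%R with (Lam * / (1 - r) * (Cmod beta * K) * 0 * r)%R by ring.
    apply is_lim_seq_mult'; [|apply is_lim_seq_const]. apply is_lim_seq_mult'; [apply is_lim_seq_const|].
    apply is_lim_seq_geom. rewrite Rabs_pos_eq; [auto|apply Rmult_le_pos; lra]. }
  pose proof (cvg_scal (Cpower (RtoC (1 - w)) (- beta)) _ _ (cvg_dom _ _ _ EST LE)) as CV.
  replace (Cpower (RtoC (1 - w)) (- beta) * 1) with (Cpower (RtoC (1 - w)) (- beta)) in CV by ring.
  apply (cvg_unshift _ _ 1). eapply cvg_ext; [|exact CV]. intros M. cbv beta. rewrite Nat.add_1_r. unfold g.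
  assert (P : (0 < 1 - w)%R) by (apply Rabs_lt_between in Hw; lra).
  rewrite Cmult_assoc, <- Cpower_plus by auto. replace (- beta + beta) with (RtoC 0) by ring. rewrite Cpower_0 by auto.
  unfold B. ring.
Qed.

(** The summand of Saalschuetz's sum, cleared of denominators; [i + j = k]. *)
Definition saal (a b c : C) (i j : nat) : C :=
  poch (a + b - c) i * poch (c - a) j * poch (c - b) j * poch (c + INR j) i / (INR (fact i) * INR (fact j)).

(** The recurrence in [k] of the sum, by creative telescoping: the right-hand
    side is the certificate. *)
Lemma saal_telescope a b c k m : (m <= S k)%nat ->
  csum (fun i => RtoC (INR (S k)) * saal a b c i (S k - i) - (a + INR k) * (b + INR k) * saal a b c i (k - i)) m
  = match m with O => 0 | S i => - (c + INR (2 * k - i)) * (a + b - c + INR i) * saal a b c i (k - i) end.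
Proof.
  induction m as [|i IH]; intros Hm; [reflexivity|].
  change (csum ?f (S i)) with (csum f i + f i). rewrite IH by lia. clear IH. cbv beta.
  destruct i as [|i].
  - rewrite !Nat.sub_0_r. unfold saal. simpl poch. rewrite (fact_simpl k), mult_INR, RtoC_mult, !RtoC_S, mult_INR, RtoC_mult.
    pose proof (fact_neq k). pose proof (INR_S_neq k). simpl (fact 0). simpl (INR 2). simpl (INR 0). simpl (INR 1). rewrite RtoC_plus. field. auto.
  - set (j := (k - S i)%nat). replace (S k - S i)%nat with (S j) by lia. replace (k - i)%nat with (S j) by lia.
    assert (E1 : RtoC (INR k) = INR i + 1 + INR j) by (rewrite <- RtoC_S, <- RtoC_INR_add; do 2 f_equal; lia).
    assert (E2 : RtoC (INR (2 * k - S i)) = INR i + 1 + INR j + INR j) by (rewrite <- RtoC_S, <- !RtoC_INR_add; do 2 f_equal; lia).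
    assert (E3 : RtoC (INR (2 * k - i)) = INR i + 1 + INR j + INR j + 1) by (rewrite <- RtoC_S, <- !RtoC_INR_add, <- RtoC_S; do 2 f_equal; lia).
    rewrite E2, E3, RtoC_S, E1. unfold saal.
    rewrite (poch_S_l (c + INR j) i).
    replace (c + INR j + 1) with (c + INR (S j)) by (rewrite RtoC_S; ring).
    rewrite !fact_simpl, !mult_INR, !RtoC_mult, !poch_S, !RtoC_S.
    pose proof (fact_neq i). pose proof (fact_neq j). pose proof (INR_S_neq i). pose proof (INR_S_neq j).
    field. auto.
Qed.

Lemma saal_sum a b c k : csum (fun i => saal a b c i (k - i)) (S k) = poch a k * poch b k / INR (fact k).
Proof.
  induction k as [|k IH].
  - unfold saal. simpl. field.
  - pose proof (saal_telescope a b c k (S k) (le_n _)) as T. cbv iota in T.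
    rewrite csum_minus, !csum_scal, IH in T.
    change (csum (fun i => saal a b c i (S k - i)) (S (S k))) with
      (csum (fun i => saal a b c i (S k - i)) (S k) + saal a b c (S k) (S k - S k)).
    assert (N : RtoC (INR (S k)) <> 0) by (apply RtoC_neq, not_0_INR; lia).
    replace (csum (fun i => saal a b c i (S k - i)) (S k)) with
      (((a + INR k) * (b + INR k) * (poch a k * poch b k / INR (fact k)) + - (c + INR (2 * k - k)) * (a + b - c + INR k) * saal a b c k (k - k)) / INR (S k)).
    2:{ rewrite <- T. pose proof (fact_neq k). field. auto. }
    rewrite !Nat.sub_diag. replace (2 * k - k)%nat with k by lia. unfold saal.
    rewrite !fact_simpl, !mult_INR, !RtoC_mult. simpl (poch (c - a) 0). simpl (poch (c - b) 0). simpl (INR 0).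
    replace (c + 0) with c by ring. rewrite !poch_S. simpl (fact 0). simpl (INR 1). pose proof (fact_neq k). field. auto.
Qed.

(** The Cauchy product of the binomial series with the transformed series has
    Saalschuetz's sums as coefficients. *)
Lemma hreg_euler a b c (w : R) : (Rabs w < 1)%R ->
  hreg a b c w = Cpower (RtoC (1 - w)) (c - a - b) * hreg (c - a) (c - b) c w.
Proof.
  intros Hw. set (r := Rabs w) in *. assert (R0 : (0 <= r)%R) by apply Rabs_pos.
  destruct (exists_ratio r (conj R0 Hw)) as [q [Hq Hqr]].
  assert (Cw : Cmod w = r) by apply Cmod_R.
  destruct (binc_bound (a + b - c) q Hq) as [K1 [HK1 HB1]].
  destruct (hcoef_bound (c - a) (c - b) c q Hq) as [K2 [HK2 HB2]].
  assert (HG : (0 <= q * r < 1)%R) by (split; auto; apply Rmult_le_pos; lra).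
  pose proof (binomial_series (a + b - c) w Hw) as S1.
  pose proof (hreg_series (c - a) (c - b) c w ltac:(lra)) as S2.
  pose proof (cauchy_product _ _ _ _ (fun k => K1 * (q * r) ^ k)%R (fun k => K2 * (q * r) ^ k)%R S1 S2) as CP.
  replace (c - a - b) with (- (a + b - c)) by ring.
  eapply cseries_unique; [apply hreg_series; lra|].
  eapply cseries_ext; [|apply CP].
  - intros k. cbv beta.
    transitivity (csum (fun i => rgamma (c + INR k) * RtoC w ^ k * saal a b c i (k - i)) (S k)).
    + apply csum_ext. intros i Hi. unfold binc, hcoef, saal.
      rewrite (rgamma_poch (c + INR (k - i)) i).
      replace (c + INR (k - i) + INR i) with (c + INR k).
      2:{ rewrite <- Cplus_assoc, <- RtoC_INR_add. do 3 f_equal. lia. }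
      replace (RtoC w ^ k) with (RtoC w ^ i * RtoC w ^ (k - i)) by (rewrite <- Cpow_add_r; f_equal; lia).
      pose proof (fact_neq i). pose proof (fact_neq (k - i)). field. auto.
    + rewrite csum_scal, saal_sum. unfold hcoef. unfold Cdiv. ring.
  - intros k. apply pow_term_bound; auto; lra.
  - intros k. apply pow_term_bound; auto; lra.
  - now apply ex_series_geom_scal.
  - now apply ex_series_geom_scal.
Qed.

(** * Homogeneous Jacobi polynomials *)

(** The coefficients [1 / ((c)_i i!)] up to a common factor.  In the form of a
    recurrence the notion is stable under differentiation, which replaces [c] by
    [c + 1], without division by [c]. *)
Definition hseq (c : C) (h : nat -> C) : Prop :=
  forall i, (INR i + 1) * (c + INR i) * h (S i) = h i.

Definition hshift (h : nat -> C) (i : nat) : C := (INR i + 1) * h (S i).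

Lemma hseq_shift c h : hseq c h -> hseq (c + 1) (hshift h).
Proof.
  intros H i. unfold hshift. rewrite <- (H (S i)), RtoC_S. ring.
Qed.

(** With [r - p = 1] and [x = p + r] this is a multiple of the Jacobi polynomial
    of degree [N] at [x]. *)
Definition jac (h k : nat -> C) (N : nat) (p r : C) : C :=
  csum (fun i => h i * k (N - i)%nat * p ^ i * r ^ (N - i)) (S N).

(** The same sum with weights polynomial in the two exponents: on such sums,
    multiplication by [p] or [r] and differentiation act on the weights, and
    identities between contiguous [jac] become identities between weights. *)
Definition wjac (phi : C -> C -> C) (h k : nat -> C) (N : nat) (p r : C) : C :=
  csum (fun i => phi (INR i) (INR (N - i)) * (h i * k (N - i)%nat * p ^ i * r ^ (N - i))) (S N).

Lemma jac_wjac h k N p r : jac h k N p r = wjac (fun _ _ => 1) h k N p r.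
Proof. apply csum_ext. intros; ring. Qed.

Lemma wjac_ext phi psi h k N p r : (forall x y, x + y = INR N -> phi x y = psi x y) ->
  wjac phi h k N p r = wjac psi h k N p r.
Proof.
  intros E. apply csum_ext. intros i Hi. rewrite E; auto. rewrite <- RtoC_INR_add. do 2 f_equal. lia.
Qed.

Lemma wjac_plus phi psi h k N p r :
  wjac phi h k N p r + wjac psi h k N p r = wjac (fun x y => phi x y + psi x y) h k N p r.
Proof. unfold wjac. rewrite <- csum_plus. apply csum_ext. intros; ring. Qed.

Lemma wjac_scal a phi h k N p r :
  a * wjac phi h k N p r = wjac (fun x y => a * phi x y) h k N p r.
Proof. unfold wjac. rewrite <- csum_scal. apply csum_ext. intros; ring. Qed.

Lemma wjac_p c phi h k N p r : hseq c h ->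
  p * wjac phi h k N p r = wjac (fun x y => x * (c + x - 1) * phi (x - 1) y) h k (S N) p r.
Proof.
  intros H. unfold wjac. rewrite (csum_S0 _ (S N)), <- csum_scal. cbv beta.
  rewrite <- Cplus_0_l at 1. f_equal; [simpl INR; ring|].
  apply csum_ext. intros i Hi. rewrite RtoC_S. replace (S N - S i)%nat with (N - i)%nat by lia.
  replace (INR i + 1 - 1) with (RtoC (INR i)) by ring. rewrite <- (H i) at 1. rewrite Cpow_S. ring.
Qed.

Lemma wjac_r d phi h k N p r : hseq d k ->
  r * wjac phi h k N p r = wjac (fun x y => y * (d + y - 1) * phi x (y - 1)) h k (S N) p r.
Proof.
  intros H. unfold wjac. change (csum ?f (S (S N))) with (csum f (S N) + f (S N)). cbv beta.
  rewrite Nat.sub_diag, <- csum_scal.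
  rewrite <- Cplus_0_r at 1. f_equal; [|simpl INR; ring].
  apply csum_ext. intros i Hi.
  replace (S N - i)%nat with (S (N - i)) by lia. rewrite RtoC_S.
  replace (INR (N - i) + 1 - 1) with (RtoC (INR (N - i))) by ring.
  rewrite <- (H (N - i)%nat) at 1. rewrite Cpow_S. ring.
Qed.

(** The three-term recurrence of Jacobi polynomials with parameters [c - 1] and
    [d - 1].  After multiplication by [p] and [r] has been moved to the weights, it
    is a polynomial identity between weights. *)
Lemma jac_recurrence c d h k n p r : hseq c h -> hseq d k ->
  let s := c + d - 2 in
  let x := RtoC (INR (S n)) in
  2 * (x + 1) * (x + s + 1) * (2 * x + s) * (x + c) * (x + d) * jac h k (S (S n)) p r
  = (2 * x + s + 1) * ((2 * x + s + 2) * (2 * x + s) * (p + r) + ((c - 1) * (c - 1) - (d - 1) * (d - 1)) * (r - p)) * jac h k (S n) p r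
    - 2 * (2 * x + s + 2) * ((r - p) * (r - p)) * jac h k n p r.
Proof.
  intros Hh Hk s x. rewrite !jac_wjac.
  set (J2 := wjac _ h k (S (S n)) p r). set (J1 := wjac _ h k (S n) p r). set (J0 := wjac _ h k n p r).
  transitivity ((2 * x + s + 1) * ((2 * x + s + 2) * (2 * x + s) - ((c - 1) * (c - 1) - (d - 1) * (d - 1))) * (p * J1)
    + (2 * x + s + 1) * ((2 * x + s + 2) * (2 * x + s) + ((c - 1) * (c - 1) - (d - 1) * (d - 1))) * (r * J1)
    + (- (2 * (2 * x + s + 2))) * (p * (p * J0)) + (4 * (2 * x + s + 2)) * (p * (r * J0))
    + (- (2 * (2 * x + s + 2))) * (r * (r * J0))); [|ring].
  unfold J2, J1, J0. rewrite !(wjac_p c), !(wjac_r d) by auto. rewrite !(wjac_p c) by auto.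
  rewrite !wjac_scal, !wjac_plus. apply wjac_ext. intros a b E.
  assert (Ex : x = a + b - 1) by (rewrite E; unfold x; rewrite !RtoC_S; ring).
  rewrite Ex. unfold s. ring.
Qed.

Lemma jac_crude h k N : exists A, (0 <= A)%R /\ forall (p r rho : R), (p <= 0 <= r)%R -> (r - p <= rho)%R ->
  (Cmod (jac h k N p r) <= A * rho ^ N)%R.
Proof.
  assert (F : forall m, (m <= S N)%nat -> exists A, (0 <= A)%R /\ forall (p r rho : R), (p <= 0 <= r)%R -> (r - p <= rho)%R ->
    (Cmod (csum (fun i => h i * k (N - i)%nat * RtoC p ^ i * RtoC r ^ (N - i))%C m) <= A * rho ^ N)%R).
  { induction m as [|m IH]; intros Hm.
    - exists 0%R. split; [lra|]. intros. simpl. rewrite Cmod_0. lra.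
    - destruct (IH ltac:(lia)) as [A [HA H]]. exists (A + Cmod (h m * k (N - m)%nat))%R.
      split. { apply Rplus_le_le_0_compat; auto. apply Cmod_ge_0. }
      intros p r rho Hpr Hrho. simpl. eapply Rle_trans; [apply Cmod_triangle|]. rewrite Rmult_plus_distr_r.
      apply Rplus_le_compat; auto. rewrite <- Cmult_assoc, Cmod_mult. apply Rmult_le_compat_l; [apply Cmod_ge_0|].
      rewrite Cmod_mult, !Cmod_pow, !Cmod_R. replace (rho ^ N)%R with (rho ^ m * rho ^ (N - m))%R by (rewrite <- pow_add; f_equal; lia).
      apply Rmult_le_compat; try (apply pow_le, Rabs_pos); apply pow_incr; split; try apply Rabs_pos.
      rewrite Rabs_left1; lra. rewrite Rabs_pos_eq; lra. }
  destruct (F (S N) (le_n _)) as [A [HA H]]. exists A. auto.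
Qed.

Lemma cvg_inv_shift (b : C) : cvg (fun n => / (INR n + b)) 0.
Proof.
  intros eps He. destruct (ratio_eventually 0 (Cmod b + / eps) 2 ltac:(lra)) as [n0 H0].
  exists n0. intros n Hn. destruct (H0 n Hn) as [_ H].
  pose proof (Cmod_rev_triangle (INR n) b) as T. rewrite Cmod_INR in T.
  assert (P : (0 < / eps)%R) by (apply Rinv_0_lt_compat; auto).
  assert (L : (/ eps < Cmod (INR n + b))%R) by lra.
  replace (/ (INR n + b) - 0) with (/ (INR n + b)) by ring. rewrite Cmod_inv by (apply Cmod_pos_neq; lra).
  replace eps with (/ / eps)%R by (apply Rinv_inv). apply Rinv_lt_contravar; auto. apply Rmult_lt_0_compat; lra.
Qed.

Lemma shift_neq_ev (b : C) : exists n0, forall n, (n0 <= n)%nat -> INR n + b <> 0.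
Proof.
  destruct (ratio_eventually 0 (Cmod b) 2 ltac:(lra)) as [n0 H0]. exists n0. intros n Hn.
  destruct (H0 n Hn) as [_ H]. apply Cmod_pos_neq.
  pose proof (Cmod_rev_triangle (INR n) b) as T. rewrite Cmod_INR in T. lra.
Qed.

Lemma cvg_ratio (a b : C) : cvg (fun n => (INR n + a) / (INR n + b)) 1.
Proof.
  destruct (shift_neq_ev b) as [n0 H0].
  apply cvg_ext_ev with (u := fun n => RtoC 1 + (a - b) * / (INR n + b)) (N := n0).
  - intros n Hn. field. auto.
  - assert (L : cvg (fun n => RtoC 1 + (a - b) * / (INR n + b)) (1 + (a - b) * 0)).
    2:{ replace (1 + (a - b) * 0) with (RtoC 1) in L by ring. exact L. }
    apply (cvg_plus (fun _ => 1) (fun n => (a - b) * / (INR n + b)) 1); [apply cvg_const|].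
    apply cvg_scal, cvg_inv_shift.
Qed.

(** The recurrence tends to [K_{n+2} = 2 X K_{n+1} - rho^2 K_n], whose
    characteristic roots [U], [conj U] have modulus [rho]: factoring the limit
    operator as (shift - U)(shift - conj U) gives a norm that grows by at most
    [q rho] per step. *)
Section JacBound.
Variables (al be ga : nat -> C) (eta eps : R) (n0 : nat) (q : R).
Hypothesis Heta : (0 < eta)%R.
Hypothesis Heps : (0 <= eps)%R.
Hypothesis H1 : (1 + eta + 2 * eps <= q)%R.
Hypothesis H2 : (eta + 3 * eps <= q * eta)%R.
Hypothesis Hal : forall n, (n0 <= n)%nat -> (Cmod (al n - 2) + Cmod (be n) <= 2 * eps)%R.
Hypothesis Hga : forall n, (n0 <= n)%nat -> (Cmod (ga n - 1) <= eps)%R.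

Lemma growth_step (K : nat -> C) (X rho rho1 : R) :
  (Rabs X <= rho)%R -> (rho <= rho1)%R ->
  (forall n, (n0 <= n)%nat -> K (S (S n)) = (al n * RtoC X + be n * RtoC rho) * K (S n) - ga n * RtoC (rho * rho) * K n) ->
  exists V : nat -> R, (forall n, (eta * rho1 * Cmod (K n) <= V n <= eta * rho1 * Cmod (K n) + (Cmod (K (S n)) + rho1 * Cmod (K n)))%R) /\
    forall n, (n0 <= n)%nat -> (V (S n) <= q * rho1 * V n)%R.
Proof.
  intros HX Hr HK. assert (R0 : (0 <= rho)%R) by (pose proof (Rabs_pos X); lra).
  assert (SQ : (0 <= rho * rho - X * X)%R).
  { apply Rabs_le_between in HX. nra. }
  set (U := (X, sqrt (rho * rho - X * X)) : C).
  assert (EU1 : U + Cconj U = 2 * RtoC X) by (apply injective_projections; simpl; ring).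
  assert (EU2 : U * Cconj U = RtoC (rho * rho)).
  { apply injective_projections; simpl; [|ring]. pose proof (sqrt_sqrt _ SQ). lra. }
  assert (MU : Cmod U = rho).
  { unfold Cmod, U; simpl. replace (X * (X * 1) + _)%R with (rho * rho)%R.
    - now apply sqrt_square.
    - pose proof (sqrt_sqrt _ SQ). lra. }
  assert (MU' : Cmod (Cconj U) = rho) by (now rewrite Cmod_conj).
  set (D := fun n => K (S n) - Cconj U * K n).
  exists (fun n => eta * rho1 * Cmod (K n) + Cmod (D n))%R.
  assert (P1 : (0 <= rho1)%R) by lra.
  split.
  - intros n. pose proof (Cmod_ge_0 (D n)). split; [lra|]. apply Rplus_le_compat_l. unfold D.
    eapply Rle_trans; [apply Cmod_triangle|]. rewrite Cmod_opp, Cmod_mult, MU'.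
    apply Rplus_le_compat_l. apply Rmult_le_compat_r; auto using Cmod_ge_0.
  - intros n Hn. specialize (HK n Hn). specialize (Hal n Hn). specialize (Hga n Hn).
    set (a := Cmod (K n)). set (b := Cmod (D n)). set (a' := Cmod (K (S n))).
    assert (A0 : (0 <= a)%R) by apply Cmod_ge_0. assert (B0 : (0 <= b)%R) by apply Cmod_ge_0.
    assert (A1 : (a' <= b + rho1 * a)%R).
    { unfold a'. replace (K (S n)) with (D n + Cconj U * K n) by (unfold D; ring).
      eapply Rle_trans; [apply Cmod_triangle|]. rewrite Cmod_mult, MU'. apply Rplus_le_compat_l.
      apply Rmult_le_compat_r; auto. }
    set (xi := ((al n - 2) * RtoC X + be n * RtoC rho) * K (S n) - (ga n - 1) * RtoC (rho * rho) * K n).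
    assert (ED : D (S n) = U * D n + xi).
    { unfold D, xi. rewrite HK. rewrite <- EU2. replace (RtoC X) with ((U + Cconj U) / 2) by (rewrite EU1; field). field. }
    assert (X1 : (Cmod xi <= 2 * eps * rho1 * a' + eps * (rho1 * rho1) * a)%R).
    { unfold xi. eapply Rle_trans; [apply Cmod_triangle|]. rewrite Cmod_opp, !Cmod_mult. fold a' a.
      apply Rplus_le_compat.
      - apply Rmult_le_compat_r; [apply Cmod_ge_0|]. eapply Rle_trans; [apply Cmod_triangle|].
        rewrite !Cmod_mult, !Cmod_R, (Rabs_pos_eq rho) by auto.
        apply Rle_trans with (Cmod (al n - 2) * rho1 + Cmod (be n) * rho1)%R.
        + apply Rplus_le_compat; apply Rmult_le_compat_l; try apply Cmod_ge_0; lra.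
        + rewrite <- Rmult_plus_distr_r. apply Rmult_le_compat_r; auto.
      - apply Rmult_le_compat_r; auto. rewrite Cmod_R, Rabs_pos_eq by nra.
        apply Rmult_le_compat; auto using Cmod_ge_0; nra. }
    assert (X2 : (Cmod (D (S n)) <= rho1 * b + Cmod xi)%R).
    { rewrite ED. eapply Rle_trans; [apply Cmod_triangle|]. rewrite Cmod_mult, MU. apply Rplus_le_compat_r.
      apply Rmult_le_compat_r; auto. }
    assert (S1 : (eta * rho1 * a' <= eta * rho1 * (b + rho1 * a))%R).
    { apply Rmult_le_compat_l; auto. apply Rmult_le_pos; lra. }
    assert (S2 : (2 * eps * rho1 * a' <= 2 * eps * rho1 * (b + rho1 * a))%R).
    { apply Rmult_le_compat_l; auto. apply Rmult_le_pos; lra. }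
    apply Rle_trans with ((1 + eta + 2 * eps) * (rho1 * b) + (eta + 3 * eps) * (rho1 * (rho1 * a)))%R; [lra|].
    assert (Q1 : (0 <= rho1 * b)%R) by (apply Rmult_le_pos; auto).
    assert (Q2 : (0 <= rho1 * (rho1 * a))%R) by (repeat apply Rmult_le_pos; auto).
    apply Rle_trans with (q * (rho1 * b) + q * eta * (rho1 * (rho1 * a)))%R; [|right; ring].
    apply Rplus_le_compat; apply Rmult_le_compat_r; auto.
Qed.
End JacBound.

Lemma cvg_ev u l eps : cvg u l -> (0 < eps)%R -> exists N, forall n, (N <= n)%nat -> (Cmod (u n - l) <= eps)%R.
Proof. intros H He. destruct (H eps He) as [N HN]. exists N. intros. left. auto. Qed.

(** The factor [N!^2] removes the decay of the coefficients: the normalized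
    polynomials satisfy a recurrence with convergent coefficients, to which
    [growth_step] applies from some degree on; lower degrees are bounded
    one by one. *)
Lemma jac_bound c d h k q : hseq c h -> hseq d k -> (1 < q)%R -> exists A, (0 <= A)%R /\
  forall N (p r rho : R), (p <= 0 <= r)%R -> (r - p <= rho)%R -> (0 < rho)%R ->
    (INR (fact N) ^ 2 * Cmod (jac h k N p r) <= A * (q * rho) ^ N)%R.
Proof.
  intros Hh Hk Hq.
  set (s := c + d - 2).
  (* the recurrence divided by its leading coefficient, written with factors that
     tend to 1 *)
  set (al := fun n : nat => let x := RtoC (INR (S n)) in 2 * (((x + 1) / (x + (s + 1))) * ((x + (s + 1) / 2) / (x + c)) * ((x + (s + 2) / 2) / (x + d)))).
  set (be := fun n : nat => let x := RtoC (INR (S n)) in (((c - 1) * (c - 1) - (d - 1) * (d - 1)) / 2) * (((x + 1) / (x + (s + 1))) * ((x + (s + 1) / 2) / (x + s / 2)) * (/ (x + c) * / (x + d)))).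
  set (ga := fun n : nat => let x := RtoC (INR (S n)) in ((x + 1) / (x + (s + 1))) * ((x + (s + 2) / 2) / (x + s / 2)) * (((x + 0) / (x + c)) * ((x + 0) / (x + d)))).
  assert (Sh : forall u l, cvg u l -> cvg (fun n => u (S n)) l).
  { intros u l H. apply (cvg_shift _ _ 1) in H. eapply cvg_ext; [|exact H]. intros n. cbv beta. now rewrite Nat.add_1_r. }
  assert (Lal : cvg al 2).
  { replace (RtoC 2) with (2 * (1 * 1 * 1)) by ring. unfold al. cbv zeta. apply cvg_scal.
    apply (Sh (fun n => (INR n + 1) / (INR n + (s + 1)) * ((INR n + (s + 1) / 2) / (INR n + c)) * ((INR n + (s + 2) / 2) / (INR n + d)))).
    repeat apply cvg_mult; apply cvg_ratio. }
  assert (Lbe : cvg be 0).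
  { replace (RtoC 0) with ((((c - 1) * (c - 1) - (d - 1) * (d - 1)) / 2) * (1 * 1 * (0 * 0))) by ring. apply cvg_scal.
    apply (Sh (fun n => (INR n + 1) / (INR n + (s + 1)) * ((INR n + (s + 1) / 2) / (INR n + s / 2)) * (/ (INR n + c) * / (INR n + d)))).
    repeat apply cvg_mult; try apply cvg_ratio; apply cvg_inv_shift. }
  assert (Lga : cvg ga 1).
  { replace (RtoC 1) with (1 * 1 * (1 * 1)) by ring.
    apply (Sh (fun n => (INR n + 1) / (INR n + (s + 1)) * ((INR n + (s + 2) / 2) / (INR n + s / 2)) * ((INR n + 0) / (INR n + c) * ((INR n + 0) / (INR n + d))))).
    repeat apply cvg_mult; apply cvg_ratio. }
  set (eta := ((q - 1) / 2)%R). assert (Heta : (0 < eta)%R) by (unfold eta; lra).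
  set (eps := Rmin (eta / 2) (eta * eta / 2)).
  assert (Heps : (0 < eps)%R) by (unfold eps; apply Rmin_glb_lt; nra).
  assert (E1 : (eps <= eta / 2)%R) by apply Rmin_l. assert (E2 : (eps <= eta * eta / 2)%R) by apply Rmin_r.
  destruct (cvg_ev _ _ _ Lal Heps) as [N1 HN1]. destruct (cvg_ev _ _ _ Lbe Heps) as [N2 HN2].
  destruct (cvg_ev _ _ _ Lga Heps) as [N3 HN3].
  destruct (shift_neq_ev (s + 1)) as [N4 HN4]. destruct (shift_neq_ev (s / 2)) as [N5 HN5].
  destruct (shift_neq_ev c) as [N6 HN6]. destruct (shift_neq_ev d) as [N7 HN7].
  set (n0 := (N1 + N2 + N3 + N4 + N5 + N6 + N7)%nat).
  set (K := fun p r n => RtoC (INR (fact n) ^ 2) * jac h k n p r).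
  assert (REC : forall p r n, (n0 <= n)%nat ->
     K p r (S (S n)) = (al n * (p + r) + be n * (r - p)) * K p r (S n) - ga n * ((r - p) * (r - p)) * K p r n).
  { intros p r n Hn. pose proof (jac_recurrence c d h k n p r Hh Hk) as R. cbv zeta in R. fold s in R.
    unfold K, al, be, ga. cbv zeta.
    set (J2 := jac h k (S (S n)) p r) in *. set (J1 := jac h k (S n) p r) in *. set (J0 := jac h k n p r) in *.
    rewrite (fact_simpl (S n)), (fact_simpl n), !mult_INR. rewrite !RtoC_pow, !RtoC_mult, (RtoC_S (S n)).
    assert (X1 := HN4 (S n) ltac:(lia)). assert (X2 := HN5 (S n) ltac:(lia)).
    assert (X3 := HN6 (S n) ltac:(lia)). assert (X4 := HN7 (S n) ltac:(lia)).
    assert (X5 := INR_S_neq (S n)).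
    set (x := RtoC (INR (S n))) in *.
    assert (X1' : x + s + 1 <> 0) by (intros E; apply X1; rewrite <- E; ring).
    assert (X2' : 2 * x + s <> 0).
    { intros E; apply X2. replace (x + s / 2) with ((2 * x + s) / 2) by field. rewrite E. field. }
    set (f := RtoC (INR (fact n))).
    apply (f_equal (fun u => u * ((x + 1) * f * f * x * x / (2 * (x + s + 1) * (2 * x + s) * (x + c) * (x + d))))) in R.
    transitivity (2 * (x + 1) * (x + s + 1) * (2 * x + s) * (x + c) * (x + d) * J2 * ((x + 1) * f * f * x * x / (2 * (x + s + 1) * (2 * x + s) * (x + c) * (x + d)))).
    - field. auto.
    - rewrite R. field. repeat split; auto; intros E; cbv beta in E; first [apply X2'; rewrite <- E; ring | apply X1'; rewrite <- E; ring]. }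
  assert (CR : forall m, exists A, (0 <= A)%R /\ forall n, (n <= m)%nat -> forall (p r rho : R), (p <= 0 <= r)%R -> (r - p <= rho)%R -> (0 < rho)%R ->
     (Cmod (K p r n) <= A * (q * rho) ^ n)%R).
  { assert (C1 : forall n, exists A, (0 <= A)%R /\ forall (p r rho : R), (p <= 0 <= r)%R -> (r - p <= rho)%R -> (0 < rho)%R -> (Cmod (K p r n) <= A * (q * rho) ^ n)%R).
    { intros n. destruct (jac_crude h k n) as [A [HA H]]. exists (INR (fact n) ^ 2 * A)%R.
      split. { apply Rmult_le_pos; auto. apply pow2_ge_0. }
      intros p r rho Hpr Hrho Hr0. unfold K. rewrite Cmod_mult, Cmod_RtoC_pos by apply pow2_ge_0.
      rewrite Rmult_assoc. apply Rmult_le_compat_l; [apply pow2_ge_0|]. eapply Rle_trans; [apply (H p r rho); auto|].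
      apply Rmult_le_compat_l; auto. apply pow_incr. nra. }
    induction m as [|m [A [HA IH]]].
    - destruct (C1 0%nat) as [A [HA H]]. exists A. split; auto. intros n Hn. replace n with 0%nat by lia. auto.
    - destruct (C1 (S m)) as [A' [HA' H]]. exists (A + A')%R. split; [lra|].
      intros n Hn p r rho Hpr Hrho Hr0. assert (PW : (0 <= (q * rho) ^ n)%R) by (apply pow_le; nra).
      destruct (Nat.eq_dec n (S m)) as [->|E].
      + specialize (H p r rho Hpr Hrho Hr0). nra.
      + specialize (IH n ltac:(lia) p r rho Hpr Hrho Hr0). nra. }
  destruct (CR (S n0)) as [A [HA HC]].
  exists (A * (eta + 1 + q) / eta + A)%R.
  assert (AP : (0 <= A * (eta + 1 + q) / eta)%R).
  { apply Rmult_le_pos; [apply Rmult_le_pos; lra|left; apply Rinv_0_lt_compat; auto]. }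
  split; [lra|].
  intros N p r rho Hpr Hrho Hr0.
  replace (INR (fact N) ^ 2 * Cmod (jac h k N p r))%R with (Cmod (K p r N)).
  2:{ unfold K. rewrite Cmod_mult, Cmod_RtoC_pos; auto. apply pow2_ge_0. }
  assert (PW : forall n, (0 <= (q * rho) ^ n)%R) by (intros n; apply pow_le; nra).
  destruct (Nat.le_gt_cases N (S n0)) as [HN|HN].
  { specialize (HC N HN p r rho Hpr Hrho Hr0). specialize (PW N). nra. }
  destruct (growth_step al be ga eta eps n0 q Heta (Rlt_le _ _ Heps)) with (K := K p r) (X := (p + r)%R) (rho := (r - p)%R) (rho1 := rho) as [V [HV1 HV2]]; auto.
  - unfold eta in *; lra.
  - unfold eta in *. nra.
  - intros n Hn. pose proof (HN1 n ltac:(lia)) as Y1. pose proof (HN2 n ltac:(lia)) as Y2.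
    replace (be n - 0) with (be n) in Y2 by ring. lra.
  - intros n Hn. apply HN3. lia.
  - apply Rabs_le. lra.
  - intros n Hn. rewrite REC by auto. rewrite RtoC_plus, RtoC_mult, RtoC_minus. reflexivity.
  - assert (G : forall n, (n0 <= n)%nat -> (V n <= A * (eta + 1 + q) * rho * (q * rho) ^ n)%R).
    { intros n Hn. induction Hn as [|n Hn IH].
      - destruct (HV1 n0) as [_ W]. eapply Rle_trans; [exact W|].
        pose proof (HC n0 ltac:(lia) p r rho Hpr Hrho Hr0) as B0. pose proof (HC (S n0) ltac:(lia) p r rho Hpr Hrho Hr0) as B1.
        simpl pow in B1.
        assert (S1 : (eta * rho * Cmod (K p r n0) <= eta * rho * (A * (q * rho) ^ n0))%R) by (apply Rmult_le_compat_l; nra).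
        assert (S2 : (rho * Cmod (K p r n0) <= rho * (A * (q * rho) ^ n0))%R) by (apply Rmult_le_compat_l; lra).
        lra.
      - eapply Rle_trans; [apply HV2; auto|]. simpl.
        apply Rle_trans with (q * rho * (A * (eta + 1 + q) * rho * (q * rho) ^ n))%R; [|right; ring].
        apply Rmult_le_compat_l; auto. nra. }
    destruct (HV1 N) as [W _]. specialize (G N ltac:(lia)).
    assert (FIN : (Cmod (K p r N) <= A * (eta + 1 + q) / eta * (q * rho) ^ N)%R).
    { apply Rmult_le_reg_l with (eta * rho)%R; [nra|].
      replace (eta * rho * (A * (eta + 1 + q) / eta * (q * rho) ^ N))%R with (A * (eta + 1 + q) * rho * (q * rho) ^ N)%R by (field; lra).
      lra. }
    specialize (PW N). nra.
Qed.

(** * Stability of the hypergeometric equation at its singular point *)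

Lemma Cmod_sq (a : C) : (Cmod a * Cmod a = Re a * Re a + Im a * Im a)%R.
Proof. pose proof (Cmod2_alt a). simpl in H. lra. Qed.

Lemma cder_incr_bound (y y' : R -> C) L B s : (forall s, cder y s (y' s)) -> (- L <= s <= 0)%R ->
  (forall u, (s <= u <= 0)%R -> (Cmod (y' u) <= B)%R) -> (Cmod (y s) <= Cmod (y 0%R) + (- s) * B)%R.
Proof.
  intros Hy Hs HB. pose proof (cder_MVI y y' s 0 B ltac:(lra) (fun u _ => Hy u) HB) as H.
  replace (y s) with (y 0%R - (y 0%R - y s)) by ring.
  eapply Rle_trans; [apply Cmod_triangle|]. rewrite Cmod_opp. lra.
Qed.

(** If [Re c >= 1/2], the quantity [-s (1 - s) |y'|^2] is monotone up to the
    forcing.  The exponential weight absorbs the term in [lam]. *)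
Lemma ode_energy L c lam : (0 <= L)%R -> (1 / 2 <= Re c)%R -> exists K, (0 <= K)%R /\
  forall (y0 y1 y2 e : R -> C) (E : R),
  (forall s, cder y0 s (y1 s)) -> (forall s, cder y1 s (y2 s)) ->
  (forall s, RtoC s * (1 - RtoC s) * y2 s + c * (1 - 2 * RtoC s) * y1 s - lam * y0 s = e s) ->
  (forall s, (- L <= s <= 0)%R -> (Cmod (e s) <= E)%R) ->
  forall s, (- L <= s <= 0)%R -> (Cmod (y0 s) <= K * (Cmod (y0 0%R) + E))%R.
Proof.
  intros HL Hc. set (l := Cmod lam). assert (l0 : (0 <= l)%R) by apply Cmod_ge_0.
  set (kap := (2 * l + 1)%R). set (W := exp (kap * L)).
  assert (W0 : (0 < W)%R) by apply exp_pos.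
  exists (1 + 4 * L * (1 + l) * W)%R. split.
  { assert (0 <= 4 * L * (1 + l) * W)%R by (repeat apply Rmult_le_pos; lra). lra. }
  intros y0 y1 y2 e E D0 D1 ODE HE.
  set (d := Cmod (y0 0%R)). assert (d0 : (0 <= d)%R) by apply Cmod_ge_0.
  assert (E0 : (0 <= E)%R). { specialize (HE 0%R ltac:(lra)). pose proof (Cmod_ge_0 (e 0%R)). lra. }
  set (v := fun s => (Re (y1 s) * Re (y1 s) + Im (y1 s) * Im (y1 s))%R).
  assert (Dv : forall s, is_derive v s (2 * (Re (y1 s) * Re (y2 s) + Im (y1 s) * Im (y2 s)))%R).
  { intros s. destruct (D1 s) as [H1 H2]. unfold v. evar_last.
    - apply (is_derive_plus (V := R_NormedModule)); apply is_derive_mult_R; eassumption.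
    - unfold plus; simpl. ring. }
  assert (Vm : forall s, v s = (Cmod (y1 s) * Cmod (y1 s))%R) by (intros s; unfold v; now rewrite Cmod_sq).
  set (phi := fun s => (exp (2 * kap * s) * v s)%R).
  destruct (continuity_ab_maj phi (- L) 0) as [sm [Hmax Hsm]]; [lra| |].
  { intros s _. apply continuity_pt_filterlim. apply (ex_derive_continuous (V := R_NormedModule) phi).
    eexists. unfold phi. apply is_derive_mult_R; [|apply Dv]. auto_derive; auto. }
  set (S := sqrt (phi sm)).
  assert (phipos : forall s, (0 <= phi s)%R).
  { intros s. unfold phi. rewrite Vm. pose proof (exp_pos (2 * kap * s)). apply Rmult_le_pos; [lra|]. apply Rle_0_sqr. }
  assert (S0 : (0 <= S)%R) by apply sqrt_pos.
  assert (SS : (S * S = phi sm)%R) by (apply sqrt_sqrt; auto).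
  assert (Y1 : forall s, (- L <= s <= 0)%R -> (Cmod (y1 s) <= S * exp (- kap * s))%R).
  { intros s Hs. pose proof (exp_pos (- kap * s)).
    assert (P : (0 <= S * exp (- kap * s))%R) by (apply Rmult_le_pos; lra).
    apply Rsqr_incr_0; auto using Cmod_ge_0. unfold Rsqr. rewrite <- Vm.
    replace (S * exp (- kap * s) * (S * exp (- kap * s)))%R with (phi sm * exp (- (2 * kap * s)))%R.
    2:{ rewrite <- SS. replace (- (2 * kap * s))%R with (- kap * s + - kap * s)%R by ring. rewrite exp_plus. ring. }
    specialize (Hmax s Hs). unfold phi at 1 in Hmax. rewrite exp_Ropp. pose proof (exp_pos (2 * kap * s)).
    apply Rmult_le_reg_r with (exp (2 * kap * s)); auto. rewrite (Rmult_assoc (phi sm)), Rinv_l by lra. lra. }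
  assert (Y0 : forall s, (- L <= s <= 0)%R -> (Cmod (y0 s) <= d + (- s) * (S * exp (- kap * s)))%R).
  { intros s Hs. apply (cder_incr_bound y0 y1 L); auto. intros u Hu. eapply Rle_trans; [apply Y1; lra|].
    apply Rmult_le_compat_l; auto. apply exp_le. unfold kap. nra. }
  set (D := (E + l * d)%R). assert (HD : (0 <= D)%R) by (unfold D; nra).
  (* at the singular point the equation itself bounds [y'] *)
  assert (KEY : (S <= 4 * D)%R).
  { destruct (Req_dec sm 0) as [Z|Z].
    - assert (C0 : (1 / 2 * Cmod (y1 0%R) <= D)%R).
      { apply Rle_trans with (Cmod (c * y1 0%R)).
        - rewrite Cmod_mult. apply Rmult_le_compat_r; [apply Cmod_ge_0|]. pose proof (re_le_Cmod c). pose proof (Rle_abs (Re c)). lra.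
        - replace (c * y1 0%R) with (e 0%R + lam * y0 0%R) by (rewrite <- ODE; ring).
          eapply Rle_trans; [apply Cmod_triangle|]. rewrite Cmod_mult. unfold D. fold l d. specialize (HE 0%R ltac:(lra)). lra. }
      assert (SE : S = Cmod (y1 0%R)).
      { unfold S. rewrite Z. unfold phi. rewrite Rmult_0_r, exp_0, Rmult_1_l, Vm. apply sqrt_square, Cmod_ge_0. }
      lra.
    - (* [Bf] collects the bounds on the forcing and on the term in [lam] *)
      set (Bf := fun s => ((- s) * (2 * S * D * exp (- kap * s) + l * (S * S) / kap * exp (- (2 * kap) * s)))%R).
      set (Phi := fun s => ((- s) * (1 - s) * v s - Bf s)%R).
      set (Phi' := fun s => ((2 * s - 1) * v s + (- s) * (1 - s) * (2 * (Re (y1 s) * Re (y2 s) + Im (y1 s) * Im (y2 s)))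
         - (- (2 * S * D * exp (- kap * s) + l * (S * S) / kap * exp (- (2 * kap) * s))
            + (- s) * (- kap * (2 * S * D * exp (- kap * s)) - 2 * kap * (l * (S * S) / kap * exp (- (2 * kap) * s)))))%R).
      assert (DPhi : forall s, is_derive Phi s (Phi' s)).
      { intros s. unfold Phi, Phi'. apply (is_derive_minus (V := R_NormedModule)).
        - evar_last. apply is_derive_mult_R; [|apply Dv]. instantiate (1 := (2 * s - 1)%R). auto_derive; auto. ring. simpl. ring.
        - unfold Bf. auto_derive; auto. ring. }
      assert (POS : forall s, (sm <= s <= 0)%R -> (0 <= Phi' s)%R).
      { intros s Hs. assert (Hs' : (- L <= s <= 0)%R) by lra. unfold Phi'.
        assert (OR : ((- s) * (1 - s) * (Re (y1 s) * Re (y2 s) + Im (y1 s) * Im (y2 s)) =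
            (1 - 2 * s) * Re c * v s - (Re (y1 s) * Re (lam * y0 s + e s) + Im (y1 s) * Im (lam * y0 s + e s)))%R).
        { rewrite <- ODE. unfold v. simpl. unfold Re, Im. ring. }
        assert (CS : (Re (y1 s) * Re (lam * y0 s + e s)%C + Im (y1 s) * Im (lam * y0 s + e s)%C <= S * exp (- kap * s) * (D + l * ((- s) * (S * exp (- kap * s)))))%R).
        { eapply Rle_trans; [apply Re_conj_mult_le|]. apply Rmult_le_compat; auto using Cmod_ge_0.
          eapply Rle_trans; [apply Cmod_triangle|]. rewrite Cmod_mult. fold l. specialize (HE s Hs'). specialize (Y0 s Hs').
          assert (l * Cmod (y0 s) <= l * (d + - s * (S * exp (- kap * s))))%R by (apply Rmult_le_compat_l; auto).
          unfold D. lra. }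
        assert (V0 : (0 <= v s)%R) by (rewrite Vm; apply Rle_0_sqr).
        assert (T1 : (0 <= (1 - 2 * s) * (2 * Re c - 1) * v s)%R) by (repeat apply Rmult_le_pos; lra).
        set (x := exp (- kap * s)) in *.
        assert (X2 : exp (- (2 * kap) * s) = (x * x)%R) by (unfold x; rewrite <- exp_plus; f_equal; ring).
        rewrite X2. assert (x0 : (0 < x)%R) by apply exp_pos.
        assert (kp : (0 < kap)%R) by (unfold kap; lra).
        assert (Q1 : (0 <= (- s) * kap * (2 * S * D * x))%R) by (repeat apply Rmult_le_pos; lra).
        assert (Q2 : (0 <= l * (S * S) / kap * (x * x))%R).
        { unfold Rdiv. repeat apply Rmult_le_pos; try lra. left; apply Rinv_0_lt_compat; lra. }
        assert (Q3 : ((- s) * (2 * kap * (l * (S * S) / kap * (x * x))) = 2 * (S * x * (l * ((- s) * (S * x)))))%R) by (field; lra).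
        replace ((- s) * (1 - s) * (2 * (Re (y1 s) * Re (y2 s) + Im (y1 s) * Im (y2 s))))%R with (2 * ((- s) * (1 - s) * (Re (y1 s) * Re (y2 s) + Im (y1 s) * Im (y2 s))))%R by ring.
        rewrite OR. lra. }
      assert (LE : (Phi sm <= Phi 0)%R).
      { destruct (MVT_gen Phi sm 0 Phi') as [x [Hx HM]].
        - intros; apply DPhi.
        - intros. apply continuity_pt_filterlim. apply (ex_derive_continuous (V := R_NormedModule) Phi). eexists; apply DPhi.
        - rewrite Rmin_left, Rmax_right in Hx by lra. specialize (POS x Hx). nra. }
      unfold Phi at 2, Bf in LE. replace (- 0 * (1 - 0) * v 0%R - - 0 * _)%R with 0%R in LE by ring.
      unfold Phi, Bf in LE. set (x := exp (- kap * sm)) in *.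
      assert (X2 : exp (- (2 * kap) * sm) = (x * x)%R) by (unfold x; rewrite <- exp_plus; f_equal; ring).
      rewrite X2 in LE. assert (x1 : (1 <= x)%R). { unfold x. rewrite <- exp_0. apply exp_le. unfold kap; nra. }
      assert (SV : (S * S * (x * x) = v sm)%R).
      { rewrite SS. unfold phi. rewrite <- X2. rewrite Rmult_comm, <- Rmult_assoc, <- exp_plus.
        replace (- (2 * kap) * sm + 2 * kap * sm)%R with 0%R by ring. rewrite exp_0. ring. }
      rewrite <- SV in LE. assert (sn : (0 < - sm)%R) by lra.
      assert (L1 : ((1 - sm) * (S * S * (x * x)) <= 2 * S * D * x + l * (S * S) / kap * (x * x))%R).
      { apply Rmult_le_reg_l with (- sm)%R; auto. lra. }
      assert (L2 : (S * S * (x * x) <= 2 * S * D * (x * x) + 1 / 2 * (S * S) * (x * x))%R).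
      { assert (0 <= S * S * (x * x))%R by (apply Rmult_le_pos; nra).
        assert (2 * S * D * x <= 2 * S * D * (x * x))%R. { apply Rmult_le_compat_l; [repeat apply Rmult_le_pos; lra|nra]. }
        assert (l * (S * S) / kap * (x * x) <= 1 / 2 * (S * S) * (x * x))%R.
        { apply Rmult_le_compat_r; [nra|]. apply Rmult_le_reg_r with kap; [unfold kap; lra|].
          unfold Rdiv. rewrite (Rmult_assoc (l * (S * S))), Rinv_l, Rmult_1_r by (unfold kap; lra). unfold kap. nra. }
        nra. }
      assert (L3 : (S * S <= 2 * S * D + 1 / 2 * (S * S))%R).
      { apply Rmult_le_reg_r with (x * x)%R; [nra|]. lra. }
      destruct (Req_dec S 0) as [S1|S1]; [lra|].
      apply Rmult_le_reg_l with S; lra. }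
  intros s Hs. eapply Rle_trans; [apply Y0; auto|].
  assert (X : (exp (- kap * s) <= W)%R) by (apply exp_le; unfold kap; nra).
  assert (X0 : (0 < exp (- kap * s))%R) by apply exp_pos.
  assert (P1 : ((- s) * (S * exp (- kap * s)) <= L * (4 * D * W))%R).
  { apply Rmult_le_compat; try lra. apply Rmult_le_pos; lra. apply Rmult_le_compat; lra. }
  assert (P2 : (D <= (1 + l) * (d + E))%R) by (unfold D; nra).
  assert (P3 : (L * (4 * D * W) <= L * (4 * ((1 + l) * (d + E)) * W))%R).
  { apply Rmult_le_compat_l; auto. apply Rmult_le_compat_r; lra. }
  lra.
Qed.

(** Differentiating raises [c] by one, and the value of [y'] at the singular
    point is determined by that of [y] when [c] is not zero. *)
Lemma ode_stability L k : (0 <= L)%R -> forall c lam, (1 / 2 <= Re c + INR k)%R -> ~ nonpos_int c ->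
  exists K, (0 <= K)%R /\
  forall (y e : nat -> R -> C) (E : R),
  (forall j s, cder (y j) s (y (S j) s)) -> (forall j s, cder (e j) s (e (S j) s)) ->
  (forall s, RtoC s * (1 - RtoC s) * y 2%nat s + c * (1 - 2 * RtoC s) * y 1%nat s - lam * y O s = e O s) ->
  (forall j s, (j <= k)%nat -> (- L <= s <= 0)%R -> (Cmod (e j s) <= E)%R) ->
  forall s, (- L <= s <= 0)%R -> (Cmod (y O s) <= K * (Cmod (y O 0%R) + E))%R.
Proof.
  intros HL. induction k as [|k IH]; intros c lam Hc Hp.
  - destruct (ode_energy L c lam HL) as [K [HK H]]. { simpl in Hc. lra. }
    exists K. split; auto. intros y e E Dy De ODE HE.
    apply (H (y 0%nat) (y 1%nat) (y 2%nat) (e 0%nat) E); auto.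
  - destruct (IH (c + 1) (lam + 2 * c)) as [K [HK H]].
    { rewrite S_INR in Hc. simpl. unfold Re in *. lra. }
    { now apply nonpos_int_shift. }
    assert (c0 : c <> 0). { intros Z. apply Hp. exists 0%nat. rewrite Z. simpl. ring. }
    assert (cm : (0 < Cmod c)%R) by (now apply Cmod_gt_0).
    set (l := Cmod lam). assert (l0 : (0 <= l)%R) by apply Cmod_ge_0.
    assert (ic : (0 < / Cmod c)%R) by (now apply Rinv_0_lt_compat).
    exists (1 + L * K * ((l + 1) / Cmod c + 1))%R.
    assert (Q : (0 <= (l + 1) / Cmod c)%R) by (apply Rmult_le_pos; lra).
    split. { assert (0 <= L * K * ((l + 1) / Cmod c + 1))%R by (repeat apply Rmult_le_pos; lra). lra. }
    intros y e E Dy De ODE HE s Hs.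
    assert (E0 : (0 <= E)%R). { specialize (HE 0%nat 0%R ltac:(lia) ltac:(lra)). pose proof (Cmod_ge_0 (e 0%nat 0%R)). lra. }
    assert (ODE1 : forall s, RtoC s * (1 - RtoC s) * y 3%nat s + (c + 1) * (1 - 2 * RtoC s) * y 2%nat s - (lam + 2 * c) * y 1%nat s = e 1%nat s).
    { intros u. apply (cder_unique (e 0%nat) u); [|apply De].
      apply (cder_ext (fun s => RtoC s * (1 - RtoC s) * y 2%nat s + c * (1 - 2 * RtoC s) * y 1%nat s - lam * y 0%nat s)); [exact ODE|].
      eapply cder_eq; [|apply cder_minus; [apply cder_plus; [apply cder_mult; [apply cder_mult; [apply cder_id|apply cder_minus; [apply cder_const|apply cder_id]]|apply Dy]|
        apply cder_mult; [apply cder_scal; apply cder_minus; [apply cder_const|apply cder_scal; apply cder_id]|apply Dy]]|apply cder_scal; apply Dy]].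
      cbv beta. ring. }
    pose proof (H (fun j => y (S j)) (fun j => e (S j)) E (fun j => Dy (S j)) (fun j => De (S j)) ODE1
      (fun j u Hj Hu => HE (S j) u ltac:(lia) Hu)) as B.
    set (d := Cmod (y 0%nat 0%R)) in *. assert (d0 : (0 <= d)%R) by apply Cmod_ge_0.
    assert (Y10 : (Cmod (y 1%nat 0%R) <= (l * d + E) / Cmod c)%R).
    { apply Rmult_le_reg_r with (Cmod c); auto. unfold Rdiv. rewrite (Rmult_assoc (l * d + E)), Rinv_l, Rmult_1_r by lra.
      rewrite <- Cmod_mult. replace (y 1%nat 0%R * c) with (e 0%nat 0%R + lam * y 0%nat 0%R) by (rewrite <- ODE; ring).
      eapply Rle_trans; [apply Cmod_triangle|]. rewrite Cmod_mult. fold l d. specialize (HE 0%nat 0%R ltac:(lia) ltac:(lra)). lra. }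
    assert (Y1 : forall u, (- L <= u <= 0)%R -> (Cmod (y 1%nat u) <= K * ((l * d + E) / Cmod c + E))%R).
    { intros u Hu. eapply Rle_trans; [apply B; auto|]. apply Rmult_le_compat_l; auto. lra. }
    eapply Rle_trans; [apply (cder_incr_bound (y 0%nat) (y 1%nat) L (K * ((l * d + E) / Cmod c + E)) s); auto|].
    { intros u Hu. apply Y1. lra. }
    fold d.
    assert (Z1 : ((l * d + E) / Cmod c <= (l + 1) / Cmod c * (d + E))%R).
    { unfold Rdiv. rewrite (Rmult_comm (l + 1)), Rmult_assoc, Rmult_comm. apply Rmult_le_compat_l; [lra|nra]. }
    assert (Z2 : (0 <= (l * d + E) / Cmod c + E)%R). { assert (0 <= (l * d + E) / Cmod c)%R by (apply Rmult_le_pos; [nra|lra]). lra. }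
    assert (Z3 : (- s * (K * ((l * d + E) / Cmod c + E)) <= L * (K * (((l + 1) / Cmod c + 1) * (d + E))))%R).
    { apply Rmult_le_compat; try lra. apply Rmult_le_pos; auto. apply Rmult_le_compat_l; auto. lra. }
    lra.
Qed.

(** * The product formula for two hypergeometric functions *)

(** Differentiation lowers the degree; with zero as the value in negative degrees
    the relations below are uniform in [N]. *)
Definition jacp (h k : nat -> C) (N : nat) (p r : C) : C :=
  match N with O => 0 | S M => jac h k M p r end.
Definition jacpp (h k : nat -> C) (N : nat) (p r : C) : C :=
  match N with O => 0 | S M => jacp h k M p r end.

Lemma jacp_p h k N p r : p * jacp (hshift h) k N p r = wjac (fun x _ => x) h k N p r.
Proof.
  unfold wjac. rewrite csum_S0. replace (RtoC (INR 0) * _) with (RtoC 0) by (simpl INR; ring). rewrite Cplus_0_l.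
  destruct N as [|N]; simpl jacp. simpl. ring.
  unfold jac. rewrite <- csum_scal. apply csum_ext. intros i Hi. unfold hshift. replace (S N - S i)%nat with (N - i)%nat by lia.
  rewrite RtoC_S, Cpow_S. ring.
Qed.

Lemma jacp_r h k N p r : r * jacp h (hshift k) N p r = wjac (fun _ y => y) h k N p r.
Proof.
  unfold wjac. change (csum ?f (S N)) with (csum f N + f N). cbv beta. rewrite Nat.sub_diag.
  replace (RtoC (INR 0) * _) with (RtoC 0) by (simpl INR; ring). rewrite Cplus_0_r.
  destruct N as [|N]; simpl jacp. simpl. ring.
  unfold jac. rewrite <- csum_scal. apply csum_ext. intros i Hi. unfold hshift.
  replace (S N - i)%nat with (S (N - i)) by lia. rewrite RtoC_S, Cpow_S. ring.
Qed.

Lemma jac_euler h k N p r : p * jacp (hshift h) k N p r + r * jacp h (hshift k) N p r = INR N * jac h k N p r.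
Proof.
  rewrite jacp_p, jacp_r, jac_wjac, wjac_plus, wjac_scal. apply wjac_ext. intros x y ->. ring.
Qed.

Lemma jac_contig_p c h k N p r : hseq c h ->
  p * jacpp (hshift (hshift h)) k N p r + c * jacp (hshift h) k N p r = jacp h k N p r.
Proof.
  intros H. destruct N as [|N]; simpl; [ring|]. rewrite jacp_p. unfold jac, wjac.
  rewrite <- csum_scal, <- csum_plus. apply csum_ext. intros i Hi. unfold hshift. rewrite <- (H i). ring.
Qed.

Lemma jac_contig_r d h k N p r : hseq d k ->
  r * jacpp h (hshift (hshift k)) N p r + d * jacp h (hshift k) N p r = jacp h k N p r.
Proof.
  intros H. destruct N as [|N]; simpl; [ring|]. rewrite jacp_r. unfold jac, wjac.
  rewrite <- csum_scal, <- csum_plus. apply csum_ext. intros i Hi. unfold hshift. rewrite <- (H (N - i)%nat). ring.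
Qed.

Lemma jac_euler_p h k N p r :
  p * jacpp (hshift (hshift h)) k N p r + r * jacpp (hshift h) (hshift k) N p r = (INR N - 1) * jacp (hshift h) k N p r.
Proof.
  destruct N as [|N]; simpl jacpp. simpl. ring. rewrite jac_euler, RtoC_S. simpl jacp. ring.
Qed.

Lemma jac_euler_r h k N p r :
  p * jacpp (hshift h) (hshift k) N p r + r * jacpp h (hshift (hshift k)) N p r = (INR N - 1) * jacp h (hshift k) N p r.
Proof.
  destruct N as [|N]; simpl jacpp. simpl. ring. rewrite jac_euler, RtoC_S. simpl jacp. ring.
Qed.

Lemma cder_jac (P Q : R -> C) dP dQ h k N s : cder P s dP -> cder Q s dQ ->
  cder (fun s => jac h k N (P s) (Q s)) s (dP * jacp (hshift h) k N (P s) (Q s) + dQ * jacp h (hshift k) N (P s) (Q s)).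
Proof.
  intros HP HQ.
  assert (DP : forall (F : R -> C) dF i, cder F s dF -> cder (fun s => F s ^ i) s (INR i * dF * F s ^ pred i)).
  { intros F dF i HF. induction i as [|i IH].
    - eapply cder_eq; [|apply (cder_const 1)]. simpl. ring.
    - eapply cder_eq; [|apply (cder_mult F (fun s => F s ^ i)); [exact HF|exact IH]].
      cbv beta. rewrite RtoC_S. destruct i as [|i]; simpl pred; rewrite ?Cpow_S; [simpl; ring|ring]. }
  eapply cder_eq; [|apply (cder_csum (fun i s => h i * k (N - i)%nat * P s ^ i * Q s ^ (N - i))
    (fun i => dP * (INR i * (h i * k (N - i)%nat * P s ^ pred i * Q s ^ (N - i))) + dQ * (INR (N - i) * (h i * k (N - i)%nat * P s ^ i * Q s ^ pred (N - i)))))].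
  2:{ intros i Hi. eapply cder_eq; [|apply cder_mult; [apply cder_scal; apply DP; exact HP|apply DP; exact HQ]]. cbv beta. ring. }
  rewrite csum_plus, !csum_scal. f_equal; f_equal.
  - rewrite csum_S0. replace (RtoC (INR 0) * _) with (RtoC 0) by (simpl INR; ring). rewrite Cplus_0_l.
    destruct N as [|N]; simpl jacp; [reflexivity|]. unfold jac. apply csum_ext. intros i Hi. unfold hshift.
    replace (S N - S i)%nat with (N - i)%nat by lia. rewrite RtoC_S. simpl pred. ring.
  - change (csum ?f (S N)) with (csum f N + f N). cbv beta. rewrite Nat.sub_diag.
    replace (RtoC (INR 0) * _) with (RtoC 0) by (simpl INR; ring). rewrite Cplus_0_r.
    destruct N as [|N]; simpl jacp; [reflexivity|]. unfold jac. apply csum_ext. intros i Hi. unfold hshift.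
    replace (S N - i)%nat with (S (N - i)) by lia. rewrite RtoC_S. simpl pred. ring.
Qed.

(** The [j]-th derivative in [s] of [jac] along [p = s (1 - t)], [r = t (1 - s)]. *)
Fixpoint jder (t : R) (j : nat) (h k : nat -> C) (N : nat) (s : R) : C :=
  match j with
  | O => jac h k N (RtoC s * (1 - RtoC t)) (RtoC t * (1 - RtoC s))
  | S j => match N with
           | O => 0
           | S N => (1 - RtoC t) * jder t j (hshift h) k N s - RtoC t * jder t j h (hshift k) N s
           end
  end.

Lemma cder_jder t j : forall h k N s, cder (jder t j h k N) s (jder t (S j) h k N s).
Proof.
  induction j as [|j IH]; intros h k N s.
  - eapply cder_eq; [|apply (cder_jac (fun s => RtoC s * (1 - RtoC t)) (fun s => RtoC t * (1 - RtoC s)) (1 - RtoC t) (- RtoC t))].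
    + destruct N as [|N]; simpl; ring.
    + eapply cder_eq; [|apply cder_mult; [apply cder_id|apply cder_const]]. cbv beta. ring.
    + eapply cder_eq; [|apply cder_scal; apply cder_minus; [apply cder_const|apply cder_id]]. ring.
  - destruct N as [|N]. apply (cder_const 0).
    apply (cder_minus (fun s => (1 - RtoC t) * jder t j (hshift h) k N s) (fun s => RtoC t * jder t j h (hshift k) N s)
      s ((1 - RtoC t) * jder t (S j) (hshift h) k N s) (RtoC t * jder t (S j) h (hshift k) N s)); apply cder_scal; apply IH.
Qed.

Lemma jder_1 t h k N s : let p := RtoC s * (1 - RtoC t) in let r := RtoC t * (1 - RtoC s) in
  jder t 1 h k N s = (1 - RtoC t) * jacp (hshift h) k N p r - RtoC t * jacp h (hshift k) N p r.
Proof. destruct N; simpl; ring. Qed.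

Lemma jder_2 t h k N s : let p := RtoC s * (1 - RtoC t) in let r := RtoC t * (1 - RtoC s) in
  jder t 2 h k N s = (1 - RtoC t) * (1 - RtoC t) * jacpp (hshift (hshift h)) k N p r
    - 2 * (RtoC t * (1 - RtoC t)) * jacpp (hshift h) (hshift k) N p r + RtoC t * RtoC t * jacpp h (hshift (hshift k)) N p r.
Proof. destruct N as [|[|N]]; simpl; ring. Qed.

(** The hypergeometric operator acts on these polynomials as a two-term
    operator in the degree; this is where [a + b + 1 = 2c] is used. *)
Lemma jder_ode c t h N s : hseq c h ->
  let p := RtoC s * (1 - RtoC t) in let r := RtoC t * (1 - RtoC s) in
  RtoC s * (1 - RtoC s) * jder t 2 h h N s + c * (1 - 2 * RtoC s) * jder t 1 h h N s
  = jacp h h N p r - INR N * (INR N + 2 * c - 1) * jac h h N p r.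
Proof.
  intros H p r. rewrite jder_1, jder_2. fold p r.
  pose proof (jac_contig_p c h h N p r H) as RA. pose proof (jac_contig_r c h h N p r H) as RC.
  pose proof (jac_euler h h N p r) as R0. pose proof (jac_euler_p h h N p r) as RP. pose proof (jac_euler_r h h N p r) as RQ.
  set (A := jacpp (hshift (hshift h)) h N p r) in *. set (B := jacpp (hshift h) (hshift h) N p r) in *.
  set (D := jacpp h (hshift (hshift h)) N p r) in *. set (P := jacp (hshift h) h N p r) in *.
  set (Q := jacp h (hshift h) N p r) in *. set (H1 := jacp h h N p r) in *. set (H0 := jac h h N p r) in *.
  assert (PA : p * A = H1 - c * P) by (rewrite <- RA; ring).
  assert (RD : r * D = H1 - c * Q) by (rewrite <- RC; ring).
  assert (B1 : p * (r * B) = (INR N - 1) * (p * P) - p * (H1 - c * P)).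
  { rewrite <- PA. replace (r * B) with ((INR N - 1) * P - p * A) by (rewrite <- RP; ring). ring. }
  assert (B2 : p * (r * B) = (INR N - 1) * (r * Q) - r * (H1 - c * Q)).
  { rewrite <- RD. replace (p * (r * B)) with (r * (p * B)) by ring.
    replace (p * B) with ((INR N - 1) * Q - r * D) by (rewrite <- RQ; ring). ring. }
  transitivity ((1 - RtoC s) * (1 - RtoC t) * (p * A) + RtoC s * RtoC t * (r * D) - (p * (r * B) + p * (r * B))
    + c * (1 - 2 * RtoC s) * ((1 - RtoC t) * P - RtoC t * Q)).
  { unfold p, r. ring. }
  rewrite B1 at 1. rewrite B2, PA, RD.
  transitivity (H1 - (INR N + 2 * c - 1) * (INR N * H0)); [|ring]. rewrite <- R0. unfold p, r. ring.
Qed.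

Lemma sq_geom q : (1 < q)%R -> exists K, (0 <= K)%R /\ forall N, ((INR N + 1) ^ 2 <= K * q ^ N)%R.
Proof.
  intros Hq. destruct (exists_sqrt q ltac:(auto)) as [r [Hr Hr2]].
  destruct (ratio_eventually 2 (-1) r Hr) as [n0 H]. apply geom_of_ratio with n0; [lra|].
  intros n Hn. destruct (H n Hn) as [H1 H2]. rewrite S_INR, <- Hr2.
  replace (r * r * (INR n + 1) ^ 2)%R with ((r * (INR n - -1)) ^ 2)%R by ring.
  apply pow_incr. pose proof (pos_INR n). lra.
Qed.

(** The derivatives are polynomials of the same kind in one degree less; the
    factor [N^2] lost each time is absorbed by the room left in [q]. *)
Lemma jder_bound j : forall c d h k q t L, hseq c h -> hseq d k -> (1 < q)%R -> (0 <= t <= 1)%R -> (0 < t + L)%R ->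
  exists A, (0 <= A)%R /\ forall N s, (- L <= s <= 0)%R ->
   (INR (fact N) ^ 2 * Cmod (jder t j h k N s) <= A * (q * (t + L)) ^ N)%R.
Proof.
  induction j as [|j IH]; intros c d h k q t L Hh Hk Hq Ht HL.
  - destruct (jac_bound c d h k q Hh Hk Hq) as [A [HA H]]. exists A. split; auto.
    intros N s Hs. simpl.
    replace (RtoC s * (1 - RtoC t)) with (RtoC (s * (1 - t))) by (rewrite RtoC_mult, RtoC_minus; ring).
    replace (RtoC t * (1 - RtoC s)) with (RtoC (t * (1 - s))) by (rewrite RtoC_mult, RtoC_minus; ring).
    apply (H N (s * (1 - t))%R (t * (1 - s))%R (t + L)%R); auto; try nra.
  - destruct (exists_sqrt q ltac:(auto)) as [r [Hr Hr2]].
    destruct (IH (c + 1) d (hshift h) k r t L) as [A1 [HA1 H1]]; auto using hseq_shift.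
    destruct (IH c (d + 1) h (hshift k) r t L) as [A2 [HA2 H2]]; auto using hseq_shift.
    destruct (sq_geom r Hr) as [K [HK HS]].
    assert (qp : (0 < q * (t + L))%R) by (apply Rmult_lt_0_compat; lra).
    exists (K * (A1 + A2) / (q * (t + L)))%R. split. { apply Rmult_le_pos; [nra|]. left. now apply Rinv_0_lt_compat. }
    intros N s Hs. destruct N as [|N].
    + simpl. rewrite Cmod_0. assert (0 <= K * (A1 + A2) / (q * (t + L)))%R. { apply Rmult_le_pos; [nra|]. left. now apply Rinv_0_lt_compat. } lra.
    + specialize (H1 N s Hs). specialize (H2 N s Hs). specialize (HS N).
      set (x := Cmod (jder t j (hshift h) k N s)) in *. set (y := Cmod (jder t j h (hshift k) N s)) in *.
      set (g := ((r * (t + L)) ^ N)%R) in *.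
      assert (B : (Cmod (jder t (S j) h k (S N) s) <= x + y)%R).
      { simpl. eapply Rle_trans; [apply Cmod_triangle|]. rewrite Cmod_opp, !Cmod_mult.
        replace (1 - RtoC t) with (RtoC (1 - t)) by (rewrite RtoC_minus; ring). rewrite !Cmod_RtoC_pos by lra. fold x y.
        assert (0 <= x)%R by apply Cmod_ge_0. assert (0 <= y)%R by apply Cmod_ge_0. nra. }
      rewrite fact_simpl, mult_INR, S_INR, Rpow_mult_distr.
      replace (K * (A1 + A2) / (q * (t + L)) * (q * (t + L)) ^ S N)%R with ((K * r ^ N) * ((A1 + A2) * g))%R.
      2:{ unfold g. simpl. rewrite !Rpow_mult_distr, <- Hr2, Rpow_mult_distr. field. split; nra. }
      rewrite Rmult_assoc. apply Rmult_le_compat; auto.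
      * apply pow2_ge_0.
      * apply Rmult_le_pos; [apply pow2_ge_0|apply Cmod_ge_0].
      * pose proof (pow2_ge_0 (INR (fact N))). apply Rle_trans with (INR (fact N) ^ 2 * (x + y))%R; [nra|]. lra.
Qed.

(** In this section, [h] is the sequence [1 / ((c)_i i!)] and [f] in
    [bailey_limit] is the hypergeometric series in [a, b; c]. *)
Section Bailey.
Variables (a b c : C) (h : nat -> C).
Hypothesis Hab : a + b = 2 * c - 1.
Hypothesis Hc : ~ nonpos_int c.
Hypothesis Hh : hseq c h.
Hypothesis Hh0 : h O = 1.

Definition bcoef (N : nat) : C := poch a N * poch b N.

Lemma bcoef_S N : bcoef (S N) = (INR N * (INR N + 2 * c - 1) + a * b) * bcoef N.
Proof. unfold bcoef. rewrite !poch_S. replace (2 * c) with (a + b + 1) by (rewrite Hab; ring). ring. Qed.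

Lemma bcoef_bound q : (1 < q)%R -> exists K, (0 <= K)%R /\ forall N, (Cmod (bcoef N) <= K * q ^ N * INR (fact N) ^ 2)%R.
Proof.
  intros Hq. destruct (exists_sqrt q ltac:(auto)) as [r [Hr Hr2]].
  destruct (binc_bound a r Hr) as [K1 [HK1 H1]]. destruct (binc_bound b r Hr) as [K2 [HK2 H2]].
  exists (K1 * K2)%R. split; [nra|]. intros N.
  replace (bcoef N) with (binc a N * binc b N * RtoC (INR (fact N) ^ 2)).
  2:{ unfold binc, bcoef. rewrite RtoC_pow. pose proof (fact_neq N). field. auto. }
  rewrite !Cmod_mult, (Cmod_RtoC_pos (_ ^ 2)) by apply pow2_ge_0.
  apply Rmult_le_compat_r; [apply pow2_ge_0|]. rewrite <- Hr2, Rpow_mult_distr.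
  replace (K1 * K2 * (r ^ N * r ^ N))%R with ((K1 * r ^ N) * (K2 * r ^ N))%R by ring.
  apply Rmult_le_compat; auto using Cmod_ge_0.
Qed.

Definition bsum (t : R) (j M : nat) (s : R) : C := csum (fun N => bcoef N * jder t j h h N s) (S M).

Lemma cder_bsum t j M s : cder (bsum t j M) s (bsum t (S j) M s).
Proof.
  apply (cder_csum (fun N s => bcoef N * jder t j h h N s)). intros i Hi. apply cder_scal, cder_jder.
Qed.

(** The two-term action in the degree telescopes against [bcoef_S]. *)
Lemma bsum_ode t M s :
  RtoC s * (1 - RtoC s) * bsum t 2 M s + c * (1 - 2 * RtoC s) * bsum t 1 M s - a * b * bsum t 0 M s
  = - bcoef (S M) * jder t 0 h h M s.
Proof.
  assert (OD := fun N => jder_ode c t h N s Hh). cbv zeta in OD. unfold bsum. induction M as [|M IH].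
  - specialize (OD 0%nat). change (csum ?f 1) with (0 + f 0%nat). cbv beta.
    transitivity (bcoef 0 * (RtoC s * (1 - RtoC s) * jder t 2 h h 0 s + c * (1 - 2 * RtoC s) * jder t 1 h h 0 s) - a * b * bcoef 0 * jder t 0 h h 0 s); [ring|].
    rewrite OD, bcoef_S. simpl (INR 0). cbn [jacp jder]. ring.
  - specialize (OD (S M)). change (csum ?f (S (S M))) with (csum f (S M) + f (S M)). cbv beta.
    transitivity ((RtoC s * (1 - RtoC s) * csum (fun N => bcoef N * jder t 2 h h N s) (S M) + c * (1 - 2 * RtoC s) * csum (fun N => bcoef N * jder t 1 h h N s) (S M) - a * b * csum (fun N => bcoef N * jder t 0 h h N s) (S M))
      + bcoef (S M) * (RtoC s * (1 - RtoC s) * jder t 2 h h (S M) s + c * (1 - 2 * RtoC s) * jder t 1 h h (S M) s) - a * b * bcoef (S M) * jder t 0 h h (S M) s); [ring|].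
    rewrite IH, OD, (bcoef_S (S M)). cbn [jacp jder]. ring.
Qed.

Lemma jac_00 N : jac h h (S N) 0 0 = 0.
Proof.
  unfold jac. apply csum_zero. intros i Hi. destruct i as [|i].
  - rewrite Nat.sub_0_r, (Cpow_S 0 N). ring.
  - rewrite (Cpow_S 0 i). ring.
Qed.

Lemma jac_p0 N (r : C) : jac h h N 0 r = h N * r ^ N.
Proof.
  unfold jac. rewrite csum_S0, Nat.sub_0_r. rewrite (csum_zero (fun i => _)).
  - rewrite Hh0. simpl. ring.
  - intros i Hi. rewrite (Cpow_S 0 i). ring.
Qed.

Lemma jac_r0 N (p : C) : jac h h N p 0 = h N * p ^ N.
Proof.
  unfold jac. change (csum ?f (S N)) with (csum f N + f N). cbv beta. rewrite (csum_zero (fun i => _)).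
  - rewrite Nat.sub_diag, Hh0. simpl. ring.
  - intros i Hi. replace (N - i)%nat with (S (N - S i)) by lia. rewrite (Cpow_S 0). ring.
Qed.

Lemma bsum_bound t L j q : (0 <= t <= 1)%R -> (0 < t + L)%R -> (1 < q)%R -> exists K, (0 <= K)%R /\
  forall N s, (- L <= s <= 0)%R -> (Cmod (bcoef N * jder t j h h N s) <= K * (q * (t + L)) ^ N)%R /\
    (Cmod (bcoef (S N) * jder t j h h N s) <= K * (q * (t + L)) ^ N)%R.
Proof.
  intros Ht HL Hq. destruct (exists_sqrt q Hq) as [r' [Hr' Hrr]]. destruct (exists_sqrt r' Hr') as [r [Hr Hr2]].
  destruct (bcoef_bound r Hr) as [K1 [HK1 H1]]. destruct (jder_bound j c c h h r t L Hh Hh Hr Ht HL) as [A [HA H2]].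
  destruct (sq_geom r Hr) as [K3 [HK3 H3]].
  exists (K1 * A + K1 * r * K3 * A)%R. assert (P1 : (0 <= K1 * A)%R) by nra. assert (P2 : (0 <= K1 * r * K3 * A)%R) by (repeat apply Rmult_le_pos; lra).
  split; [lra|]. intros N s Hs. specialize (H2 N s Hs).
  assert (fp : (0 < INR (fact N) ^ 2)%R) by (apply pow_lt, INR_fact_lt_0).
  assert (rN : (1 <= r ^ N)%R) by (apply pow_R1_Rle; lra).
  assert (GN : (0 <= (t + L) ^ N)%R) by (apply pow_le; lra).
  assert (EQ : ((q * (t + L)) ^ N = r ^ N * r ^ N * r ^ N * r ^ N * (t + L) ^ N)%R).
  { rewrite <- Hrr, <- Hr2, !Rpow_mult_distr. ring. }
  rewrite EQ. rewrite Rpow_mult_distr in H2. set (g := ((t + L) ^ N)%R) in *. set (x := (r ^ N)%R) in *.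
  rewrite !Cmod_mult. set (y := Cmod (jder t j h h N s)) in *. assert (y0 : (0 <= y)%R) by apply Cmod_ge_0.
  assert (C1 : (K1 * x * (INR (fact N) ^ 2 * y) <= K1 * x * (A * (x * g)))%R) by (apply Rmult_le_compat_l; auto; nra).
  assert (xg : (0 <= x * x * g)%R) by (repeat apply Rmult_le_pos; lra).
  assert (xx : (1 <= x * x)%R) by nra.
  assert (M1 : (x * x * g <= x * x * x * x * g)%R) by nra.
  split.
  - specialize (H1 N). fold x in H1.
    apply Rle_trans with (K1 * x * INR (fact N) ^ 2 * y)%R; [apply Rmult_le_compat_r; auto|].
    apply Rle_trans with (K1 * A * (x * x * g))%R; [lra|].
    apply Rle_trans with (K1 * A * (x * x * x * x * g))%R; [apply Rmult_le_compat_l; auto|].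
    assert (0 <= x * x * x * x * g)%R by lra. nra.
  - specialize (H1 (S N)). rewrite fact_simpl, mult_INR, Rpow_mult_distr, S_INR in H1. simpl (r ^ S N)%R in H1. fold x in H1.
    apply Rle_trans with (K1 * (r * x) * ((INR N + 1) ^ 2 * INR (fact N) ^ 2) * y)%R; [apply Rmult_le_compat_r; auto|].
    specialize (H3 N). fold x in H3.
    apply Rle_trans with (r * (INR N + 1) ^ 2 * (K1 * x * (A * (x * g))))%R.
    { replace (K1 * (r * x) * ((INR N + 1) ^ 2 * INR (fact N) ^ 2) * y)%R with (r * (INR N + 1) ^ 2 * (K1 * x * (INR (fact N) ^ 2 * y)))%R by ring.
      apply Rmult_le_compat_l; auto. apply Rmult_le_pos; [lra|apply pow2_ge_0]. }
    assert (Z : (0 <= K1 * x * (A * (x * g)))%R). { replace (K1 * x * (A * (x * g)))%R with (K1 * A * (x * x * g))%R by ring. nra. }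
    apply Rle_trans with (r * (K3 * x) * (K1 * x * (A * (x * g))))%R.
    { apply Rmult_le_compat_r; auto. apply Rmult_le_compat_l; lra. }
    apply Rle_trans with (K1 * r * K3 * A * (x * x * x * x * g))%R.
    + replace (r * (K3 * x) * (K1 * x * (A * (x * g))))%R with (K1 * r * K3 * A * (x * (x * x * g)))%R by ring.
      apply Rmult_le_compat_l; auto. nra.
    + assert (0 <= x * x * x * x * g)%R by lra. nra.
Qed.

(** Both sides solve the same equation in [s] up to a vanishing forcing, and
    agree at the singular point [s = 0]. *)
Lemma bailey_limit t s f : (0 <= t <= 1)%R -> (s <= 0)%R -> (0 < t - s < 1)%R ->
  (forall u : R, (Rabs u < 1)%R -> cseries (fun N => bcoef N * (h N * RtoC u ^ N)) (f u)) ->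
  cvg (fun M => bsum t 0 M s) (f s * f t).
Proof.
  intros Ht Hs Hts Hf. set (L := (- s)%R).
  destruct (exists_ratio (t + L)%R ltac:(unfold L; lra)) as [q [Hq Hqr]].
  assert (Lt : (0 < t + L < 1)%R) by (unfold L; lra).
  assert (EX : exists k, (1 / 2 <= Re c + INR k)%R).
  { destruct (ratio_eventually 0 (- Re c) 2 ltac:(lra)) as [k Hk]. exists k. destruct (Hk k (le_n _)). lra. }
  destruct EX as [k Hk].
  destruct (ode_stability L k ltac:(unfold L; lra) c (a * b) Hk Hc) as [K [HK ST]].
  assert (F0 : cvg (fun M => bsum 0 0 M s) (f s)).
  { pose proof (Hf s) as X. apply (cvg_shift _ _ 1) in X; [|rewrite Rabs_left1; lra]. eapply cvg_ext; [|exact X].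
    intros M. cbv beta. rewrite Nat.add_1_r. unfold bsum. apply csum_ext. intros N _. simpl jder.
    replace (RtoC 0 * (1 - RtoC s)) with (RtoC 0) by ring. rewrite jac_r0. do 3 f_equal. ring. }
  assert (FT : cvg (fun M => bsum t 0 M 0) (f t)).
  { pose proof (Hf t) as X. apply (cvg_shift _ _ 1) in X; [|rewrite Rabs_pos_eq; lra]. eapply cvg_ext; [|exact X].
    intros M. cbv beta. rewrite Nat.add_1_r. unfold bsum. apply csum_ext. intros N _. simpl jder.
    replace (RtoC 0 * (1 - RtoC t)) with (RtoC 0) by ring. rewrite jac_p0. do 3 f_equal. ring. }
  destruct (cvg_bounded _ _ FT) as [Th [HTh BT]].
  destruct (Req_dec s 0) as [Z|Z].
  { rewrite Z. replace (f 0%R) with (RtoC 1). replace (1 * f t) with (f t) by ring. exact FT.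
    apply (cseries_unique (fun N => bcoef N * (h N * RtoC 0 ^ N))); [|apply Hf; rewrite Rabs_R0; lra].
    replace (RtoC 1) with (csum (fun N => bcoef N * (h N * RtoC 0 ^ N)) 1).
    - apply cseries_finite. intros [|n] Hn; [lia|]. rewrite (Cpow_S 0 n). ring.
    - simpl. rewrite Hh0. unfold bcoef. simpl. ring. }
  assert (L0 : (0 < 0 + L < 1)%R) by (unfold L; lra).
  assert (AB : exists A, (0 <= A)%R /\ forall j u M, (j <= k)%nat -> (- L <= u <= 0)%R ->
     (Cmod (- bcoef (S M) * jder t j h h M u - bsum t 0 M 0 * (- bcoef (S M) * jder 0 j h h M u)) <= A * (q * (t + L)) ^ M)%R).
  { assert (ONE : forall j, exists A, (0 <= A)%R /\ forall u M, (- L <= u <= 0)%R ->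
       (Cmod (- bcoef (S M) * jder t j h h M u - bsum t 0 M 0 * (- bcoef (S M) * jder 0 j h h M u)) <= A * (q * (t + L)) ^ M)%R).
    { intros j. destruct (bsum_bound t L j q Ht (proj1 Lt) Hq) as [A1 [HA1 H1]].
      destruct (bsum_bound 0 L j q ltac:(lra) (proj1 L0) Hq) as [A2 [HA2 H2]].
      exists (A1 + Th * A2)%R. split; [nra|]. intros u M Hu.
      destruct (H1 M u Hu) as [_ X1]. destruct (H2 M u Hu) as [_ X2].
      eapply Rle_trans; [apply Cmod_triangle|]. rewrite Cmod_opp.
      replace (- bcoef (S M) * jder t j h h M u) with (- (bcoef (S M) * jder t j h h M u)) by ring.
      replace (- bcoef (S M) * jder 0 j h h M u) with (- (bcoef (S M) * jder 0 j h h M u)) by ring.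
      rewrite (Cmod_mult (bsum _ _ _ _)), !Cmod_opp. rewrite Rmult_plus_distr_r. apply Rplus_le_compat; auto. rewrite Rmult_assoc.
      apply Rmult_le_compat; auto using Cmod_ge_0. eapply Rle_trans; [exact X2|]. apply Rmult_le_compat_l; auto. apply pow_incr. nra. }
    assert (PW : forall M, (0 <= (q * (t + L)) ^ M)%R) by (intros; apply pow_le; nra).
    clear ST Hk. induction k as [|k [A [HA IH]]].
    - destruct (ONE 0%nat) as [A [HA H]]. exists A. split; auto. intros j u M Hj. replace j with 0%nat by lia. auto.
    - destruct (ONE (S k)) as [A' [HA' H]]. exists (A + A')%R. split; [lra|]. intros j u M Hj Hu. specialize (PW M).
      destruct (Nat.eq_dec j (S k)) as [->|Nj]; [specialize (H u M Hu)|specialize (IH j u M ltac:(lia) Hu)]; nra. }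
  destruct AB as [A [HA AB]].
  assert (EST : forall M, (Cmod (bsum t 0 M s - bsum t 0 M 0 * bsum 0 0 M s - 0) <= K * (0 + A * (q * (t + L)) ^ M))%R).
  { intros M. set (th := bsum t 0 M 0).
    pose proof (ST (fun j u => bsum t j M u - th * bsum 0 j M u) (fun j u => - bcoef (S M) * jder t j h h M u - th * (- bcoef (S M) * jder 0 j h h M u)) (A * (q * (t + L)) ^ M)%R) as X.
    replace (bsum t 0 M s - th * bsum 0 0 M s - 0) with (bsum t 0 M s - th * bsum 0 0 M s) by ring.
    eapply Rle_trans; [apply X; [| | | |unfold L; lra]|].
    - intros j u. apply cder_minus; [apply cder_bsum|apply cder_scal, cder_bsum].
    - intros j u. apply cder_minus; [apply cder_scal, cder_jder|apply cder_scal, cder_scal, cder_jder].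
    - intros u. cbv beta. rewrite <- !bsum_ode. ring.
    - intros j u Hj Hu. apply AB; auto.
    - apply Rmult_le_compat_l; auto. apply Rplus_le_compat_r. right.
      replace (bsum 0 0 M 0) with (RtoC 1). { unfold th. replace (bsum t 0 M 0 - bsum t 0 M 0 * 1) with (RtoC 0) by ring. apply Cmod_0. }
      unfold bsum. rewrite csum_S0. rewrite (csum_zero (fun i => _)).
      + simpl jder. unfold jac. simpl. rewrite Hh0. unfold bcoef. simpl. ring.
      + intros i Hi. simpl jder. replace (RtoC 0 * (1 - RtoC 0)) with (RtoC 0) by ring. rewrite jac_00. ring. }
  assert (C1 : cvg (fun M => bsum t 0 M s - bsum t 0 M 0 * bsum 0 0 M s) 0).
  { eapply cvg_dom; [exact EST|].
    assert (LZ : is_lim_seq (fun M => K * (0 + A * (q * (t + L)) ^ M))%R (K * (0 + A * 0))%R).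
    2:{ replace (K * (0 + A * 0))%R with 0%R in LZ by ring. exact LZ. }
    apply is_lim_seq_mult'; [apply is_lim_seq_const|]. apply is_lim_seq_plus'; [apply is_lim_seq_const|].
    apply is_lim_seq_mult'; [apply is_lim_seq_const|]. apply is_lim_seq_geom. rewrite Rabs_pos_eq; [auto|apply Rmult_le_pos; lra]. }
  pose proof (cvg_plus _ _ _ _ C1 (cvg_mult _ _ _ _ FT F0)) as C2.
  replace (0 + f t * f s) with (f s * f t) in C2 by ring.
  eapply cvg_ext; [|exact C2]. intros M. cbv beta. ring.
Qed.
End Bailey.

Definition hnorm (c : C) (i : nat) : C := / (poch c i * INR (fact i)).

Lemma hseq_hnorm c : ~ nonpos_int c -> hseq c (hnorm c).
Proof.
  intros Hc i. unfold hnorm. rewrite fact_simpl, mult_INR, RtoC_mult, RtoC_S, poch_S.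
  pose proof (poch_nonpole c i Hc). pose proof (fact_neq i). pose proof (INR_S_neq i). pose proof (nonpos_int_neq c i Hc).
  field. auto.
Qed.

Lemma bailey a b c (s t : R) : a + b = 2 * c - 1 -> ~ nonpos_int c ->
  (0 <= t <= 1)%R -> (s <= 0)%R -> (0 < t - s < 1)%R ->
  cseries (fun N => poch a N * poch b N * jac (hnorm c) (hnorm c) N (RtoC (s * (1 - t))) (RtoC (t * (1 - s))))
    (hreg a b c s * hreg a b c t / (rgamma c * rgamma c)).
Proof.
  intros Hab Hc Ht Hs Hts. pose proof (rgamma_neq_0 c Hc) as NZ.
  pose proof (bailey_limit a b c (hnorm c) Hab Hc (hseq_hnorm c Hc)) as X.
  assert (h0 : hnorm c 0 = 1) by (unfold hnorm; simpl; field).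
  specialize (X h0 t s (fun u => hreg a b c (RtoC u) / rgamma c) Ht Hs Hts).
  assert (F : forall u : R, (Rabs u < 1)%R -> cseries (fun N => bcoef a b N * (hnorm c N * RtoC u ^ N)) (hreg a b c u / rgamma c)).
  { intros u Hu. pose proof (hreg_series a b c u ltac:(rewrite Cmod_R; auto)) as H.
    apply (cseries_scal (/ rgamma c)) in H. unfold Cdiv. rewrite Cmult_comm. eapply cseries_ext; [|exact H].
    intros k. unfold hcoef, bcoef, hnorm. rewrite (rgamma_poch c k) in *. pose proof (poch_nonpole c k Hc). pose proof (fact_neq k).
    assert (rgamma (c + INR k) <> 0) by (intros E; apply NZ; rewrite E; ring). field. auto. }
  specialize (X F). cbv beta in X.
  replace (hreg a b c s * hreg a b c t / (rgamma c * rgamma c)) with (hreg a b c s / rgamma c * (hreg a b c t / rgamma c)) by (field; auto).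
  apply (cvg_unshift _ _ 1). eapply cvg_ext; [|exact X]. intros M. cbv beta. rewrite Nat.add_1_r. unfold bsum.
  apply csum_ext. intros N _. simpl jder. unfold bcoef. rewrite !RtoC_mult, !RtoC_minus. reflexivity.
Qed.

(** * Improper integrals over the interval (-1, 1) *)

Definition Iopen (f : R -> R) (l : R) : Prop := is_RInt_gen f (at_right (-1)) (at_left 1) l.

Lemma ends_filter (P : R * R -> Prop) :
  filter_prod (at_right (-1)) (at_left 1) P <->
  exists d, (0 < d < 1)%R /\ forall a b, (-1 < a < -1 + d)%R -> (1 - d < b < 1)%R -> P (a, b).
Proof.
  split.
  - intros [Q S [d1 HQ] [d2 HS] H]. exists (Rmin (1 / 2) (Rmin d1 d2)).
    pose proof (cond_pos d1). pose proof (cond_pos d2).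
    pose proof (Rmin_l (1 / 2) (Rmin d1 d2)). pose proof (Rmin_r (1 / 2) (Rmin d1 d2)).
    pose proof (Rmin_l d1 d2). pose proof (Rmin_r d1 d2).
    split. { split; [|lra]. repeat apply Rmin_glb_lt; lra. }
    intros a b Ha Hb. apply H.
    + apply HQ; [|lra]. change (Rabs (a - -1) < d1)%R. apply Rabs_lt_between. lra.
    + apply HS; [|lra]. change (Rabs (b - 1) < d2)%R. apply Rabs_lt_between. lra.
  - intros [d [Hd H]].
    apply Filter_prod with (Q := fun a => (-1 < a < -1 + d)%R) (R := fun b => (1 - d < b < 1)%R); auto.
    + exists (mkposreal d (proj1 Hd)). intros a Ha Ha'. change (Rabs (a - -1) < d)%R in Ha. apply Rabs_lt_between in Ha. lra.
    + exists (mkposreal d (proj1 Hd)). intros a Ha Ha'. change (Rabs (a - 1) < d)%R in Ha. apply Rabs_lt_between in Ha. lra.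
Qed.

Lemma Iopen_ext f g l : (forall x, (-1 < x < 1)%R -> f x = g x) -> Iopen f l -> Iopen g l.
Proof.
  intros E. unfold Iopen. apply (is_RInt_gen_ext (V := R_NormedModule) (Fa := at_right (-1)) (Fb := at_left 1)). apply ends_filter. exists (1 / 2)%R. split; [lra|].
  intros a b Ha Hb x. simpl. rewrite Rmin_left, Rmax_right by lra. intros Hx. apply E. lra.
Qed.

Lemma Iopen_plus f g l m : Iopen f l -> Iopen g m -> Iopen (fun x => f x + g x)%R (l + m)%R.
Proof.
  intros H K. exact (is_RInt_gen_plus (V := R_NormedModule) (Fa := at_right (-1)) (Fb := at_left 1) f g l m H K).
Qed.

Lemma Iopen_scal k f l : Iopen f l -> Iopen (fun x => k * f x)%R (k * l)%R.
Proof.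
  intros H. exact (is_RInt_gen_scal (V := R_NormedModule) (Fa := at_right (-1)) (Fb := at_left 1) f k l H).
Qed.

Lemma Iopen_unique f l l' : Iopen f l -> Iopen f l' -> l = l'.
Proof.
  intros H K. transitivity (RInt_gen f (at_right (-1)) (at_left 1)).
  - symmetry. exact (is_RInt_gen_unique (V := R_CompleteNormedModule) (Fa := at_right (-1)) (Fb := at_left 1) f l H).
  - exact (is_RInt_gen_unique (V := R_CompleteNormedModule) (Fa := at_right (-1)) (Fb := at_left 1) f l' K).
Qed.

Lemma Iopen_le f g l m : (forall x, (-1 < x < 1)%R -> (Rabs (f x) <= g x)%R) -> Iopen f l -> Iopen g m -> (Rabs l <= m)%R.
Proof.
  intros H Hf Hg. apply (RInt_gen_norm (V := R_CompleteNormedModule) (Fa := at_right (-1)) (Fb := at_left 1) f g l m); [| |exact Hf|exact Hg]; apply ends_filter; exists (1 / 2)%R; (split; [lra|]); intros a b Ha Hb; simpl.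
  - lra.
  - intros x Hx. apply H. lra.
Qed.

(** Convergence of the dominating integral makes the truncated integrals of [f]
    a Cauchy family. *)
Lemma Iopen_dom f g lg : (forall x, (-1 < x < 1)%R -> continuous f x) -> (forall x, (-1 < x < 1)%R -> continuous g x) ->
  (forall x, (-1 < x < 1)%R -> (Rabs (f x) <= g x)%R) -> Iopen g lg -> exists l, Iopen f l.
Proof.
  intros Cf Cg H Hg.
  assert (Xf : forall a b, (-1 < a < 1)%R -> (-1 < b < 1)%R -> ex_RInt f a b).
  { intros a b Ha Hb. apply (ex_RInt_continuous (V := R_CompleteNormedModule)). intros z Hz. apply Cf.
    unfold Rmin, Rmax in Hz. destruct (Rle_dec a b); lra. }
  assert (Xg : forall a b, (-1 < a < 1)%R -> (-1 < b < 1)%R -> ex_RInt g a b).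
  { intros a b Ha Hb. apply (ex_RInt_continuous (V := R_CompleteNormedModule)). intros z Hz. apply Cg.
    unfold Rmin, Rmax in Hz. destruct (Rle_dec a b); lra. }
  assert (LE : forall a b, (-1 < a < 1)%R -> (-1 < b < 1)%R -> (a <= b)%R -> (Rabs (RInt f a b) <= RInt g a b)%R).
  { intros a b Ha Hb Hab. apply (norm_RInt_le (V := R_NormedModule) f g a b); auto.
    - intros x Hx. apply H. lra.
    - apply (RInt_correct (V := R_CompleteNormedModule)); auto.
    - apply (RInt_correct (V := R_CompleteNormedModule)); auto. }
  assert (LA : forall a b, (-1 < a < 1)%R -> (-1 < b < 1)%R -> (Rabs (RInt f a b) <= Rabs (RInt g a b))%R).
  { intros a b Ha Hb. destruct (Rle_dec a b) as [L|L].
    - eapply Rle_trans; [apply LE; auto|]. apply Rle_abs.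
    - assert (L' : (b <= a)%R) by lra. rewrite <- (opp_RInt_swap (V := R_CompleteNormedModule) f b a) by auto.
      rewrite <- (opp_RInt_swap (V := R_CompleteNormedModule) g b a) by auto.
      unfold opp; simpl. rewrite !Rabs_Ropp. eapply Rle_trans; [apply LE; auto|]. apply Rle_abs. }
  assert (CH : forall u a b c, ((u = f \/ u = g) -> (-1 < a < 1) -> (-1 < b < 1) -> (-1 < c < 1) -> RInt u a b + RInt u b c = RInt u a c)%R).
  { intros u a b c Hu Ha Hb Hc. destruct Hu; subst u; apply (RInt_Chasles (V := R_CompleteNormedModule)); auto. }
  destruct (proj1 (filterlim_locally_cauchy (U := R_CompleteSpace) (F := filter_prod (at_right (-1)) (at_left 1)) (fun ab => RInt f (fst ab) (snd ab)))) as [l Hl].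
  - intros eps.
    assert (e4 : (0 < eps / 4)%R) by (pose proof (cond_pos eps); lra).
    assert (HP := Hg (fun y => (Rabs (y - lg) < eps / 4)%R)).
    assert (LOC : locally lg (fun y => (Rabs (y - lg) < eps / 4)%R)) by (exists (mkposreal _ e4); intros y Hy; exact Hy).
    specialize (HP LOC). apply ends_filter in HP. destruct HP as [d [Hd HP]].
    exists (fun ab => (-1 < fst ab < -1 + d)%R /\ (1 - d < snd ab < 1)%R). split.
    + apply ends_filter. exists d. split; auto.
    + intros [a b] [a' b'] [Ha Hb] [Ha' Hb']. simpl in *.
      assert (G : forall a b, (-1 < a < -1 + d)%R -> (1 - d < b < 1)%R -> (Rabs (RInt g a b - lg) < eps / 4)%R).
      { intros x y Hx Hy. destruct (HP x y Hx Hy) as [z [Hz Hz']]. simpl in Hz.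
        apply (is_RInt_unique (V := R_CompleteNormedModule)) in Hz. now rewrite Hz. }
      change (Rabs (RInt f a' b' - RInt f a b) < eps)%R.
      assert (Z : (RInt f a' b' - RInt f a b = RInt f a' a + RInt f b b')%R).
      { rewrite <- (CH f a' a b'), <- (CH f a b b'); auto; try lra. }
      rewrite Z. eapply Rle_lt_trans; [apply Rabs_triang|].
      assert (S1 : (Rabs (RInt f a' a) < eps / 2)%R).
      { eapply Rle_lt_trans; [apply LA; lra|]. replace (RInt g a' a) with ((RInt g a' b - lg) - (RInt g a b - lg))%R.
        2:{ rewrite <- (CH g a' a b); auto; try lra. }
        pose proof (G a' b Ha' Hb). pose proof (G a b Ha Hb). unfold Rminus at 1. eapply Rle_lt_trans; [apply Rabs_triang|]. rewrite Rabs_Ropp. lra. }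
      assert (S2 : (Rabs (RInt f b b') < eps / 2)%R).
      { eapply Rle_lt_trans; [apply LA; lra|]. replace (RInt g b b') with ((RInt g a b' - lg) - (RInt g a b - lg))%R.
        2:{ rewrite <- (CH g a b b'); auto; try lra. }
        pose proof (G a b' Ha Hb'). pose proof (G a b Ha Hb). unfold Rminus at 1. eapply Rle_lt_trans; [apply Rabs_triang|]. rewrite Rabs_Ropp. lra. }
      lra.
  - exists l. intros P HP. specialize (Hl P HP). unfold filtermap in Hl. unfold filtermapi.
    assert (EV : filter_prod (at_right (-1)) (at_left 1) (fun ab => (-1 < fst ab < 1 /\ -1 < snd ab < 1)%R)).
    { apply ends_filter. exists (1 / 2)%R. split; [lra|]. simpl. intros; lra. }
    eapply filter_imp; [|apply (filter_and _ _ EV Hl)].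
    intros [a b] [[Ha Hb] Hx]. simpl in *. exists (RInt f a b). split; auto.
    apply (RInt_correct (V := R_CompleteNormedModule)); auto.
Qed.

Lemma Iopen_FTC F f la lb : (forall x, (-1 < x < 1)%R -> is_derive F x (f x)) -> (forall x, (-1 < x < 1)%R -> continuous f x) ->
  filterlim F (at_right (-1)) (locally la) -> filterlim F (at_left 1) (locally lb) -> Iopen f (lb - la)%R.
Proof.
  intros HD HC Ha Hb.
  apply Iopen_ext with (Derive F). { intros x Hx. apply is_derive_unique. auto. }
  apply (is_RInt_gen_Derive (Fa := at_right (-1)) (Fb := at_left 1) F la lb); [| |exact Ha|exact Hb].
  - apply ends_filter. exists (1 / 2)%R. split; [lra|]. intros a b Ha' Hb' x. simpl. rewrite Rmin_left, Rmax_right by lra.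
    intros Hx. exists (f x). apply HD. lra.
  - apply ends_filter. exists (1 / 2)%R. split; [lra|]. intros a b Ha' Hb' x. simpl. rewrite Rmin_left, Rmax_right by lra.
    intros Hx. apply (continuous_ext_loc _ f); [|apply HC; lra].
    assert (P : (0 < Rmin (1 - x) (x + 1))%R) by (apply Rmin_glb_lt; lra).
    exists (mkposreal _ P). intros y Hy. change (Rabs (y - x) < Rmin (1 - x) (x + 1))%R in Hy.
    symmetry. apply is_derive_unique, HD. pose proof (Rmin_l (1 - x) (x + 1)). pose proof (Rmin_r (1 - x) (x + 1)).
    apply Rabs_lt_between in Hy. lra.
Qed.

(** * The Gegenbauer weight *)

Definition wt (nu x : R) : R := Rpower (1 - x ^ 2) (nu - 1 / 2).

Lemma one_sub_sq_pos x : (-1 < x < 1)%R -> (0 < 1 - x ^ 2)%R.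
Proof. intros. nra. Qed.

Lemma wt_pos nu x : (0 < wt nu x)%R.
Proof. apply exp_pos. Qed.

Lemma wt_S nu x : (-1 < x < 1)%R -> wt (nu + 1) x = ((1 - x ^ 2) * wt nu x)%R.
Proof.
  intros H. unfold wt. replace (nu + 1 - 1 / 2)%R with (1 + (nu - 1 / 2))%R by ring.
  rewrite Rpower_plus, Rpower_1 by (now apply one_sub_sq_pos). reflexivity.
Qed.

Lemma wt_derive nu x : (-1 < x < 1)%R -> is_derive (wt (nu + 1)) x (- (2 * nu + 1) * x * wt nu x)%R.
Proof.
  intros H. pose proof (one_sub_sq_pos x H) as P. unfold wt, Rpower.
  auto_derive. simpl in P; lra.
  replace (exp ((nu + 1 - 1 / 2) * ln (1 + - (x * (x * 1)))))%R with (wt (nu + 1) x) by (unfold wt, Rpower; do 3 f_equal; ring).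
  rewrite wt_S by auto. fold (Rpower (1 - x ^ 2) (nu - 1 / 2)) (wt nu x). field. simpl in P. lra.
Qed.

Lemma wt_continuous nu x : (-1 < x < 1)%R -> continuous (wt nu) x.
Proof.
  intros H. replace nu with ((nu - 1) + 1)%R by ring. apply (ex_derive_continuous (V := R_NormedModule)).
  eexists. now apply wt_derive.
Qed.

Lemma wt_le_1 nu x : (1 / 2 <= nu)%R -> (-1 < x < 1)%R -> (wt nu x <= 1)%R.
Proof.
  intros Hn H. pose proof (one_sub_sq_pos x H) as P. unfold wt, Rpower. apply Rle_trans with (exp 0); [|rewrite exp_0; lra]. apply exp_le.
  assert (ln (1 - x ^ 2) <= 0)%R. { apply Rle_trans with (ln 1); [|rewrite ln_1; lra]. apply ln_le; auto. pose proof (pow2_ge_0 x). lra. } nra.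
Qed.

Lemma wt_mono nu nu' x : (nu <= nu')%R -> (-1 < x < 1)%R -> (wt nu' x <= wt nu x)%R.
Proof.
  intros Hn H. pose proof (one_sub_sq_pos x H) as P. unfold wt, Rpower. apply exp_le.
  assert (ln (1 - x ^ 2) <= 0)%R. { apply Rle_trans with (ln 1); [|rewrite ln_1; lra]. apply ln_le; auto. pose proof (pow2_ge_0 x). lra. } nra.
Qed.

(** The boundary terms of every integration by parts below. *)
Lemma wt_end nu (G : R -> R) M (F : (R -> Prop) -> Prop) : Filter F -> (0 < nu + 1 / 2)%R ->
  (forall x, (-1 < x < 1)%R -> (Rabs (G x) <= M)%R) ->
  (F = at_left 1 \/ F = at_right (-1))%R ->
  filterlim (fun x => wt (nu + 1) x * G x)%R F (locally 0%R).
Proof.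
  intros FF Hn HG HF. intros P [e HP].
  assert (M0 : (0 <= M)%R). { specialize (HG 0%R ltac:(lra)). pose proof (Rabs_pos (G 0%R)). lra. }
  set (s := (nu + 1 / 2)%R). fold s in Hn.
  set (z := Rmin (1 / 2) (Rpower (e / (M + 1)) (/ s))).
  assert (z0 : (0 < z)%R). { unfold z. apply Rmin_glb_lt; [lra|apply exp_pos]. }
  assert (Z2 : (z <= Rpower (e / (M + 1)) (/ s))%R) by apply Rmin_r.
  assert (Z1 : (z <= 1 / 2)%R) by apply Rmin_l.
  assert (KEY : forall x, (-1 < x < 1)%R -> (1 - x ^ 2 < z)%R -> P (wt (nu + 1) x * G x)%R).
  { intros x Hx Hz. pose proof (one_sub_sq_pos x Hx) as Px. apply HP. change (Rabs (wt (nu + 1) x * G x - 0) < e)%R.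
    rewrite Rminus_0_r, Rabs_mult, (Rabs_pos_eq (wt _ _)) by (left; apply wt_pos).
    assert (W : (wt (nu + 1) x < e / (M + 1))%R).
    { unfold wt. replace (nu + 1 - 1 / 2)%R with s by (unfold s; field).
      apply Rlt_le_trans with (Rpower (Rpower (e / (M + 1)) (/ s)) s).
      - unfold Rpower at 1 2. apply exp_increasing. apply Rmult_lt_compat_l; auto. apply ln_increasing; auto.
        lra.
      - rewrite Rpower_mult, Rinv_l by lra. rewrite Rpower_1. lra. apply Rdiv_lt_0_compat; [apply cond_pos|lra]. }
    pose proof (wt_pos (nu + 1) x). specialize (HG x Hx).
    apply Rle_lt_trans with (wt (nu + 1) x * (M + 1))%R.
    - apply Rmult_le_compat_l; lra.
    - apply Rmult_lt_reg_r with (/ (M + 1))%R; [apply Rinv_0_lt_compat; lra|].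
      rewrite Rmult_assoc, Rinv_r by lra. lra. }
  assert (hz : (0 < z / 2)%R) by lra.
  destruct HF as [-> | ->].
  - exists (mkposreal _ hz). intros x Hx Hx'. change (Rabs (x - 1) < z / 2)%R in Hx. apply Rabs_lt_between in Hx. apply KEY; nra.
  - exists (mkposreal _ hz). intros x Hx Hx'. change (Rabs (x - -1) < z / 2)%R in Hx. apply Rabs_lt_between in Hx. apply KEY; nra.
Qed.

Lemma Iopen_parts nu (G G' : R -> R) M : (-1 / 2 < nu)%R ->
  (forall x, is_derive G x (G' x)) -> (forall x, continuous G' x) ->
  (forall x, (-1 < x < 1)%R -> (Rabs (G x) <= M)%R) ->
  Iopen (fun x => wt nu x * ((1 - x ^ 2) * G' x - (2 * nu + 1) * x * G x))%R 0.
Proof.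
  intros Hn HD HC HM.
  assert (CG : forall x, continuous G x) by (intros x; apply (ex_derive_continuous (V := R_NormedModule)); eexists; apply HD).
  replace 0%R with (0 - 0)%R by ring.
  apply (Iopen_FTC (fun x => wt (nu + 1) x * G x)%R).
  - intros x Hx. evar_last. apply is_derive_mult_R; [now apply wt_derive|apply HD]. rewrite wt_S by auto. ring.
  - intros x Hx. apply (continuous_mult (K := R_AbsRing)); [now apply wt_continuous|].
    apply (continuous_minus (V := R_NormedModule)).
    + apply (continuous_mult (K := R_AbsRing)); auto. apply (ex_derive_continuous (V := R_NormedModule)). auto_derive. auto.
    + apply (continuous_mult (K := R_AbsRing)); auto. apply (ex_derive_continuous (V := R_NormedModule)). auto_derive. auto.
  - apply wt_end with M; auto; try typeclasses eauto. lra.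
  - apply wt_end with M; auto; try typeclasses eauto. lra.
Qed.

Lemma Iopen_const1 : Iopen (fun _ => 1%R) 2%R.
Proof.
  replace 2%R with (1 - -1)%R by ring. apply (Iopen_FTC (fun x => x)).
  - intros x _. apply (is_derive_id (K := R_AbsRing)).
  - intros x _. apply continuous_const.
  - intros P HP. apply filter_le_within. exact HP.
  - intros P HP. apply filter_le_within. exact HP.
Qed.

Definition wint (nu : R) : R := RInt_gen (wt nu) (at_right (-1)) (at_left 1).

Lemma Iopen_wint_of_ex nu l : Iopen (wt nu) l -> Iopen (wt nu) (wint nu).
Proof. intros H. unfold wint. rewrite (is_RInt_gen_unique (V := R_CompleteNormedModule) (Fa := at_right (-1)) (Fb := at_left 1) (wt nu) l H). exact H. Qed.

(** For negative [nu - 1/2] the weight is unbounded; the same integration by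
    parts reduces it to [nu + 1] and gives the recurrence. *)
Lemma Iopen_wint_step nu : (-1 / 2 < nu)%R -> Iopen (wt nu) (wint nu) /\ ((2 * nu + 1) * wint nu = (2 * nu + 2) * wint (nu + 1))%R.
Proof.
  intros Hn.
  assert (H1 : exists l, Iopen (wt (nu + 1)) l).
  { apply (Iopen_dom _ (fun _ => 1%R) 2).
    - intros x Hx. now apply wt_continuous.
    - intros x _. apply continuous_const.
    - intros x Hx. rewrite Rabs_pos_eq by (left; apply wt_pos). apply wt_le_1; lra.
    - apply Iopen_const1. }
  destruct H1 as [l1 H1]. apply Iopen_wint_of_ex in H1.
  pose proof (Iopen_parts nu (fun x => x) (fun _ => 1%R) 1 Hn) as H2.
  assert (H3 : Iopen (fun x => wt nu x * ((1 - x ^ 2) * 1 - (2 * nu + 1) * x * x))%R 0).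
  { apply H2. - intros x. apply (is_derive_id (K := R_AbsRing)). - intros x. apply continuous_const. - intros x Hx. apply Rabs_le. lra. }
  assert (H4 : Iopen (wt nu) (/ (2 * nu + 1) * ((2 * nu + 2) * wint (nu + 1) + (-1) * 0))%R).
  { eapply Iopen_ext; [|apply Iopen_scal, Iopen_plus; [apply Iopen_scal, H1|apply Iopen_scal, H3]].
    intros x Hx. cbv beta. rewrite wt_S by auto. field. lra. }
  split. now apply Iopen_wint_of_ex in H4.
  apply Iopen_wint_of_ex in H4 as H5. rewrite (Iopen_unique _ _ _ H5 H4). field. lra.
Qed.

Lemma Iopen_wint nu : (-1 / 2 < nu)%R -> Iopen (wt nu) (wint nu).
Proof. apply Iopen_wint_step. Qed.

Lemma wint_rec nu : (-1 / 2 < nu)%R -> ((2 * nu + 1) * wint nu = (2 * nu + 2) * wint (nu + 1))%R.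
Proof. apply Iopen_wint_step. Qed.

Lemma wint_mono nu nu' : (-1 / 2 < nu)%R -> (nu <= nu')%R -> (wint nu' <= wint nu)%R.
Proof.
  intros Hn Hl. eapply Rle_trans; [apply Rle_abs|]. apply (Iopen_le (wt nu') (wt nu)); try apply Iopen_wint; try lra.
  intros x Hx. rewrite Rabs_pos_eq by (left; apply wt_pos). now apply wt_mono.
Qed.

Lemma wint_half : wint (1 / 2) = 2%R.
Proof.
  apply (Iopen_unique (wt (1 / 2))); [apply Iopen_wint; lra|]. apply (Iopen_ext (fun _ => 1%R)); [|apply Iopen_const1].
  intros x Hx. unfold wt. replace (1 / 2 - 1 / 2)%R with 0%R by ring. rewrite Rpower_O; auto. now apply one_sub_sq_pos.
Qed.

Lemma asin_at_left_1 : filterlim asin (at_left 1) (locally (PI / 2)%R).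
Proof.
  intros P [e HP].
  assert (Pe : (0 < Rmin e 1)%R) by (apply Rmin_glb_lt; [apply cond_pos|lra]).
  pose proof PI2_1 as HPI. pose proof (Rmin_l e 1) as M1. pose proof (Rmin_r e 1) as M2.
  set (th := (PI / 2 - Rmin e 1)%R) in *.
  assert (S1 : (sin th < 1)%R). { rewrite <- sin_PI2. apply sin_increasing_1; unfold th; lra. }
  assert (dp : (0 < 1 - sin th)%R) by lra.
  exists (mkposreal _ dp). intros x Hx Hx'. change (Rabs (x - 1) < 1 - sin th)%R in Hx. apply Rabs_lt_between in Hx.
  pose proof (asin_bound x) as AB.
  apply HP. change (Rabs (asin x - (PI / 2)) < e)%R. rewrite Rabs_left1 by lra.
  assert (th < asin x)%R; [|unfold th in *; lra].
  destruct (Rlt_le_dec th (asin x)) as [|C]; auto. exfalso.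
  assert (sin (asin x) <= sin th)%R by (apply sin_incr_1; unfold th in *; lra).
  pose proof (SIN_bound th). rewrite sin_asin in H by lra. lra.
Qed.

Lemma asin_at_right_m1 : filterlim asin (at_right (-1)) (locally (- (PI / 2))%R).
Proof.
  apply (filterlim_ext (fun x => - asin (- x))%R). { intros x. rewrite asin_opp. apply Ropp_involutive. }
  apply (filterlim_comp _ _ _ (fun x => asin (- x)) Ropp _ (locally (PI / 2)%R)).
  - apply (filterlim_comp _ _ _ Ropp asin _ (at_left 1)); [|apply asin_at_left_1].
    intros P [e HP]. exists e. intros x Hx Hx'. apply HP; [|lra].
    change (Rabs (x - -1) < e)%R in Hx. change (Rabs (- x - 1) < e)%R.
    replace (- x - 1)%R with (- (x - -1))%R by ring. now rewrite Rabs_Ropp.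
  - apply (filterlim_opp (V := R_NormedModule)).
Qed.

(** Here the weight is the derivative of [asin]. *)
Lemma wint_0 : wint 0 = PI.
Proof.
  apply (Iopen_unique (wt 0)); [apply Iopen_wint; lra|].
  replace PI with (PI / 2 - - (PI / 2))%R by field.
  apply (Iopen_FTC asin); [| |apply asin_at_right_m1|apply asin_at_left_1].
  - intros x Hx. replace (wt 0 x) with (1 / sqrt (1 - Rsqr x))%R.
    + apply is_derive_Reals. rewrite <- (derive_pt_asin x Hx). apply derive_pt_eq_1 with (derivable_pt_asin x Hx). reflexivity.
    + unfold wt. replace (0 - 1 / 2)%R with (- / 2)%R by field. pose proof (one_sub_sq_pos x Hx).
      rewrite Rpower_Ropp, Rpower_sqrt by auto. unfold Rsqr, Rdiv. rewrite Rmult_1_l. do 3 f_equal. ring.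
  - intros x Hx. now apply wt_continuous.
Qed.

(** * Weighted integrals of complex functions *)

Definition Iw (nu : R) (Phi : R -> C) (l : C) : Prop :=
  Iopen (fun x => wt nu x * Re (Phi x))%R (Re l) /\ Iopen (fun x => wt nu x * Im (Phi x))%R (Im l).

Definition ccont (Phi : R -> C) (x : R) : Prop :=
  continuous (fun x => Re (Phi x)) x /\ continuous (fun x => Im (Phi x)) x.

Lemma Iw_ext nu f g l : (forall x, (-1 < x < 1)%R -> f x = g x) -> Iw nu f l -> Iw nu g l.
Proof. intros E [H K]. split; (eapply Iopen_ext; [|eassumption]); intros x Hx; cbv beta; now rewrite E. Qed.

Lemma Iw_eq nu f l l' : l = l' -> Iw nu f l -> Iw nu f l'.
Proof. intros ->; auto. Qed.

Lemma Iw_plus nu f g l m : Iw nu f l -> Iw nu g m -> Iw nu (fun x => f x + g x) (l + m).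
Proof.
  intros [H1 H2] [K1 K2]. split.
  - eapply Iopen_ext; [|exact (Iopen_plus _ _ _ _ H1 K1)]. intros x _. simpl. unfold Re. ring.
  - eapply Iopen_ext; [|exact (Iopen_plus _ _ _ _ H2 K2)]. intros x _. simpl. unfold Im. ring.
Qed.

Lemma Iw_scal nu k f l : Iw nu f l -> Iw nu (fun x => k * f x) (k * l).
Proof.
  intros [H1 H2]. split.
  - replace (Re (k * l)) with (Re k * Re l + (- Im k) * Im l)%R by (simpl; unfold Re, Im; ring).
    eapply Iopen_ext; [|exact (Iopen_plus _ _ _ _ (Iopen_scal (Re k) _ _ H1) (Iopen_scal (- Im k)%R _ _ H2))].
    intros x _. simpl. unfold Re, Im. ring.
  - replace (Im (k * l)) with (Im k * Re l + Re k * Im l)%R by (simpl; unfold Re, Im; ring).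
    eapply Iopen_ext; [|exact (Iopen_plus _ _ _ _ (Iopen_scal (Im k) _ _ H1) (Iopen_scal (Re k)%R _ _ H2))].
    intros x _. simpl. unfold Re, Im. ring.
Qed.

Lemma Iw_minus nu f g l m : Iw nu f l -> Iw nu g m -> Iw nu (fun x => f x - g x) (l - m).
Proof.
  intros H K. eapply Iw_eq; [|eapply Iw_ext; [|exact (Iw_plus _ _ _ _ _ H (Iw_scal _ (-(1)) _ _ K))]].
  ring. intros x _. cbv beta. ring.
Qed.

Lemma Iw_unique nu f l l' : Iw nu f l -> Iw nu f l' -> l = l'.
Proof.
  intros [H1 H2] [K1 K2]. apply injective_projections; [exact (Iopen_unique _ _ _ H1 K1)|exact (Iopen_unique _ _ _ H2 K2)].
Qed.

Lemma Iw_bound nu f l e : (-1 / 2 < nu)%R -> Iw nu f l -> (forall x, (-1 < x < 1)%R -> (Cmod (f x) <= e)%R) ->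
  (Cmod l <= 2 * (e * wint nu))%R.
Proof.
  intros Hn [H K] He. eapply Rle_trans; [apply Cmod_le_ReIm|].
  assert (W := Iopen_scal e _ _ (Iopen_wint nu Hn)).
  assert (Rabs (Re l) <= e * wint nu)%R.
  { eapply Iopen_le; [|exact H|exact W]. intros x Hx. cbv beta. rewrite Rabs_mult, (Rabs_pos_eq (wt nu x)) by (left; apply wt_pos).
    rewrite Rmult_comm. apply Rmult_le_compat_r; [left; apply wt_pos|]. eapply Rle_trans; [apply re_le_Cmod|auto]. }
  assert (Rabs (Im l) <= e * wint nu)%R.
  { eapply Iopen_le; [|exact K|exact W]. intros x Hx. cbv beta. rewrite Rabs_mult, (Rabs_pos_eq (wt nu x)) by (left; apply wt_pos).
    rewrite Rmult_comm. apply Rmult_le_compat_r; [left; apply wt_pos|]. eapply Rle_trans; [apply Cmod_Im_le|auto]. }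
  lra.
Qed.

Lemma Iw_ex nu f M : (-1 / 2 < nu)%R -> (forall x, (-1 < x < 1)%R -> ccont f x) -> (forall x, (-1 < x < 1)%R -> (Cmod (f x) <= M)%R) ->
  exists l, Iw nu f l.
Proof.
  intros Hn Hc HM. assert (W := Iopen_scal M _ _ (Iopen_wint nu Hn)).
  destruct (Iopen_dom (fun x => wt nu x * Re (f x))%R (fun x => M * wt nu x)%R (M * wint nu)%R) with (4 := W) as [l1 H1].
  - intros x Hx. apply (continuous_mult (K := R_AbsRing)); [now apply wt_continuous|]. exact (proj1 (Hc x Hx)).
  - intros x Hx. apply (continuous_scal_r (K := R_AbsRing) (V := R_NormedModule)). now apply wt_continuous.
  - intros x Hx. rewrite Rabs_mult, (Rabs_pos_eq (wt nu x)) by (left; apply wt_pos).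
    rewrite Rmult_comm. apply Rmult_le_compat_r; [left; apply wt_pos|]. eapply Rle_trans; [apply re_le_Cmod|auto].
  - destruct (Iopen_dom (fun x => wt nu x * Im (f x))%R (fun x => M * wt nu x)%R (M * wint nu)%R) with (4 := W) as [l2 H2].
    + intros x Hx. apply (continuous_mult (K := R_AbsRing)); [now apply wt_continuous|]. exact (proj2 (Hc x Hx)).
    + intros x Hx. apply (continuous_scal_r (K := R_AbsRing) (V := R_NormedModule)). now apply wt_continuous.
    + intros x Hx. rewrite Rabs_mult, (Rabs_pos_eq (wt nu x)) by (left; apply wt_pos).
      rewrite Rmult_comm. apply Rmult_le_compat_r; [left; apply wt_pos|]. eapply Rle_trans; [apply Cmod_Im_le|auto].
    + exists (l1, l2). split; assumption.
Qed.

Lemma Iw_uniform nu (F : nat -> R -> C) z f l (e : nat -> R) : (-1 / 2 < nu)%R ->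
  (forall n, Iw nu (F n) (z n)) -> Iw nu f l ->
  (forall n x, (-1 < x < 1)%R -> (Cmod (F n x - f x) <= e n)%R) -> is_lim_seq e 0%R -> cvg z l.
Proof.
  intros Hn HF Hf He Le. apply cvg_dom with (fun n => 2 * (e n * wint nu))%R.
  - intros n. apply (Iw_bound nu (fun x => F n x - f x)); auto. now apply Iw_minus.
  - replace 0%R with (2 * (0 * wint nu))%R by ring.
    apply is_lim_seq_mult'; [apply is_lim_seq_const|]. apply is_lim_seq_mult'; [exact Le|apply is_lim_seq_const].
Qed.

Lemma Iw_is_RInt_gen nu f l : Iw nu f l ->
  is_RInt_gen (V := C_R_NormedModule) (fun x => RtoC (wt nu x) * f x) (at_right (-1)) (at_left 1) l.
Proof.
  intros [H K] P HP. apply locally_Cmod in HP. destruct HP as [e [He HP]].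
  assert (e2 : (0 < e / 2)%R) by lra.
  assert (L : forall r : R, locally r (fun y => (Rabs (y - r) < e / 2)%R)).
  { intros r. exists (mkposreal _ e2). intros y Hy. exact Hy. }
  specialize (H _ (L (Re l))). specialize (K _ (L (Im l))). unfold filtermapi in *.
  eapply filter_imp; [|apply (filter_and _ _ H K)].
  intros [a b] [[y1 [H1 H1']] [y2 [H2 H2']]]. simpl in *. exists (y1, y2). split.
  - apply is_RInt_fct_extend_pair; (eapply is_RInt_ext; [|eassumption]); intros x _; simpl; unfold Re, Im; ring.
  - apply HP. eapply Rle_lt_trans; [apply Cmod_le_ReIm|]. simpl. unfold Re, Im in *. simpl in *.
    change (Rabs (y1 - fst l) + Rabs (y2 - snd l) < e)%R. lra.
Qed.

(** * Differentiable functions on the line *)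

Definition cdiff (f : R -> C) : Prop := forall x, exists l, cder f x l.

Lemma cdiff_ccont f x : cdiff f -> ccont f x.
Proof.
  intros H. destruct (H x) as [l [H1 H2]]. split; apply (ex_derive_continuous (V := R_NormedModule)); eexists; eassumption.
Qed.

Lemma cdiff_mult f g : cdiff f -> cdiff g -> cdiff (fun x => f x * g x).
Proof. intros H K x. destruct (H x), (K x). eexists. now apply cder_mult; eauto. Qed.

Lemma cdiff_plus f g : cdiff f -> cdiff g -> cdiff (fun x => f x + g x).
Proof. intros H K x. destruct (H x), (K x). eexists. now apply cder_plus; eauto. Qed.

Lemma cdiff_const k : cdiff (fun _ => k).
Proof. intros x. eexists. apply cder_const. Qed.

Lemma cdiff_csum (f : nat -> R -> C) n : (forall i, cdiff (f i)) -> cdiff (fun x => csum (fun i => f i x) n).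
Proof. intros H. induction n as [|n IH]; simpl. apply cdiff_const. now apply cdiff_plus. Qed.

Lemma cdiff_pow f n : cdiff f -> cdiff (fun x => f x ^ n).
Proof. intros H. induction n as [|n IH]; simpl. apply cdiff_const. now apply (cdiff_mult f). Qed.

Lemma cdiff_bounded f : cdiff f -> exists M, forall x, (-1 <= x <= 1)%R -> (Cmod (f x) <= M)%R.
Proof.
  intros H. set (g := fun x => (Re (f x) ^ 2 + Im (f x) ^ 2)%R).
  destruct (continuity_ab_maj g (-1) 1) as [m [Hm _]]; [lra| |].
  - intros x _. apply continuity_pt_filterlim. destruct (H x) as [l [H1 H2]].
    apply (ex_derive_continuous (V := R_NormedModule) g). eexists. unfold g.
    apply (is_derive_plus (V := R_NormedModule)); apply (is_derive_pow (fun x => _) 2); eassumption.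
  - exists (Cmod (f m)). intros x Hx. apply Rsqr_incr_0; auto using Cmod_ge_0. rewrite !Rsqr_pow2, !Cmod2_alt. now apply Hm.
Qed.

Lemma Iw_parts nu G G' : (-1 / 2 < nu)%R -> (forall x, cder G x (G' x)) -> cdiff G' ->
  Iw nu (fun x => (1 - RtoC x * RtoC x) * G' x - RtoC (2 * nu + 1) * RtoC x * G x) 0.
Proof.
  intros Hn HG HG'. destruct (cdiff_bounded G) as [M HM]. { intros x. eexists; apply HG. }
  split.
  - eapply Iopen_ext; [|apply (Iopen_parts nu (fun x => Re (G x)) (fun x => Re (G' x)) M Hn)].
    + intros x _. simpl. unfold Re, Im. ring.
    + intros x. exact (proj1 (HG x)).
    + intros x. exact (proj1 (cdiff_ccont G' x HG')).
    + intros x Hx. eapply Rle_trans; [apply re_le_Cmod|apply HM; lra].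
  - eapply Iopen_ext; [|apply (Iopen_parts nu (fun x => Im (G x)) (fun x => Im (G' x)) M Hn)].
    + intros x _. simpl. unfold Re, Im. ring.
    + intros x. exact (proj2 (HG x)).
    + intros x. exact (proj2 (cdiff_ccont G' x HG')).
    + intros x Hx. eapply Rle_trans; [apply Cmod_Im_le|apply HM; lra].
Qed.

(** * Gegenbauer polynomials against contiguous Jacobi polynomials *)

Definition gcoef (n : nat) (nu : R) (k : nat) : C :=
  poch (- INR n) k * poch (INR n + 2 * nu) k / (poch (nu + 1 / 2) k * INR (fact k)).

(** The Gegenbauer polynomial normalized to 1 at [x = 1]. *)
Definition gpoly (n : nat) (nu : R) (x : R) : C :=
  csum (fun k => gcoef n nu k * ((1 - RtoC x) / 2) ^ k) (S n).

Definition gpoly' (n : nat) (nu : R) (x : R) : C :=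
  csum (fun k => gcoef n nu k * (- (1 / 2) * (INR k * ((1 - RtoC x) / 2) ^ pred k))) (S n).

Lemma gcoef_big n nu : gcoef n nu (S n) = 0.
Proof. unfold gcoef. rewrite poch_nonpos_zero by lia. unfold Cdiv. ring. Qed.

Lemma cder_gpoly n nu x : cder (gpoly n nu) x (gpoly' n nu x).
Proof.
  apply (cder_csum (fun k x => gcoef n nu k * ((1 - RtoC x) / 2) ^ k)). intros k _. apply cder_scal.
  assert (D : cder (fun x => (1 - RtoC x) / 2) x (- (1 / 2))).
  { eapply cder_eq; [|eapply cder_ext; [|apply (cder_scal (/ 2)); apply cder_minus; [apply (cder_const 1)|apply cder_id]]].
    field. intros u; cbv beta; field. }
  induction k as [|k IH].
  - eapply cder_eq; [|apply (cder_const 1)]. simpl. ring.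
  - eapply cder_eq; [|apply (cder_mult (fun x => (1 - RtoC x) / 2) (fun x => ((1 - RtoC x) / 2) ^ k)); [exact D|exact IH]].
    cbv beta. rewrite RtoC_S. destruct k as [|k]; simpl pred; rewrite ?Cpow_S; [simpl; ring|ring].
Qed.

Lemma cdiff_gpoly n nu : cdiff (gpoly n nu).
Proof. intros x. eexists. apply cder_gpoly. Qed.

Lemma cdiff_y : cdiff (fun x => (1 - RtoC x) / 2).
Proof.
  apply (cdiff_mult (fun x => 1 - RtoC x) (fun _ => / 2)); [|apply cdiff_const].
  intros x. eexists. apply cder_minus; [apply (cder_const 1)|apply cder_id].
Qed.

Lemma cdiff_gpoly' n nu : cdiff (gpoly' n nu).
Proof.
  apply (cdiff_csum (fun k x => gcoef n nu k * (- (1 / 2) * (INR k * ((1 - RtoC x) / 2) ^ pred k)))). intros k.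
  apply (cdiff_mult (fun _ => gcoef n nu k)); [apply cdiff_const|].
  apply (cdiff_mult (fun _ => - (1 / 2))); [apply cdiff_const|].
  apply (cdiff_mult (fun _ => RtoC (INR k))); [apply cdiff_const|]. apply cdiff_pow, cdiff_y.
Qed.

Lemma half_nonpole nu : (-1 / 2 < nu)%R -> ~ nonpos_int (RtoC nu + 1 / 2).
Proof.
  intros H. replace (RtoC nu + 1 / 2) with (RtoC (nu + 1 / 2)).
  - apply Re_not_nonpos_int. simpl. lra.
  - rewrite RtoC_plus. f_equal. apply injective_projections; simpl; field.
Qed.

Lemma RtoC_add1 nu : RtoC (nu + 1) = RtoC nu + 1.
Proof. apply RtoC_plus. Qed.

Lemma gcoef_step n nu k : (-1 / 2 < nu)%R ->
  (nu + 1 / 2) * gcoef (S n) nu (S k) =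
  (INR k + 1 + (nu + 1 / 2)) * gcoef n (nu + 1) (S k) - (INR k + 2 * (nu + 1 / 2)) * gcoef n (nu + 1) k.
Proof.
  intros Hn. unfold gcoef. rewrite RtoC_add1.
  replace (RtoC nu + 1 + 1 / 2) with (RtoC nu + 1 / 2 + 1) by ring.
  replace (- INR (S n)) with (- INR n - 1) by (rewrite RtoC_S; ring).
  rewrite (poch_S_l (- INR n - 1) k), (poch_S_l (INR (S n) + 2 * nu) k), (poch_S_l (nu + 1 / 2) k).
  replace (- INR n - 1 + 1) with (- INR n) by ring.
  replace (INR (S n) + 2 * nu + 1) with (INR n + 2 * (nu + 1)) by (rewrite RtoC_S; ring).
  rewrite !poch_S, fact_simpl, mult_INR, RtoC_mult, !RtoC_S.
  pose proof (half_nonpole nu Hn) as N1. pose proof (nonpos_int_shift _ N1) as N2.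
  pose proof (poch_nonpole _ k N2). pose proof (nonpos_int_neq _ k N2).
  assert (N0 := nonpos_int_neq _ 0 N1). simpl INR in N0. rewrite Cplus_0_r in N0.
  pose proof (fact_neq k). pose proof (INR_S_neq k).
  set (A := poch (RtoC nu + 1 / 2 + 1) k) in *.
  set (g := RtoC nu + 1 / 2) in *.
  assert (Eg : RtoC nu = g - 1 / 2) by (unfold g; ring). rewrite Eg.
  field. repeat split; auto.
Qed.

(** Rodrigues' formula, one step at a time. *)
Lemma gpoly_rodrigues n nu x : (-1 / 2 < nu)%R ->
  (1 - RtoC x * RtoC x) * gpoly' n (nu + 1) x - RtoC (2 * nu + 1) * RtoC x * gpoly n (nu + 1) x
  = - RtoC (2 * nu + 1) * gpoly (S n) nu x.
Proof.
  intros Hn. set (y := (1 - RtoC x) / 2). assert (Ex : RtoC x = 1 - 2 * y) by (unfold y; field).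
  set (g := RtoC nu + 1 / 2). assert (Eg : RtoC (2 * nu + 1) = 2 * g) by (unfold g; rewrite RtoC_plus, RtoC_mult; field).
  set (t := gcoef n (nu + 1)).
  set (P := csum (fun k => t k * y ^ k) (S n)). set (P1 := csum (fun k => INR k * (t k * y ^ k)) (S n)).
  assert (E1 : y * gpoly' n (nu + 1) x = - (1 / 2) * P1).
  { unfold gpoly', P1. rewrite <- !csum_scal. apply csum_ext. intros k _. fold y t.
    destruct k as [|k]; [simpl; ring|]. simpl pred. rewrite Cpow_S. ring. }
  assert (E2 : gpoly n (nu + 1) x = P) by reflexivity.
  assert (E3 : g * gpoly (S n) nu x = P1 + g * P - y * (P1 + 2 * g * P)).
  { unfold gpoly. fold y. rewrite csum_S0, Cmult_plus_distr_l, <- csum_scal.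
    transitivity (g * t 0%nat + csum (fun k => ((INR k + 1 + g) * t (S k) * y ^ S k) - y * (INR k * (t k * y ^ k) + 2 * g * (t k * y ^ k))) (S n)).
    - f_equal. + unfold t, gcoef. simpl. f_equal. field.
      + apply csum_ext. intros k _. rewrite Cmult_assoc. unfold g. rewrite gcoef_step by auto. fold g t. rewrite Cpow_S. ring.
    - rewrite csum_minus, csum_scal, csum_plus, csum_scal. fold P P1.
      assert (S1 : csum (fun k => (INR k + g) * t k * y ^ k) (S (S n)) = P1 + g * P).
      { change (csum ?f (S (S n))) with (csum f (S n) + f (S n)). cbv beta. unfold t at 2. rewrite gcoef_big.
        unfold P1, P. rewrite <- csum_scal, <- csum_plus. rewrite <- Cplus_0_r. f_equal; [|ring]. apply csum_ext. intros; ring. }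
      rewrite csum_S0 in S1. rewrite <- S1.
      assert (S2 : csum (fun i => (INR i + 1 + g) * t (S i) * y ^ S i) (S n) = csum (fun i => (INR (S i) + g) * t (S i) * y ^ S i) (S n)).
      { apply csum_ext. intros i _. now rewrite RtoC_S. }
      rewrite S2. simpl (INR 0). change (y ^ 0) with (RtoC 1). ring. }
  rewrite Eg, E2. transitivity (4 * (1 - y) * (y * gpoly' n (nu + 1) x) - 2 * g * (1 - 2 * y) * P).
  { rewrite Ex. ring. }
  rewrite E1. transitivity (- (2) * (g * gpoly (S n) nu x)); [|ring]. rewrite E3. field.
Qed.

Definition jpoly (c : C) (N : nat) (x : R) : C :=
  jac (hnorm c) (hnorm c) N (RtoC ((x - 1) / 2)) (RtoC ((x + 1) / 2)).

Lemma cder_jpoly_raw c N x : cder (jpoly c N) x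
  (1 / 2 * (jacp (hshift (hnorm c)) (hnorm c) N (RtoC ((x - 1) / 2)) (RtoC ((x + 1) / 2))
          + jacp (hnorm c) (hshift (hnorm c)) N (RtoC ((x - 1) / 2)) (RtoC ((x + 1) / 2)))).
Proof.
  eapply cder_eq; [|apply (cder_jac (fun x => RtoC ((x - 1) / 2)) (fun x => RtoC ((x + 1) / 2)) (RtoC (1 / 2)) (RtoC (1 / 2)))].
  - rewrite RtoC_div by lra. ring.
  - apply cder_RtoC. auto_derive; [exact I|lra].
  - apply cder_RtoC. auto_derive; [exact I|lra].
Qed.

Lemma hshift_hnorm c i : ~ nonpos_int c -> hshift (hnorm c) i = / c * hnorm (c + 1) i.
Proof.
  intros Hc. unfold hshift, hnorm. rewrite poch_S_l, fact_simpl, mult_INR, RtoC_mult, RtoC_S.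
  pose proof (nonpos_int_neq c 0 Hc) as c0. simpl INR in c0. rewrite Cplus_0_r in c0.
  pose proof (poch_nonpole _ i (nonpos_int_shift c Hc)). pose proof (fact_neq i). pose proof (INR_S_neq i). field. auto.
Qed.

Lemma hnorm_shift c i : ~ nonpos_int c -> hnorm c i = (c + INR i) / c * hnorm (c + 1) i.
Proof.
  intros Hc. unfold hnorm.
  pose proof (nonpos_int_neq c 0 Hc) as c0. simpl INR in c0. rewrite Cplus_0_r in c0.
  pose proof (poch_nonpole _ i (nonpos_int_shift c Hc)) as H1. pose proof (poch_nonpole _ i Hc) as H2. pose proof (fact_neq i).
  pose proof (poch_S_l c i) as E. rewrite poch_S in E.
  replace (poch (c + 1) i) with (poch c i * (c + INR i) / c) by (rewrite E; field; auto).
  pose proof (nonpos_int_neq c i Hc). field. auto.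
Qed.

Lemma cder_jpoly c N x : ~ nonpos_int c ->
  cder (jpoly c (S N)) x ((2 * c + INR N) / (2 * (c * c)) * jpoly (c + 1) N x).
Proof.
  intros Hc. eapply cder_eq; [|apply cder_jpoly_raw]. unfold jacp, jpoly, jac.
  set (p := RtoC ((x - 1) / 2)). set (r := RtoC ((x + 1) / 2)).
  rewrite <- csum_plus, <- !csum_scal. apply csum_ext. intros i Hi.
  rewrite !hshift_hnorm, (hnorm_shift c i), (hnorm_shift c (N - i)) by auto.
  pose proof (nonpos_int_neq c 0 Hc) as c0. simpl INR in c0. rewrite Cplus_0_r in c0.
  replace (RtoC (INR N)) with (INR i + INR (N - i)) by (rewrite <- RtoC_INR_add; do 2 f_equal; lia).
  field. auto.
Qed.

Lemma cdiff_jpoly c N : cdiff (jpoly c N).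
Proof. intros x. eexists. apply cder_jpoly_raw. Qed.

(** The integrand of an integration by parts that links the integrals of the
    polynomials of degrees [m + 2] and [m]. *)
Lemma jpoly_contig c nu m x : ~ nonpos_int c -> let M := RtoC (INR (S m)) in
  (2 * M + 2 * c - 1) * (c + M - 1) *
  ((1 - RtoC x * RtoC x) * (1 / 2 * (jacp (hshift (hnorm c)) (hnorm c) (S m) (RtoC ((x - 1) / 2)) (RtoC ((x + 1) / 2))
          + jacp (hnorm c) (hshift (hnorm c)) (S m) (RtoC ((x - 1) / 2)) (RtoC ((x + 1) / 2))))
    - RtoC (2 * nu + 1) * RtoC x * jpoly c (S m) x)
  = - ((M + 1) * (M + 1 + 2 * nu) * (2 * c - 1 + M) * (c + M) * (c + M - 1)) * jpoly c (S (S m)) x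
    + (M - 2 + 2 * c - 2 * nu) * jpoly c m x.
Proof.
  intros Hc M. set (p := RtoC ((x - 1) / 2)). set (r := RtoC ((x + 1) / 2)).
  assert (E1 : r - p = 1) by (unfold p, r; rewrite <- RtoC_minus; f_equal; field).
  assert (E2 : RtoC x = p + r) by (unfold p, r; rewrite <- RtoC_plus; f_equal; field).
  unfold jpoly. fold p r. rewrite RtoC_plus, RtoC_mult, E2.
  set (h := hnorm c). pose proof (hseq_hnorm c Hc : hseq c h) as Hh.
  set (J0 := jac h h m p r). set (J1 := jac h h (S m) p r). set (J2 := jac h h (S (S m)) p r).
  set (A := jacp (hshift h) h (S m) p r). set (B := jacp h (hshift h) (S m) p r).
  set (K := (2 * M + 2 * c - 1) * (c + M - 1)).
  transitivity ((- (2) * K) * (r * (p * A)) + (- (2) * K) * (p * (r * B)) + (- (2 * nu + 1) * K) * (p * J1) + (- (2 * nu + 1) * K) * (r * J1)).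
  { replace (1 - (p + r) * (p + r)) with ((r - p) * (r - p) - (p + r) * (p + r)) by (rewrite E1; ring). field. }
  transitivity ((- ((M + 1) * (M + 1 + 2 * nu) * (2 * c - 1 + M) * (c + M) * (c + M - 1))) * J2
    + (M - 2 + 2 * c - 2 * nu) * (r * (r * J0)) + (M - 2 + 2 * c - 2 * nu) * (p * (p * J0)) + (- (2) * (M - 2 + 2 * c - 2 * nu)) * (p * (r * J0))).
  2:{ transitivity ((- ((M + 1) * (M + 1 + 2 * nu) * (2 * c - 1 + M) * (c + M) * (c + M - 1))) * J2
        + (M - 2 + 2 * c - 2 * nu) * ((r - p) * (r - p) * J0)); [ring|]. rewrite E1. ring. }
  unfold A, B, J0, J1, J2. rewrite jacp_p, jacp_r, !jac_wjac.
  rewrite !(wjac_p c), !(wjac_r c) by auto. rewrite !(wjac_p c) by auto.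
  rewrite !wjac_scal, !wjac_plus.
  apply wjac_ext. intros a b E. assert (EM : M = a + b - 1) by (rewrite E; unfold M; rewrite !RtoC_S; ring).
  unfold K. rewrite EM. ring.
Qed.

(** The integral of [jpoly c (2 * k)] relative to that of the weight, see
    [Iw_jpoly]. *)
Fixpoint jratio (c : C) (nu : R) (k : nat) : C :=
  match k with
  | O => 1
  | S k => (INR k + (c - 1 / 2 - nu)) / (4 * (INR k + 1) * (INR k + 1 + nu) * (c + INR k) * (c + INR (2 * k)) * (c + INR (2 * k) + 1)) * jratio c nu k
  end.

Lemma double_nonpole c : ~ nonpos_int (2 * c - 1) -> ~ nonpos_int c.
Proof.
  intros H [m Hm]. apply H. exists (2 * m + 1)%nat. rewrite Hm, RtoC_INR_add, mult_INR, RtoC_mult. simpl (INR 1). simpl (INR 2).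
  rewrite RtoC_plus. ring.
Qed.

Lemma nu_pos_neq nu k : (-1 / 2 < nu)%R -> INR k + 1 + RtoC nu <> 0.
Proof.
  intros H E. rewrite <- !RtoC_plus in E. apply RtoC_inj in E. pose proof (pos_INR k). lra.
Qed.

Lemma Iw_jpoly c nu k : (-1 / 2 < nu)%R -> ~ nonpos_int (2 * c - 1) ->
  Iw nu (jpoly c (2 * k)) (jratio c nu k * wint nu) /\ Iw nu (jpoly c (2 * k + 1)) 0.
Proof.
  intros Hn Hg. pose proof (double_nonpole c Hg) as Hc.
  pose proof (nonpos_int_neq c 0 Hc) as c0. simpl INR in c0. rewrite Cplus_0_r in c0.
  assert (STEP : forall m l, Iw nu (jpoly c m) l ->
    Iw nu (jpoly c (S (S m))) ((INR m - 1 + 2 * c - 2 * nu) / ((INR m + 2) * (INR m + 2 + 2 * nu) * (2 * c + INR m) * (c + INR m + 1) * (c + INR m)) * l)).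
  { intros m l H. pose proof (Iw_parts nu (jpoly c (S m)) _ Hn (fun x => cder_jpoly_raw c (S m) x)) as IP.
    assert (CD : cdiff (fun x => 1 / 2 * (jacp (hshift (hnorm c)) (hnorm c) (S m) (RtoC ((x - 1) / 2)) (RtoC ((x + 1) / 2))
          + jacp (hnorm c) (hshift (hnorm c)) (S m) (RtoC ((x - 1) / 2)) (RtoC ((x + 1) / 2))))).
    { intros x. destruct (cdiff_jpoly (c + 1) m x) as [d Hd].
      exists ((2 * c + INR m) / (2 * (c * c)) * d).
      eapply cder_ext; [|apply cder_scal; exact Hd]. intros u. cbv beta.
      apply (cder_unique (jpoly c (S m)) u); [now apply cder_jpoly|apply cder_jpoly_raw]. }
    specialize (IP CD).
    pose proof (nonpos_int_neq c m Hc) as N1. pose proof (nonpos_int_neq c (S m) Hc) as N2. rewrite RtoC_S in N2.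
    pose proof (nonpos_int_neq _ (S m) Hg) as N3. rewrite RtoC_S in N3.
    assert (N4 : RtoC (INR m) + 2 <> 0) by (rewrite <- RtoC_plus; apply RtoC_neq; pose proof (pos_INR m); lra).
    assert (N5 : RtoC (INR m) + 2 + 2 * nu <> 0).
    { rewrite <- !RtoC_mult, <- !RtoC_plus. apply RtoC_neq. pose proof (pos_INR m). lra. }
    assert (N3' : 2 * c + INR m <> 0) by (intros E; apply N3; rewrite <- E; ring).
    assert (N2' : c + INR m + 1 <> 0) by (intros E; apply N2; rewrite <- E; ring).
    set (den := (INR m + 2) * (INR m + 2 + 2 * nu) * (2 * c + INR m) * (c + INR m + 1) * (c + INR m)).
    assert (Nd : den <> 0) by (unfold den; repeat apply Cmult_neq_0; auto).
    eapply Iw_eq; [|eapply Iw_ext; [|exact (Iw_minus _ _ _ _ _ (Iw_scal _ ((INR m - 1 + 2 * c - 2 * nu) / den) _ _ H)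
       (Iw_scal _ ((2 * INR (S m) + 2 * c - 1) * (c + INR (S m) - 1) / den) _ _ IP))]].
    - ring.
    - intros x Hx. cbv beta. pose proof (jpoly_contig c nu m x Hc) as JC. cbv zeta in JC.
      set (br := (1 - RtoC x * RtoC x) * _ - _) in *.
      replace ((2 * INR (S m) + 2 * c - 1) * (c + INR (S m) - 1) / den * br) with ((2 * INR (S m) + 2 * c - 1) * (c + INR (S m) - 1) * br / den) by (field; auto).
      rewrite JC.
      replace ((INR (S m) + 1) * (INR (S m) + 1 + 2 * nu) * (2 * c - 1 + INR (S m)) * (c + INR (S m)) * (c + INR (S m) - 1)) with den
        by (unfold den; rewrite RtoC_S; ring).
      rewrite RtoC_S. field. auto. }
  induction k as [|k [IH1 IH2]].
  - split.
    + eapply Iw_eq; [|eapply Iw_ext; [|apply (Iw_scal nu 1 (fun _ => 1) (wint nu))]].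
      * simpl. ring.
      * intros x _. unfold jpoly, jac, hnorm. simpl. field.
      * split; simpl. eapply Iopen_ext; [|exact (Iopen_wint nu Hn)]. intros; ring.
        assert (Z0 := Iopen_scal 0 _ _ (Iopen_wint nu Hn)). rewrite Rmult_0_l in Z0. eapply Iopen_ext; [|exact Z0]. intros; cbv beta; ring.
    + pose proof (Iw_parts nu (fun _ => 1) (fun _ => 0) Hn (fun x => cder_const 1 x) (cdiff_const 0)) as IP.
      assert (N : RtoC (2 * nu + 1) <> 0) by (apply RtoC_neq; lra).
      eapply Iw_eq; [|eapply Iw_ext; [|apply (Iw_scal nu (- / (RtoC (2 * nu + 1) * c)) _ _ IP)]].
      * ring.
      * intros x _. cbv beta. unfold jpoly, jac, hnorm. simpl. rewrite !RtoC_div, RtoC_minus, (RtoC_plus x) by lra. field. auto.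
  - replace (2 * S k)%nat with (S (S (2 * k))) by lia. replace (S (S (2 * k)) + 1)%nat with (S (S (2 * k + 1))) by lia. split.
    + eapply Iw_eq; [|apply STEP; exact IH1]. cbn [jratio].
      pose proof (nonpos_int_neq c k Hc) as N0. pose proof (nonpos_int_neq c (2 * k) Hc) as N1. pose proof (nonpos_int_neq c (S (2 * k)) Hc) as N2. rewrite RtoC_S in N2.
      assert (N2' : c + INR (2 * k) + 1 <> 0) by (intros E; apply N2; rewrite <- E; ring).
      pose proof (nu_pos_neq nu k Hn). pose proof (INR_S_neq k).
      assert (E : RtoC (INR (2 * k)) = 2 * INR k) by (rewrite mult_INR, RtoC_mult; reflexivity).
      rewrite E in *.
      replace (2 * INR k + 2) with (2 * (INR k + 1)) by ring.
      replace (2 * (INR k + 1) + 2 * nu) with (2 * (INR k + 1 + nu)) by ring.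
      replace (2 * c + 2 * INR k) with (2 * (c + INR k)) by ring.
      field. repeat split; auto.
    + eapply Iw_eq; [|apply STEP; exact IH2]. ring.
Qed.

(** Integration by parts moves one degree from the Gegenbauer polynomial to the
    parameters. *)
Fixpoint zratio (n N : nat) (c : C) (nu : R) : C :=
  match n, N with
  | O, _ => if Nat.even N then jratio c nu (Nat.div2 N) else 0
  | S _, O => 0
  | S n, S N => (2 * c + INR N) / (2 * (c * c) * (2 * nu + 1)) * zratio n N (c + 1) (nu + 1)
  end.

Lemma Iw_jpoly_gpoly n : forall N c nu, (-1 / 2 < nu)%R -> ~ nonpos_int (2 * c - 1) ->
  Iw nu (fun x => jpoly c N x * gpoly n nu x) (zratio n N c nu * wint (nu + INR n)).
Proof.
  induction n as [|n IH]; intros N c nu Hn Hg.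
  - eapply Iw_ext with (f := jpoly c N).
    { intros x _. unfold gpoly, gcoef. simpl. field. }
    simpl INR. rewrite Rplus_0_r. unfold zratio.
    destruct (Nat.even N) eqn:EV.
    + apply Nat.even_spec in EV. destruct EV as [k ->]. rewrite Nat.div2_double. exact (proj1 (Iw_jpoly c nu k Hn Hg)).
    + assert (OD : Nat.odd N = true) by (unfold Nat.odd; now rewrite EV).
      apply Nat.odd_spec in OD. destruct OD as [k ->]. replace (0 * wint nu) with (RtoC 0) by ring. exact (proj2 (Iw_jpoly c nu k Hn Hg)).
  - pose proof (double_nonpole c Hg) as Hc.
    pose proof (nonpos_int_neq c 0 Hc) as c0. simpl INR in c0. rewrite Cplus_0_r in c0.
    assert (N2 : 2 * RtoC nu + 1 <> 0). { rewrite <- RtoC_mult, <- RtoC_plus. apply RtoC_neq. lra. }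
    assert (En : (nu + INR (S n) = nu + 1 + INR n)%R) by (rewrite S_INR; ring). rewrite En.
    assert (H21 : RtoC (2 * nu + 1) = 2 * nu + 1) by (rewrite RtoC_plus, RtoC_mult; reflexivity).
    assert (PARTS : forall dJ, (forall x, cder (jpoly c N) x (dJ x)) -> cdiff dJ ->
       Iw nu (fun x => (1 - RtoC x * RtoC x) * (dJ x * gpoly n (nu + 1) x) - (2 * nu + 1) * (jpoly c N x * gpoly (S n) nu x)) 0).
    { intros dJ HJ HJ'. eapply Iw_ext; [|apply (Iw_parts nu (fun x => jpoly c N x * gpoly n (nu + 1) x)
        (fun x => dJ x * gpoly n (nu + 1) x + jpoly c N x * gpoly' n (nu + 1) x) Hn)].
      - intros x _. cbv beta. pose proof (gpoly_rodrigues n nu x Hn) as RD. rewrite H21 in RD. rewrite H21.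
        transitivity ((1 - RtoC x * RtoC x) * (dJ x * gpoly n (nu + 1) x) + jpoly c N x * ((1 - RtoC x * RtoC x) * gpoly' n (nu + 1) x - (2 * nu + 1) * RtoC x * gpoly n (nu + 1) x)); [ring|].
        rewrite RD. ring.
      - intros x. apply cder_mult; [apply HJ|apply cder_gpoly].
      - apply cdiff_plus; [apply (cdiff_mult dJ); [exact HJ'|apply cdiff_gpoly]|apply (cdiff_mult (jpoly c N)); [apply cdiff_jpoly|apply cdiff_gpoly']]. }
    destruct N as [|N].
    + assert (D0 : forall x, cder (jpoly c 0) x 0).
      { intros x. eapply cder_ext; [|apply (cder_const 1)]. intros u. unfold jpoly, jac, hnorm. simpl. field. }
      eapply Iw_eq; [|eapply Iw_ext; [|apply (Iw_scal nu (- / (2 * nu + 1)) _ _ (PARTS (fun _ => 0) D0 (cdiff_const 0)))]].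
      * simpl. ring.
      * intros x _. cbv beta. field. auto.
    + set (kp := (2 * c + INR N) / (2 * (c * c))).
      assert (CD : cdiff (fun x => kp * jpoly (c + 1) N x)) by (apply (cdiff_mult (fun _ => kp)); [apply cdiff_const|apply cdiff_jpoly]).
      pose proof (PARTS (fun x => kp * jpoly (c + 1) N x) (fun x => cder_jpoly c N x Hc) CD) as P.
      assert (Hg' : ~ nonpos_int (2 * (c + 1) - 1)).
      { intros HH. apply (nonpos_int_shift _ (nonpos_int_shift _ Hg)). replace (2 * c - 1 + 1 + 1) with (2 * (c + 1) - 1) by ring. exact HH. }
      destruct (IH N (c + 1) (nu + 1)%R ltac:(lra) Hg') as [Q1 Q2].
      assert (Q : Iw nu (fun x => (1 - RtoC x * RtoC x) * (jpoly (c + 1) N x * gpoly n (nu + 1) x)) (zratio n N (c + 1) (nu + 1) * wint (nu + 1 + INR n))).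
      { split; (eapply Iopen_ext; [|eassumption]); intros x Hx; cbv beta; rewrite wt_S by auto; simpl; unfold Re, Im; ring. }
      eapply Iw_eq; [|eapply Iw_ext; [|exact (Iw_minus _ _ _ _ _ (Iw_scal nu (kp / (2 * nu + 1)) _ _ Q) (Iw_scal nu (/ (2 * nu + 1)) _ _ P))]].
      * cbn [zratio]. unfold kp. field. auto.
      * intros x _. cbv beta. field. auto.
Qed.

Lemma jratio_closed c nu k : (-1 / 2 < nu)%R -> ~ nonpos_int c ->
  jratio c nu k = poch (c - 1 / 2 - nu) k / (4 ^ k * INR (fact k) * poch (nu + 1) k * poch c k * poch c (2 * k)).
Proof.
  intros Hn Hc. induction k as [|k IH].
  - simpl. field.
  - cbn [jratio]. rewrite IH. replace (2 * S k)%nat with (S (S (2 * k))) by lia.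
    rewrite !poch_S, fact_simpl, (mult_INR (S k) (fact k)), RtoC_mult, !RtoC_S, Cpow_S.
    pose proof (nonpos_int_neq c k Hc) as N0. pose proof (nonpos_int_neq c (2 * k) Hc) as N1. pose proof (nonpos_int_neq c (S (2 * k)) Hc) as N2. rewrite RtoC_S in N2.
    assert (N2' : c + INR (2 * k) + 1 <> 0) by (intros E; apply N2; rewrite <- E; ring).
    pose proof (nu_pos_neq nu k Hn) as N3. pose proof (INR_S_neq k). pose proof (fact_neq k).
    pose proof (poch_nonpole c k Hc). pose proof (poch_nonpole c (2 * k) Hc).
    assert (Hn1 : ~ nonpos_int (RtoC nu + 1)). { apply Re_not_nonpos_int. simpl. lra. }
    pose proof (poch_nonpole _ k Hn1).
    assert (N4 : RtoC nu + 1 + INR k <> 0) by (intros E; apply N3; rewrite <- E; ring).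
    assert (N5 : (RtoC 4) ^ k <> 0). { rewrite <- RtoC_pow. apply RtoC_neq. apply pow_nonzero. lra. }
    set (q4 := RtoC 4 ^ k) in *.
    replace (RtoC nu + 1 + INR k) with (INR k + 1 + nu) by ring.
    replace (c - 1 / 2 - RtoC nu + INR k) with (INR k + (c - 1 / 2 - nu)) by ring.
    replace (c + (INR (2 * k) + 1)) with (c + INR (2 * k) + 1) by ring.
    set (X := poch (c - 1 / 2 - RtoC nu) k). set (w := INR k + (c - 1 / 2 - nu)).
    field. repeat split; auto.
Qed.

Lemma zratio_closed n : forall k c nu, (-1 / 2 < nu)%R -> ~ nonpos_int c ->
  zratio n (n + 2 * k) c nu = poch (2 * c - 1 + INR (n + 2 * k)) n / (4 ^ n * poch (nu + 1 / 2) n * (poch c n * poch c n))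
    * jratio (c + INR n) (nu + INR n) k.
Proof.
  induction n as [|n IH]; intros k c nu Hn Hc.
  - cbn [Nat.add]. unfold zratio.
    assert (EV : Nat.even (2 * k) = true) by (apply Nat.even_spec; now exists k).
    rewrite EV, Nat.div2_double. simpl poch. simpl (INR 0). rewrite Rplus_0_r, Cplus_0_r. simpl. field.
  - cbn [Nat.add zratio]. rewrite IH by (try lra; now apply nonpos_int_shift).
    replace (c + 1 + INR n) with (c + INR (S n)) by (rewrite RtoC_S; ring).
    replace (nu + 1 + INR n)%R with (nu + INR (S n))%R by (rewrite S_INR; ring).
    rewrite (poch_S_l (2 * c - 1 + INR (S (n + 2 * k)))), (poch_S_l (RtoC nu + 1 / 2)), (poch_S_l c), RtoC_add1.
    replace (2 * (c + 1) - 1 + INR (n + 2 * k)) with (2 * c - 1 + INR (S (n + 2 * k)) + 1) by (rewrite RtoC_S; ring).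
    replace (RtoC nu + 1 + 1 / 2) with (RtoC nu + 1 / 2 + 1) by ring.
    replace (2 * c - 1 + INR (S (n + 2 * k))) with (2 * c + INR (n + 2 * k)) by (rewrite RtoC_S; ring).
    rewrite Cpow_S. pose proof (half_nonpole nu Hn) as N1.
    pose proof (poch_nonpole _ n (nonpos_int_shift _ N1)). pose proof (poch_nonpole _ n (nonpos_int_shift _ Hc)).
    pose proof (nonpos_int_neq c 0 Hc) as c0. simpl INR in c0. rewrite Cplus_0_r in c0.
    pose proof (nonpos_int_neq _ 0 N1) as n0. simpl INR in n0. rewrite Cplus_0_r in n0.
    assert (N5 : (RtoC 4) ^ n <> 0). { rewrite <- RtoC_pow. apply RtoC_neq. apply pow_nonzero. lra. }
    set (q4 := RtoC 4 ^ n) in *. set (J := jratio _ _ _). set (P := poch (2 * c + INR (n + 2 * k) + 1) n).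
    set (P1 := poch (RtoC nu + 1 / 2 + 1) n) in *. set (P2 := poch (c + 1) n) in *.
    set (g := RtoC nu + 1 / 2) in *. assert (Eg : 2 * RtoC nu + 1 = 2 * g) by (unfold g; field). rewrite Eg.
    field. repeat split; auto.
Qed.

Lemma zratio_zero n : forall N c nu, (forall k, N <> (n + 2 * k)%nat) -> zratio n N c nu = 0.
Proof.
  induction n as [|n IH]; intros N c nu H.
  - unfold zratio. destruct (Nat.even N) eqn:EV; auto. apply Nat.even_spec in EV. destruct EV as [k E]. now apply (H k) in E.
  - destruct N as [|N]; cbn [zratio]; auto. rewrite IH. ring. intros k E. apply (H k). lia.
Qed.

(** * The total mass of the weight *)

Lemma wint_pos nu : (-1 / 2 < nu)%R -> (0 <= wint nu)%R.
Proof.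
  intros Hn. pose proof (Rabs_pos 0).
  assert (Rabs 0 <= wint nu)%R; [|lra].
  apply (Iopen_le (fun x => 0 * wt nu x)%R (wt nu)).
  - intros x Hx. rewrite Rmult_0_l, Rabs_R0. left; apply wt_pos.
  - pose proof (Iopen_scal 0 _ _ (Iopen_wint nu Hn)) as Z. rewrite Rmult_0_l in Z. exact Z.
  - now apply Iopen_wint.
Qed.

Lemma wint_poch nu m : (-1 / 2 < nu)%R ->
  RtoC (wint nu) * poch (nu + 1 / 2) m = poch (nu + 1) m * RtoC (wint (nu + INR m)).
Proof.
  intros Hn. induction m as [|m IH].
  - simpl. rewrite Rplus_0_r. ring.
  - rewrite !poch_S, Cmult_assoc, IH. pose proof (pos_INR m) as Pm.
    pose proof (wint_rec (nu + INR m) ltac:(lra)) as R. apply (f_equal RtoC) in R. rewrite !RtoC_mult in R.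
    replace (nu + INR (S m))%R with (nu + INR m + 1)%R by (rewrite S_INR; ring).
    replace (RtoC (2 * (nu + INR m) + 1)) with (2 * (nu + 1 / 2 + INR m)) in R by (rewrite RtoC_plus, RtoC_mult, RtoC_plus; field).
    replace (RtoC (2 * (nu + INR m) + 2)) with (2 * (nu + 1 + INR m)) in R by (rewrite RtoC_plus, RtoC_mult, RtoC_plus; field).
    transitivity (poch (nu + 1) m * (2 * (nu + 1 / 2 + INR m) * RtoC (wint (nu + INR m))) / 2); [field|]. rewrite R. field.
Qed.

(** The Wallis product: consecutive half-integral values telescope. *)
Lemma wint_half_product m : (wint (INR m / 2) * wint (INR m / 2 + 1 / 2) * (INR m / 2 + 1 / 2) = PI)%R.
Proof.
  induction m as [|m IH].
  - simpl. replace (0 / 2)%R with 0%R by field. rewrite Rplus_0_l, wint_0, wint_half. field.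
  - pose proof (pos_INR m). pose proof (wint_rec (INR m / 2) ltac:(lra)) as R. rewrite S_INR.
    replace ((INR m + 1) / 2)%R with (INR m / 2 + 1 / 2)%R by field.
    replace (INR m / 2 + 1 / 2 + 1 / 2)%R with (INR m / 2 + 1)%R by field.
    rewrite <- IH. transitivity (wint (INR m / 2 + 1 / 2) * ((2 * (INR m / 2) + 2) * wint (INR m / 2 + 1)) / 2)%R; [field|].
    rewrite <- R. field.
Qed.

Lemma wint_nat_bounds n : (PI / (INR (S n) + 1 / 2) <= wint (INR (S n)) ^ 2 <= PI / INR (S n))%R.
Proof.
  pose proof (pos_INR n) as Pn. pose proof (wint_half_product (2 * S n)) as H1. pose proof (wint_half_product (2 * n + 1)) as H2.
  replace (INR (2 * S n) / 2)%R with (INR (S n)) in H1 by (rewrite mult_INR; simpl (INR 2); field).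
  replace (INR (2 * n + 1) / 2)%R with (INR (S n) - 1 / 2)%R in H2 by (rewrite plus_INR, mult_INR, S_INR; simpl (INR 2); simpl (INR 1); field).
  replace (INR (S n) - 1 / 2 + 1 / 2)%R with (INR (S n)) in H2 by ring. rewrite S_INR in *.
  pose proof (wint_pos (INR n + 1) ltac:(lra)) as P0.
  pose proof (wint_mono (INR n + 1) (INR n + 1 + 1 / 2) ltac:(lra) ltac:(lra)) as M1.
  pose proof (wint_mono (INR n + 1 - 1 / 2) (INR n + 1) ltac:(lra) ltac:(lra)) as M2.
  split.
  - rewrite <- H1. unfold Rdiv. rewrite Rmult_assoc, Rinv_r by lra. rewrite Rmult_1_r. simpl. rewrite Rmult_1_r.
    apply Rmult_le_compat_l; auto.
  - rewrite <- H2. unfold Rdiv. rewrite Rmult_assoc, Rinv_r by lra. rewrite Rmult_1_r. simpl. rewrite Rmult_1_r.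
    apply Rmult_le_compat_r; auto.
Qed.

(** Monotonicity compares [nu + n] with the neighbouring integers. *)
Lemma wint_asymptotic nu : (-1 / 2 < nu)%R -> is_lim_seq (fun n => sqrt (INR (S n)) * wint (nu + INR (S (S n))))%R (sqrt PI).
Proof.
  intros Hn. destruct (ratio_eventually 0 nu 2 ltac:(lra)) as [j Hj]. destruct (Hj j (le_n _)) as [_ Hj'].
  pose proof PI_RGT_0 as PP.
  assert (EQ : forall n, (sqrt (INR (S n)) * wint (nu + INR (S (S n))) = sqrt (INR (S n) * wint (nu + INR (S (S n))) ^ 2))%R).
  { intros n. pose proof (pos_INR n). rewrite sqrt_mult_alt by (rewrite S_INR; lra). f_equal. symmetry. apply sqrt_pow2.
    apply wint_pos. rewrite !S_INR. lra. }
  apply (is_lim_seq_ext (fun n => sqrt (INR (S n) * wint (nu + INR (S (S n))) ^ 2))). { intros n. now rewrite EQ. }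
  apply (is_lim_seq_continuous sqrt). { apply continuity_pt_sqrt. lra. }
  set (b := (INR j + 3 / 2)%R).
  apply (is_lim_seq_le_le (fun n => PI * (1 - b * / (INR (S n) + b)))%R _ (fun _ => PI)).
  - intros n. pose proof (pos_INR n) as Pn. pose proof (pos_INR j) as Pj.
    assert (U0 : (0 <= wint (nu + INR (S (S n))))%R) by (apply wint_pos; rewrite !S_INR; lra).
    assert (U1 : (wint (nu + INR (S (S n))) <= wint (INR (S n)))%R) by (apply wint_mono; rewrite ?S_INR; lra).
    assert (U2 : (wint (INR (S (S n + j))) <= wint (nu + INR (S (S n))))%R).
    { apply wint_mono; rewrite ?S_INR, ?plus_INR, ?S_INR; lra. }
    pose proof (wint_nat_bounds n) as [_ B1]. pose proof (wint_nat_bounds (S n + j)) as [B2 _].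
    assert (V1 : (wint (nu + INR (S (S n))) ^ 2 <= PI / INR (S n))%R).
    { eapply Rle_trans; [|exact B1]. apply pow_incr. auto. }
    assert (V2 : (PI / (INR (S (S n + j)) + 1 / 2) <= wint (nu + INR (S (S n))) ^ 2)%R).
    { eapply Rle_trans; [exact B2|]. apply pow_incr. split; auto. apply wint_pos. rewrite S_INR, plus_INR, S_INR. lra. }
    assert (Sp : (0 < INR (S n))%R) by (rewrite S_INR; lra).
    split.
    + apply Rle_trans with (INR (S n) * (PI / (INR (S (S n + j)) + 1 / 2)))%R; [|apply Rmult_le_compat_l; lra].
      right. unfold b. rewrite (S_INR (S n + j)), plus_INR. field. repeat split; lra.
    + apply Rle_trans with (INR (S n) * (PI / INR (S n)))%R; [apply Rmult_le_compat_l; lra|]. right. field. lra.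
  - replace (Finite PI) with (Finite (PI * (1 - b * 0))%R) by (f_equal; ring).
    apply is_lim_seq_mult'; [apply is_lim_seq_const|]. apply is_lim_seq_minus'; [apply is_lim_seq_const|].
    apply is_lim_seq_mult'; [apply is_lim_seq_const|].
    apply (is_lim_seq_incr_1 (fun n => / (INR n + b))%R). apply (is_lim_seq_inv (fun n => INR n + b)%R p_infty); [|discriminate].
    apply (is_lim_seq_plus _ _ p_infty b); [apply is_lim_seq_INR|apply is_lim_seq_const|reflexivity].
  - apply is_lim_seq_const.
Qed.

Lemma cvg_RtoC (u : nat -> R) (l : R) : is_lim_seq u l -> cvg (fun n => RtoC (u n)) (RtoC l).
Proof. intros H. apply cvg_ReIm. split; simpl; auto. apply is_lim_seq_const. Qed.

(** Iterating the recurrence of [wint] produces the quotient of Gauss's products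
    at [nu + 1/2] and [nu + 1]; the asymptotics fix the constant. *)
Lemma wint_rgamma nu : (-1 / 2 < nu)%R ->
  RtoC (wint nu) * rgamma (nu + 1 / 2) = RtoC (sqrt PI) * rgamma (nu + 1).
Proof.
  intros Hn. apply cvg_unique with (fun n => RtoC (wint nu) * rgauss (nu + 1 / 2) (S n)).
  - apply cvg_scal. pose proof (cvg_shift _ _ 1 (rgamma_cvg (nu + 1 / 2))) as L. eapply cvg_ext; [|exact L].
    intros n. cbv beta. now rewrite Nat.add_1_r.
  - pose proof (cvg_shift _ _ 1 (rgamma_cvg (nu + 1))) as L.
    pose proof (cvg_mult _ _ _ _ (cvg_RtoC _ _ (wint_asymptotic nu Hn)) L) as P.
    eapply cvg_ext; [|exact P]. intros n. cbv beta. rewrite Nat.add_1_r. unfold rgauss.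
    assert (Sp : (0 < INR (S n))%R) by (apply lt_0_INR; lia).
    pose proof (wint_poch nu (S (S n)) Hn) as WP.
    replace (RtoC nu + 1) with (RtoC nu + 1 / 2 + RtoC (/ 2)) at 2 by (rewrite RtoC_inv by lra; field).
    set (g := RtoC nu + 1 / 2) in *. unfold Cdiv. rewrite (Cmult_assoc (RtoC (wint nu))), WP.
    rewrite (Cpower_plus (INR (S n)) g) by auto. rewrite Cpower_real, Rpower_sqrt by auto.
    rewrite RtoC_mult. pose proof (Cpower_neq_0 (INR (S n)) g Sp). pose proof (fact_neq (S n)).
    assert (RtoC (sqrt (INR (S n))) <> 0). { apply RtoC_neq. pose proof (sqrt_lt_R0 _ Sp). lra. }
    field. auto.
Qed.

(** * The integrand without its algebraic singularities *)

Lemma hreg_sym a b c w : hreg a b c w = hreg b a c w.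
Proof.
  unfold hreg. f_equal. apply FunctionalExtensionality.functional_extensionality. intros k. unfold hcoef. unfold Cdiv. ring.
Qed.

Definition rad (rho x : R) : R := sqrt (1 + rho ^ 2 - 2 * rho * x).
Definition svar (rho x : R) : R := ((1 - (rad rho x + rho)) / 2)%R.
Definition tvar (rho x : R) : R := ((1 - (rad rho x - rho)) / 2)%R.

Lemma rad_bounds rho x : (0 < rho < 1)%R -> (-1 < x < 1)%R ->
  (1 - rho < rad rho x < 1 + rho)%R /\ (rad rho x * rad rho x = 1 + rho ^ 2 - 2 * rho * x)%R.
Proof.
  intros Hr Hx. assert (P : (0 <= 1 + rho ^ 2 - 2 * rho * x)%R) by nra.
  assert (E : (rad rho x * rad rho x = 1 + rho ^ 2 - 2 * rho * x)%R) by (apply sqrt_sqrt; auto).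
  assert (R0 : (0 <= rad rho x)%R) by apply sqrt_pos. split; auto. split; nra.
Qed.

Lemma stvar_bounds rho x : (0 < rho < 1)%R -> (-1 < x < 1)%R ->
  (- rho < svar rho x < 0)%R /\ (0 < tvar rho x < rho)%R /\ (tvar rho x - svar rho x = rho)%R /\
  (svar rho x * (1 - tvar rho x) = rho * ((x - 1) / 2))%R /\ (tvar rho x * (1 - svar rho x) = rho * ((x + 1) / 2))%R.
Proof.
  intros Hr Hx. destruct (rad_bounds rho x Hr Hx) as [B E]. unfold svar, tvar.
  repeat split; try lra; nra.
Qed.

Definition reduced (alpha : C) (rho : R) (mu : C) (x : R) : C :=
  Cpower (RtoC (rho / 2)) (mu - 1 / 2)
  * hreg alpha (2 * mu - alpha) (mu + 1 / 2) (RtoC (svar rho x))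
  * hreg alpha (2 * mu - alpha) (mu + 1 / 2) (RtoC (tvar rho x)).

Lemma gegenbauer_gpoly n (nu x : R) : (-1 / 2 < nu)%R -> gegenbauer n nu x = poch (2 * nu) n / INR (fact n) * gpoly n nu x.
Proof.
  intros Hn. unfold gegenbauer. f_equal. apply hyp2F1_series.
  eapply cseries_ext; [|apply (cseries_finite (fun k => gcoef n nu k * ((1 - RtoC x) / 2) ^ k) (S n))].
  - intros k. unfold gcoef, pFq_term, pochs; simpl. pose proof (poch_nonpole _ k (half_nonpole nu Hn)). pose proof (fact_neq k).
    field. auto.
  - intros k Hk. unfold gcoef. rewrite poch_nonpos_zero by lia. unfold Cdiv. ring.
Qed.

(** After Euler's transformation of both factors all powers combine, because
    [(z^2 - 1) (1 - y^2) = 4 rho^2 (1 - x^2)] for [z = R + rho], [y = R - rho]. *)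
Lemma integrand_reduced n alpha mu nu rho x : (-1 / 2 < nu)%R -> (0 < rho < 1)%R -> (-1 < x < 1)%R ->
  integrand n alpha mu nu rho x = RtoC (wt nu x) * (reduced alpha rho mu x * (poch (2 * nu) n / INR (fact n) * gpoly n nu x)).
Proof.
  intros Hn Hr Hx. destruct (rad_bounds rho x Hr Hx) as [B E]. destruct (stvar_bounds rho x Hr Hx) as [Bs [Bt _]].
  unfold integrand. cbv zeta. fold (rad rho x). set (r := rad rho x) in *.
  rewrite gegenbauer_gpoly by auto. unfold legendreP, ferrersP.
  replace ((1 - (RtoC r + RtoC rho)) / 2) with (RtoC (svar rho x)).
  2:{ unfold svar. fold r. rewrite RtoC_div, RtoC_minus, RtoC_plus by lra. reflexivity. }
  replace ((1 - RtoC (r - rho)) / 2) with (RtoC (tvar rho x)).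
  2:{ unfold tvar. fold r. rewrite RtoC_div, !RtoC_minus by lra. reflexivity. }
  set (s := svar rho x) in *. set (t := tvar rho x) in *.
  rewrite !reg_hyp2F1_hreg by (rewrite Cmod_R; apply Rabs_lt_between; lra).
  replace (- (mu - alpha - 1 / 2)) with (alpha + 1 / 2 - mu) by ring.
  replace (mu - alpha - 1 / 2 + 1) with (mu - alpha + 1 / 2) by field.
  replace (1 - (1 / 2 - mu)) with (mu + 1 / 2) by field.
  rewrite (hreg_euler (alpha + 1 / 2 - mu) _ _ s), (hreg_euler (alpha + 1 / 2 - mu) _ _ t) by (apply Rabs_lt_between; lra).
  replace (mu + 1 / 2 - (alpha + 1 / 2 - mu)) with (2 * mu - alpha) by ring.
  replace (mu + 1 / 2 - (mu - alpha + 1 / 2)) with alpha by ring.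
  replace (2 * mu - alpha - (mu - alpha + 1 / 2)) with (mu - 1 / 2) by ring.
  rewrite !(hreg_sym (2 * mu - alpha) alpha).
  unfold reduced. fold s t. set (Fs := hreg _ _ _ (RtoC s)). set (Ft := hreg _ _ _ (RtoC t)). set (G := poch (2 * nu) n / INR (fact n) * gpoly n nu x).
  (* all bases are positive, so the identity is one between their logarithms *)
  assert (Pw : Cpower (RtoC (1 - x ^ 2)) (nu - mu / 2 - 1 / 4) * Cpower ((RtoC r + RtoC rho + 1) / (RtoC r + RtoC rho - 1)) ((1 / 2 - mu) / 2)
     * Cpower ((1 + RtoC (r - rho)) / (1 - RtoC (r - rho))) ((1 / 2 - mu) / 2) * Cpower (RtoC (1 - s)) (mu - 1 / 2) * Cpower (RtoC (1 - t)) (mu - 1 / 2)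
     = RtoC (wt nu x) * Cpower (RtoC (rho / 2)) (mu - 1 / 2)).
  { assert (X1 : (0 < 1 - x ^ 2)%R) by now apply one_sub_sq_pos.
    replace ((RtoC r + RtoC rho + 1) / (RtoC r + RtoC rho - 1)) with (RtoC ((r + rho + 1) / (r + rho - 1))).
    2:{ rewrite RtoC_div, RtoC_minus, !RtoC_plus by lra. reflexivity. }
    replace ((1 + RtoC (r - rho)) / (1 - RtoC (r - rho))) with (RtoC ((1 + (r - rho)) / (1 - (r - rho)))).
    2:{ rewrite RtoC_div by lra. rewrite (RtoC_plus 1), (RtoC_minus 1). reflexivity. }
    assert (W : RtoC (wt nu x) = Cpower (RtoC (1 - x ^ 2)) (RtoC (nu - 1 / 2))) by (rewrite Cpower_real; auto).
    rewrite W. rewrite !Cpower_pos by (try lra; apply Rdiv_lt_0_compat; lra). rewrite <- !Cexp_plus. f_equal.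
    rewrite !ln_div by lra.
    assert (L : (ln (r + rho + 1) + ln (r + rho - 1) + ln (1 + (r - rho)) + ln (1 - (r - rho)) = 2 * ln 2 + 2 * ln rho + ln (1 - x ^ 2))%R).
    { rewrite <- !ln_mult by (repeat apply Rmult_lt_0_compat; lra).
      replace (2 * ln 2 + 2 * ln rho + ln (1 - x ^ 2))%R with (ln 2 + ln 2 + (ln rho + ln rho) + ln (1 - x ^ 2))%R by ring.
      rewrite <- !ln_mult by (repeat apply Rmult_lt_0_compat; lra). f_equal.
      replace ((r + rho + 1) * (r + rho - 1) * (1 + (r - rho)) * (1 - (r - rho)))%R with
        (2 * (r * r) * (1 + rho ^ 2) - (r * r) * (r * r) - (1 - rho ^ 2) ^ 2)%R by ring. rewrite E. ring. }
    replace (1 - s)%R with ((r + rho + 1) / 2)%R by (unfold s, svar; fold r; field).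
    replace (1 - t)%R with ((1 + (r - rho)) / 2)%R by (unfold t, tvar; fold r; field).
    rewrite !ln_div by lra.
    set (l1 := ln (r + rho + 1)) in *. set (l2 := ln (r + rho - 1)) in *. set (l3 := ln (1 + (r - rho))) in *. set (l4 := ln (1 - (r - rho))) in *.
    assert (E4 : l4 = (2 * ln 2 + 2 * ln rho + ln (1 - x ^ 2) - l1 - l2 - l3)%R) by lra.
    rewrite E4. rewrite !RtoC_minus, !RtoC_plus, !RtoC_mult, RtoC_div by lra. field. }
  transitivity ((Cpower (RtoC (1 - x ^ 2)) (nu - mu / 2 - 1 / 4) * Cpower ((RtoC r + RtoC rho + 1) / (RtoC r + RtoC rho - 1)) ((1 / 2 - mu) / 2)
     * Cpower ((1 + RtoC (r - rho)) / (1 - RtoC (r - rho))) ((1 / 2 - mu) / 2) * Cpower (RtoC (1 - s)) (mu - 1 / 2) * Cpower (RtoC (1 - t)) (mu - 1 / 2)) * Fs * Ft * G); [ring|].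
  rewrite Pw. ring.
Qed.

(** * The integral for generic parameters *)

Lemma ccont_mult f g x : ccont f x -> ccont g x -> ccont (fun x => f x * g x) x.
Proof.
  intros [F1 F2] [G1 G2]. split; simpl.
  - apply (continuous_minus (V := R_NormedModule)); apply (continuous_mult (K := R_AbsRing)); assumption.
  - apply (continuous_plus (V := R_NormedModule)); apply (continuous_mult (K := R_AbsRing)); assumption.
Qed.

Lemma ccont_plus f g x : ccont f x -> ccont g x -> ccont (fun x => f x + g x) x.
Proof.
  intros [F1 F2] [G1 G2]. split; simpl; apply (continuous_plus (V := R_NormedModule)); assumption.
Qed.

Lemma ccont_const k x : ccont (fun _ => k) x.
Proof. split; apply continuous_const. Qed.

Lemma ccont_lip (F : C -> C) L r (g : R -> R) x : (0 <= L)%R ->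
  (forall w w', (Cmod w <= r)%R -> (Cmod w' <= r)%R -> (Cmod (F w - F w') <= L * Cmod (w - w'))%R) ->
  continuous g x -> locally x (fun y => (Rabs (g y) <= r)%R) -> ccont (fun y => F (RtoC (g y))) x.
Proof.
  intros HL HF Hg Hr. pose proof (locally_singleton _ _ Hr) as Hx.
  assert (K : forall e, (0 < e)%R -> locally x (fun y => (Cmod (F (RtoC (g y)) - F (RtoC (g x))) < e)%R)).
  { intros e He. assert (P : (0 < e / (L + 1))%R) by (apply Rdiv_lt_0_compat; lra).
    assert (Q : locally x (fun y => (Rabs (g y - g x) < e / (L + 1))%R)).
    { apply (Hg (fun z => (Rabs (z - g x) < e / (L + 1))%R)). exists (mkposreal _ P). intros z Hz. exact Hz. }
    eapply filter_imp; [|apply (filter_and _ _ Hr Q)]. intros y [Y1 Y2].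
    eapply Rle_lt_trans; [apply HF; rewrite Cmod_R; auto|]. rewrite <- RtoC_minus, Cmod_R.
    apply Rle_lt_trans with ((L + 1) * Rabs (g y - g x))%R. { pose proof (Rabs_pos (g y - g x)). nra. }
    apply Rmult_lt_reg_r with (/ (L + 1))%R; [apply Rinv_0_lt_compat; lra|].
    replace ((L + 1) * Rabs (g y - g x) * / (L + 1))%R with (Rabs (g y - g x)) by (field; lra). exact Y2. }
  split; intros P [e HP]; refine (filter_imp _ _ _ (K e (cond_pos e))); intros y Hy; apply HP.
  - change (Rabs (Re (F (RtoC (g y)) - F (RtoC (g x)))) < e)%R. eapply Rle_lt_trans; [apply re_le_Cmod|exact Hy].
  - change (Rabs (Im (F (RtoC (g y)) - F (RtoC (g x)))) < e)%R. eapply Rle_lt_trans; [apply Cmod_Im_le|exact Hy].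
Qed.

Lemma locally_open_interval x (P : R -> Prop) : (-1 < x < 1)%R -> (forall y, (-1 < y < 1)%R -> P y) -> locally x P.
Proof.
  intros Hx H. assert (Q : (0 < Rmin (1 - x) (x + 1))%R) by (apply Rmin_glb_lt; lra).
  exists (mkposreal _ Q). intros y Hy. change (Rabs (y - x) < Rmin (1 - x) (x + 1))%R in Hy.
  pose proof (Rmin_l (1 - x) (x + 1)). pose proof (Rmin_r (1 - x) (x + 1)).
  apply Rabs_lt_between in Hy. apply H. lra.
Qed.

Lemma stvar_continuous rho x : (0 < rho < 1)%R -> (-1 < x < 1)%R -> continuous (svar rho) x /\ continuous (tvar rho) x.
Proof.
  intros Hr Hx. assert (P : (0 < 1 + rho ^ 2 - 2 * rho * x)%R) by nra.
  split; apply (ex_derive_continuous (V := R_NormedModule)); unfold svar, tvar, rad; auto_derive; simpl in P; lra.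
Qed.

Lemma ccont_stvar (F : C -> C) L rho x : (0 < rho < 1)%R -> (0 <= L)%R ->
  (forall w w', (Cmod w <= rho)%R -> (Cmod w' <= rho)%R -> (Cmod (F w - F w') <= L * Cmod (w - w'))%R) ->
  (-1 < x < 1)%R -> ccont (fun x => F (RtoC (svar rho x))) x /\ ccont (fun x => F (RtoC (tvar rho x))) x.
Proof.
  intros Hr HL HF Hx. destruct (stvar_continuous rho x Hr Hx) as [C1 C2].
  split; apply (ccont_lip F L rho); auto; apply locally_open_interval; auto; intros y Hy;
    destruct (stvar_bounds rho y Hr Hy) as [B1 [B2 _]]; apply Rabs_le; lra.
Qed.

Lemma ccont_reduced alpha rho mu x : (0 < rho < 1)%R -> (-1 < x < 1)%R -> ccont (reduced alpha rho mu) x.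
Proof.
  intros Hr Hx. destruct (hreg_lipschitz alpha (2 * mu - alpha) (mu + 1 / 2) rho ltac:(lra)) as [L [HL H]].
  destruct (ccont_stvar _ L rho x Hr HL H Hx) as [C1 C2].
  unfold reduced. apply ccont_mult; [apply ccont_mult; [apply ccont_const|exact C1]|exact C2].
Qed.

Lemma cseries_tail a l K x n : cseries a l -> (forall k, (Cmod (a k) <= K * x ^ k)%R) -> (0 <= x < 1)%R ->
  (Cmod (csum a n - l) <= K * / (1 - x) * x ^ n)%R.
Proof.
  intros Ha HK Hx. rewrite Cmod_sub_sym.
  destruct (series_dom (fun k => a (n + k)%nat) (fun k => (K * x ^ n) * x ^ k)%R) as [m [Hm HB]].
  - intros k. eapply Rle_trans; [apply HK|]. rewrite pow_add. right; ring.
  - now apply ex_series_geom_scal.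
  - rewrite (cseries_unique _ _ _ (cseries_drop _ _ n Ha) Hm). eapply Rle_trans; [exact HB|].
    rewrite Series_scal_l, Series_geom by (rewrite Rabs_pos_eq; lra). right. ring.
Qed.

Lemma jac_homog h k N (q p r : C) : jac h k N (q * p) (q * r) = q ^ N * jac h k N p r.
Proof.
  unfold jac. rewrite <- csum_scal. apply csum_ext. intros i Hi. rewrite !Cpow_mult_l.
  replace (q ^ N) with (q ^ i * q ^ (N - i)) by (rewrite <- Cpow_add_r; f_equal; lia). ring.
Qed.

Lemma poch_double x k : poch x (2 * k) = 4 ^ k * poch (x / 2) k * poch ((x + 1) / 2) k.
Proof.
  induction k as [|k IH]. simpl. ring.
  replace (2 * S k)%nat with (S (S (2 * k))) by lia. rewrite !poch_S, IH, Cpow_S, RtoC_S, mult_INR, RtoC_mult. change (INR 2) with 2%R. field.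
Qed.

Lemma generic_nonpole mu : ~ nonpos_int (2 * mu) -> ~ nonpos_int mu /\ ~ nonpos_int (mu + 1 / 2).
Proof.
  intros H. split; intros [m Hm]; apply H.
  - exists (2 * m)%nat. rewrite Hm, mult_INR, RtoC_mult. change (INR 2) with 2%R. ring.
  - exists (2 * m + 1)%nat. rewrite plus_INR, mult_INR, RtoC_plus, RtoC_mult. change (INR 2) with 2%R. change (INR 1) with 1%R.
    replace mu with (mu + 1 / 2 - 1 / 2) by ring. rewrite Hm. field.
Qed.

Lemma cseries_every_other (z : nat -> C) l n : cseries z l -> (forall N, (forall k, N <> (n + 2 * k)%nat) -> z N = 0) ->
  cseries (fun k => z (n + 2 * k)%nat) l.
Proof.
  intros Hz H0. assert (E : forall K, csum z (n + 2 * K) = csum (fun k => z (n + 2 * k)%nat) K).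
  { induction K as [|K IH].
    - rewrite Nat.mul_0_r, Nat.add_0_r. apply csum_zero. intros i Hi. apply H0. intros; lia.
    - replace (n + 2 * S K)%nat with (S (S (n + 2 * K))) by lia.
      change (csum z (S (S (n + 2 * K)))) with (csum z (n + 2 * K) + z (n + 2 * K)%nat + z (S (n + 2 * K))).
      rewrite IH, (H0 (S (n + 2 * K))) by (intros; lia).
      change (csum ?f (S K)) with (csum f K + f K). cbv beta. ring. }
  intros eps He. destruct (Hz eps He) as [N HN]. exists N. intros K HK. rewrite <- E. apply HN. lia.
Qed.

(** The product formula converges uniformly in [x], so it may be integrated term
    by term; only the degrees [n + 2k] contribute. *)
Lemma series_integral n (alpha mu : C) (nu rho : R) : (-1 / 2 < nu)%R -> (0 < rho < 1)%R -> ~ nonpos_int (2 * mu) ->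
  let c := mu + 1 / 2 in
  exists l, Iw nu (fun x => hreg alpha (2 * mu - alpha) c (svar rho x) * hreg alpha (2 * mu - alpha) c (tvar rho x) / (rgamma c * rgamma c) * gpoly n nu x) l /\
   cseries (fun k => bcoef alpha (2 * mu - alpha) (n + 2 * k) * RtoC rho ^ (n + 2 * k) * (zratio n (n + 2 * k) c nu * wint (nu + INR n))) l.
Proof.
  intros Hn Hr Hmu c. destruct (generic_nonpole mu Hmu) as [Hm Hc]. fold c in Hc.
  assert (H2c : 2 * c - 1 = 2 * mu) by (unfold c; field).
  assert (Hab : alpha + (2 * mu - alpha) = 2 * c - 1) by (rewrite H2c; ring).
  assert (Hg : ~ nonpos_int (2 * c - 1)) by now rewrite H2c.
  destruct (cdiff_bounded (gpoly n nu) (cdiff_gpoly n nu)) as [M HM].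
  assert (M0 : (0 <= M)%R). { specialize (HM 0%R ltac:(lra)). pose proof (Cmod_ge_0 (gpoly n nu 0)). lra. }
  destruct (hreg_lipschitz alpha (2 * mu - alpha) c rho ltac:(lra)) as [L [HL HLip]].
  set (f := fun x => hreg alpha (2 * mu - alpha) c (svar rho x) * hreg alpha (2 * mu - alpha) c (tvar rho x) / (rgamma c * rgamma c)).
  set (a := fun N x => bcoef alpha (2 * mu - alpha) N * RtoC rho ^ N * jpoly c N x).
  assert (SER : forall x, (-1 < x < 1)%R -> cseries (fun N => a N x) (f x)).
  { intros x Hx. destruct (stvar_bounds rho x Hr Hx) as [B1 [B2 [B3 [B4 B5]]]].
    pose proof (bailey alpha (2 * mu - alpha) c (svar rho x) (tvar rho x) Hab Hc ltac:(lra) ltac:(lra) ltac:(lra)) as X.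
    eapply cseries_ext; [|exact X]. intros N. unfold a, bcoef, jpoly. rewrite B4, B5, !RtoC_mult, jac_homog. ring. }
  destruct (exists_ratio rho ltac:(lra)) as [q [Hq Hqr]].
  destruct (exists_sqrt q ltac:(auto)) as [r [Hr1 Hr2]].
  destruct (bcoef_bound alpha (2 * mu - alpha) r Hr1) as [K1 [HK1 HB1]].
  destruct (jac_bound c c (hnorm c) (hnorm c) r (hseq_hnorm c Hc) (hseq_hnorm c Hc) Hr1) as [K2 [HK2 HB2]].
  assert (TERM : forall N x, (-1 < x < 1)%R -> (Cmod (a N x) <= K1 * K2 * (q * rho) ^ N)%R).
  { intros N x Hx. unfold a. rewrite !Cmod_mult, Cmod_pow, Cmod_RtoC_pos by lra.
    specialize (HB1 N). specialize (HB2 N ((x - 1) / 2)%R ((x + 1) / 2)%R 1%R ltac:(lra) ltac:(lra) ltac:(lra)).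
    rewrite Rmult_1_r in HB2. fold (jpoly c N x) in HB2.
    assert (rh : (0 <= rho ^ N)%R) by (apply pow_le; lra). assert (rN : (0 <= r ^ N)%R) by (apply pow_le; lra).
    apply Rle_trans with (K1 * r ^ N * INR (fact N) ^ 2 * rho ^ N * Cmod (jpoly c N x))%R.
    - apply Rmult_le_compat_r; [apply Cmod_ge_0|]. apply Rmult_le_compat_r; auto.
    - replace (K1 * r ^ N * INR (fact N) ^ 2 * rho ^ N * Cmod (jpoly c N x))%R with (K1 * r ^ N * rho ^ N * (INR (fact N) ^ 2 * Cmod (jpoly c N x)))%R by ring.
      apply Rle_trans with (K1 * r ^ N * rho ^ N * (K2 * r ^ N))%R.
      + apply Rmult_le_compat_l; auto. repeat apply Rmult_le_pos; auto.
      + right. rewrite <- Hr2, !Rpow_mult_distr. ring. }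
  assert (FB : forall x, (-1 < x < 1)%R -> (Cmod (f x) <= K1 * K2 * / (1 - q * rho))%R).
  { intros x Hx. pose proof (cseries_tail _ _ (K1 * K2)%R (q * rho)%R 0 (SER x Hx) (fun N => TERM N x Hx)) as T.
    specialize (T ltac:(split; [apply Rmult_le_pos; lra|auto])). simpl in T. rewrite Rmult_1_r in T.
    rewrite <- Cmod_opp. replace (- f x) with (0 - f x) by ring. exact T. }
  destruct (Iw_ex nu (fun x => f x * gpoly n nu x) (K1 * K2 * / (1 - q * rho) * M)%R Hn) as [l Hl].
  - intros x Hx. destruct (ccont_stvar _ L rho x Hr HL HLip Hx) as [C1 C2].
    apply ccont_mult; [apply (ccont_mult (fun x => hreg _ _ c (svar rho x) * hreg _ _ c (tvar rho x)) (fun _ => / (rgamma c * rgamma c))); [now apply ccont_mult|apply ccont_const]|].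
    apply cdiff_ccont, cdiff_gpoly.
  - intros x Hx. rewrite Cmod_mult. apply Rmult_le_compat; auto using Cmod_ge_0. apply HM. lra.
  - exists l. split; [exact Hl|].
    set (z := fun N => bcoef alpha (2 * mu - alpha) N * RtoC rho ^ N * (zratio n N c nu * wint (nu + INR n))).
    apply (cseries_every_other z l n).
    + apply (Iw_uniform nu (fun m x => csum (fun N => a N x) m * gpoly n nu x) (csum z) (fun x => f x * gpoly n nu x) l
        (fun m => K1 * K2 * / (1 - q * rho) * (q * rho) ^ m * M)%R Hn).
      * intros m. induction m as [|m IH].
        -- eapply Iw_eq; [|eapply Iw_ext; [|exact (Iw_scal nu 0 _ _ Hl)]]. simpl; ring. intros x _. simpl. ring.
        -- eapply Iw_ext; [|exact (Iw_plus _ _ _ _ _ IH (Iw_scal nu (bcoef alpha (2 * mu - alpha) m * RtoC rho ^ m) _ _ (Iw_jpoly_gpoly n m c nu Hn Hg)))].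
           intros x _. simpl csum. unfold a at 3. ring.
      * exact Hl.
      * intros m x Hx. replace (csum (fun N => a N x) m * gpoly n nu x - f x * gpoly n nu x) with ((csum (fun N => a N x) m - f x) * gpoly n nu x) by ring.
        rewrite Cmod_mult. apply Rmult_le_compat; auto using Cmod_ge_0.
        -- apply cseries_tail; auto. split; [apply Rmult_le_pos; lra|auto].
        -- apply HM. lra.
      * assert (LZ : is_lim_seq (fun m => K1 * K2 * / (1 - q * rho) * (q * rho) ^ m * M)%R (K1 * K2 * / (1 - q * rho) * 0 * M)%R).
        2:{ replace (K1 * K2 * / (1 - q * rho) * 0 * M)%R with 0%R in LZ by ring. exact LZ. }
        apply is_lim_seq_mult'; [|apply is_lim_seq_const]. apply is_lim_seq_mult'; [apply is_lim_seq_const|].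
        apply is_lim_seq_geom. rewrite Rabs_pos_eq; [auto|apply Rmult_le_pos; lra].
    + intros N HN. unfold z. rewrite zratio_zero by auto. ring.
Qed.

(** The duplication formula splits every symbol of length [2k] into two of length
    [k]; the powers of 4 cancel. *)
Lemma term_identity n (alpha mu : C) (nu rho : R) k : (-1 / 2 < nu)%R -> ~ nonpos_int (2 * mu) ->
  bcoef alpha (2 * mu - alpha) (n + 2 * k) * RtoC rho ^ (n + 2 * k) * zratio n (n + 2 * k) (mu + 1 / 2) nu
  = poch alpha n * poch (2 * mu - alpha) n * RtoC rho ^ n * poch mu n / (poch (nu + 1 / 2) n * poch (mu + 1 / 2) n * poch (2 * mu) n)
    * pFq_term [ (alpha + INR n) / 2; (alpha + INR n + 1) / 2;
          (2 * mu - alpha + INR n) / 2; (2 * mu - alpha + INR n + 1) / 2;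
          mu + INR n; mu - nu ]
        [ (2 * mu + INR n) / 2; (2 * mu + INR n + 1) / 2;
          (mu + INR n + 1 / 2) / 2; (mu + INR n + 3 / 2) / 2;
          1 + nu + INR n ]
        (RtoC (rho ^ 2)) k.
Proof.
  intros Hn Hmu. destruct (generic_nonpole mu Hmu) as [Hm Hc].
  set (c := mu + 1 / 2) in *. assert (Ec : 2 * c - 1 = 2 * mu) by (unfold c; field).
  rewrite zratio_closed, jratio_closed by (auto; try apply nonpos_int_shiftn; auto; pose proof (pos_INR n); lra).
  rewrite Ec. replace (c + INR n - 1 / 2 - RtoC (nu + INR n)) with (mu - nu) by (unfold c; rewrite RtoC_plus; ring).
  unfold pFq_term, pochs; simpl fold_right. rewrite RtoC_pow, <- Cpow_mult_r, Cpow_add_r.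
  unfold bcoef. rewrite !(poch_add _ n (2 * k)).
  assert (D1 := poch_double (alpha + INR n) k). assert (D2 := poch_double (2 * mu - alpha + INR n) k).
  assert (D3 := poch_double (2 * mu + INR n) k). assert (D4 := poch_double (c + INR n) k).
  replace ((c + INR n) / 2) with ((mu + INR n + 1 / 2) / 2) in D4 by (unfold c; field).
  replace ((c + INR n + 1) / 2) with ((mu + INR n + 3 / 2) / 2) in D4 by (unfold c; field).
  rewrite D1, D2.
  (* (2 mu)_{2(n+k)} split in three, and by duplication *)
  assert (D5 : poch (2 * mu) n * poch (2 * mu + INR n) (2 * k) * poch (2 * mu + INR (n + 2 * k)) n
     = 4 ^ n * 4 ^ k * (poch mu n * poch (mu + INR n) k) * (poch c n * poch (c + INR n) k)).
  { rewrite <- !poch_add, <- Cpow_add_r. replace (n + 2 * k + n)%nat with (2 * (n + k))%nat by lia.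
    rewrite poch_double. f_equal; [f_equal; f_equal; field|f_equal; unfold c; field]. }
  replace (RtoC (nu + INR n) + 1) with (1 + nu + INR n) by (rewrite RtoC_plus; ring).
  assert (N1 : ~ nonpos_int (1 + nu + INR n)).
  { apply Re_not_nonpos_int. simpl. pose proof (pos_INR n). lra. }
  pose proof (poch_nonpole _ n Hm) as P1. pose proof (poch_nonpole _ k (nonpos_int_shiftn _ n Hm)) as P2.
  pose proof (poch_nonpole _ n Hc) as P3. pose proof (poch_nonpole _ k (nonpos_int_shiftn _ n Hc)) as P4.
  pose proof (poch_nonpole _ n Hmu) as P5. pose proof (poch_nonpole _ (2 * k) (nonpos_int_shiftn _ n Hmu)) as P6.
  pose proof (poch_nonpole _ (2 * k) (nonpos_int_shiftn _ n Hc)) as P7. pose proof (poch_nonpole _ k N1) as P8.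
  pose proof (poch_nonpole _ n (half_nonpole nu Hn)) as P9. pose proof (fact_neq k) as P10.
  assert (Q4 : forall j, (RtoC 4) ^ j <> 0). { intros j. rewrite <- RtoC_pow. apply RtoC_neq. apply pow_nonzero. lra. }
  pose proof (Q4 n) as Q1. pose proof (Q4 k) as Q2.
  assert (R1 : poch (2 * mu + INR (n + 2 * k)) n = 4 ^ n * 4 ^ k * (poch mu n * poch (mu + INR n) k) * (poch c n * poch (c + INR n) k) / (poch (2 * mu) n * poch (2 * mu + INR n) (2 * k))).
  { rewrite <- D5. field. auto. }
  rewrite R1. rewrite D3 in P6 |- *. rewrite D4 in P7 |- *.
  set (X1 := poch ((alpha + INR n) / 2) k) in *. set (X2 := poch ((alpha + INR n + 1) / 2) k) in *.
  set (X3 := poch ((2 * mu - alpha + INR n) / 2) k) in *. set (X4 := poch ((2 * mu - alpha + INR n + 1) / 2) k) in *.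
  set (Y1 := poch ((2 * mu + INR n) / 2) k) in *. set (Y2 := poch ((2 * mu + INR n + 1) / 2) k) in *.
  set (Y3 := poch ((mu + INR n + 1 / 2) / 2) k) in *. set (Y4 := poch ((mu + INR n + 3 / 2) / 2) k) in *.
  set (q1 := RtoC 4 ^ n) in *. set (q2 := RtoC 4 ^ k) in *.
  assert (NZ : forall a b c, a * b * c <> 0 -> b <> 0 /\ c <> 0).
  { intros a b e H. split; intros E; apply H; rewrite E; ring. }
  destruct (NZ _ _ _ P6) as [Z1 Z2]. destruct (NZ _ _ _ P7) as [Z3 Z4].
  set (g := poch (nu + 1 / 2) n) in *. set (h := poch (mu - nu) k). set (w := poch (1 + nu + INR n) k) in *.
  set (A1 := poch alpha n). set (A2 := poch (2 * mu - alpha) n). set (r1 := RtoC rho ^ n). set (r2 := RtoC rho ^ (2 * k)).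
  set (m1 := poch mu n) in *. set (m2 := poch (mu + INR n) k) in *. set (c1 := poch c n) in *. set (c2 := poch (c + INR n) k) in *.
  set (u1 := poch (2 * mu) n) in *. set (f := RtoC (INR (fact k))) in *.
  clear - P1 P2 P3 P4 P5 P8 P9 P10 Q1 Q2 Z1 Z2 Z3 Z4.
  field. repeat split; auto.
Qed.

Definition gegen (n : nat) (nu x : R) : C := poch (2 * nu) n / INR (fact n) * gpoly n nu x.

Lemma generic_integral n (alpha mu : C) (nu rho : R) : (-1 / 2 < nu)%R -> nu <> 0%R -> (0 < rho < 1)%R -> ~ nonpos_int (2 * mu) ->
  Iw nu (fun x => reduced alpha rho mu x * gegen n nu x) (rhs_formula n alpha nu rho mu).
Proof.
  intros Hn Hn0 Hr Hmu. destruct (generic_nonpole mu Hmu) as [Hm Hc].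
  destruct (series_integral n alpha mu nu rho Hn Hr Hmu) as [l [Hl HS]]. cbv zeta in Hl, HS.
  set (c := mu + 1 / 2) in *.
  pose proof (rgamma_neq_0 c Hc) as Gc.
  set (Cst := Cpower (RtoC (rho / 2)) (mu - 1 / 2) * (rgamma c * rgamma c) * (poch (2 * nu) n / INR (fact n))).
  eapply Iw_eq; [|eapply Iw_ext; [|exact (Iw_scal nu Cst _ _ Hl)]].
  2:{ intros x _. cbv beta. unfold reduced, gegen, Cst. fold c. field. split; auto using fact_neq. }
  set (E := poch alpha n * poch (2 * mu - alpha) n * RtoC rho ^ n * poch mu n / (poch (nu + 1 / 2) n * poch c n * poch (2 * mu) n)).
  unfold rhs_formula.
  set (num := [ (alpha + INR n) / 2; _; _; _; _; _ ]). set (den := [ (2 * mu + INR n) / 2; _; _; _; _ ]).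
  set (w := wint (nu + INR n)) in *.
  assert (Pn := pos_INR n).
  assert (HS' : cseries (fun k => E * RtoC w * pFq_term num den (RtoC (rho ^ 2)) k) l).
  { eapply cseries_ext; [|exact HS]. intros k. pose proof (term_identity n alpha mu nu rho k Hn Hmu) as TI.
    fold c in TI. fold num den in TI. fold E in TI. cbv beta. rewrite Cmult_assoc, TI. ring. }
  (* a vanishing prefactor makes the left-hand side vanish, whatever the value of the series *)
  assert (EL : l = E * RtoC w * pFq num den (RtoC (rho ^ 2))).
  { destruct (classic (E * RtoC w = 0)) as [Z|Z].
    - rewrite Z. replace (0 * pFq num den (RtoC (rho ^ 2))) with (RtoC 0) by ring.
      apply (cseries_unique (fun k => E * RtoC w * pFq_term num den (RtoC (rho ^ 2)) k)); auto.
      apply (cseries_ext (fun _ => RtoC 0)). { intros k. rewrite Z. ring. }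
      exact (cseries_finite (fun _ => RtoC 0) 0 (fun _ _ => eq_refl)).
    - pose proof (cseries_scal (/ (E * RtoC w)) _ _ HS') as HT.
      assert (HT' : cseries (pFq_term num den (RtoC (rho ^ 2))) (/ (E * RtoC w) * l)).
      { eapply cseries_ext; [|exact HT]. intros k. cbv beta.
        rewrite Cmult_assoc, Cinv_l by exact Z. ring. }
      unfold pFq. rewrite (CSeries_eq _ _ HT'), Cmult_assoc, Cinv_r by exact Z. ring. }
  rewrite EL. set (PF := pFq num den (RtoC (rho ^ 2))).
  pose proof (wint_rgamma (nu + INR n) ltac:(lra)) as WG. fold w in WG.
  replace (RtoC (nu + INR n) + 1 / 2) with (nu + 1 / 2 + INR n) in WG by (rewrite RtoC_plus; ring).
  replace (RtoC (nu + INR n) + 1) with (1 + nu + INR n) in WG by (rewrite RtoC_plus; ring).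
  replace (1 / 2 + mu + INR n) with (c + INR n) by (unfold c; ring). replace (1 / 2 + mu) with c by (unfold c; ring).
  assert (N1 : ~ nonpos_int (1 + nu + INR n)). { apply Re_not_nonpos_int. simpl. lra. }
  assert (N2 := half_nonpole nu Hn). replace (1 / 2 + RtoC nu) with (RtoC nu + 1 / 2) by ring.
  pose proof (nonpos_int_shiftn _ n Hc) as N3. pose proof (nonpos_int_shiftn _ n N2) as N4.
  rewrite (Gamma_inv _ N1), (Gamma_inv _ N2), (Gamma_inv _ N3), (Gamma_inv _ Hc).
  pose proof (rgamma_neq_0 _ N1). pose proof (rgamma_neq_0 _ N2) as G2. pose proof (rgamma_neq_0 _ N3). pose proof (rgamma_neq_0 _ N4).
  unfold Cst, E.
  replace (INR n + mu - 1 / 2) with (INR n + (mu - 1 / 2)) by ring. rewrite (Cpower_plus rho), Cpower_nat by lra.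
  replace (Cpower (RtoC (rho / 2)) (mu - 1 / 2)) with (Cpower rho (mu - 1 / 2) * Cpower 2 (1 / 2 - mu)).
  2:{ rewrite !Cpower_pos by lra. rewrite <- Cexp_plus. f_equal. rewrite ln_div, RtoC_minus by lra. ring. }
  rewrite (rgamma_poch (RtoC nu + 1 / 2) n) in G2 |- *. rewrite (rgamma_poch c n) in Gc |- *.
  replace (RtoC w) with (RtoC (sqrt PI) * rgamma (1 + nu + INR n) / rgamma (nu + 1 / 2 + INR n)).
  2:{ rewrite <- WG. field. auto. }
  pose proof (poch_nonpole _ n N2). pose proof (poch_nonpole _ n Hc). pose proof (poch_nonpole _ n Hmu). pose proof (fact_neq n).
  set (r1 := rgamma (1 + nu + INR n)) in *. set (r2 := rgamma (RtoC nu + 1 / 2 + INR n)) in *. set (r3 := rgamma (c + INR n)) in *.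
  set (p1 := poch (RtoC nu + 1 / 2) n) in *. set (p2 := poch c n) in *. set (p3 := poch (2 * mu) n) in *. set (f := RtoC (INR (fact n))) in *.
  set (k1 := Cpower rho (mu - 1 / 2)). set (k2 := Cpower 2 (1 / 2 - mu)). set (rn := RtoC rho ^ n).
  clearbody PF r1 r2 r3 p1 p2 p3 f k1 k2 rn.
  field. repeat split; auto.
Qed.

(** * Continuation in the order *)

Lemma integral_exists n (alpha mu : C) (nu rho : R) : (-1 / 2 < nu)%R -> (0 < rho < 1)%R ->
  exists l, Iw nu (fun x => reduced alpha rho mu x * gegen n nu x) l.
Proof.
  intros Hn Hr. destruct (hreg_lipschitz alpha (2 * mu - alpha) (mu + 1 / 2) rho ltac:(lra)) as [L [HL H]].
  set (F := hreg alpha (2 * mu - alpha) (mu + 1 / 2)) in *.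
  set (B := (Cmod (F 0) + L * rho)%R).
  assert (HB : forall u : R, (Rabs u <= rho)%R -> (Cmod (F u) <= B)%R).
  { intros u Hu. replace (F u) with (F 0 + (F u - F 0)) by ring. eapply Rle_trans; [apply Cmod_triangle|].
    apply Rplus_le_compat_l. eapply Rle_trans; [apply H|].
    - rewrite Cmod_R. auto. - rewrite Cmod_0. lra.
    - apply Rmult_le_compat_l; auto. replace (RtoC u - 0) with (RtoC u) by ring. rewrite Cmod_R. auto. }
  assert (CG : cdiff (gegen n nu)). { apply (cdiff_mult (fun _ => _)); [apply cdiff_const|apply cdiff_gpoly]. }
  destruct (cdiff_bounded _ CG) as [M HM].
  apply (Iw_ex nu _ (Cmod (Cpower (RtoC (rho / 2)) (mu - 1 / 2)) * B * B * M)%R Hn).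
  - intros x Hx. apply ccont_mult; [now apply ccont_reduced|now apply cdiff_ccont].
  - intros x Hx. destruct (stvar_bounds rho x Hr Hx) as [B1 [B2 _]]. unfold reduced. fold F. rewrite !Cmod_mult.
    assert (BS := HB (svar rho x) ltac:(apply Rabs_le; lra)). assert (BT := HB (tvar rho x) ltac:(apply Rabs_le; lra)).
    repeat apply Rmult_le_compat; auto using Cmod_ge_0; try (repeat apply Rmult_le_pos; apply Cmod_ge_0); try lra. apply HM. lra.
Qed.

Definition lhs_value (n : nat) (alpha : C) (nu rho : R) (mu : C) : C :=
  Cthe (fun l => Iw nu (fun x => reduced alpha rho mu x * gegen n nu x) l).

Lemma lhs_value_spec n (alpha mu : C) (nu rho : R) : (-1 / 2 < nu)%R -> (0 < rho < 1)%R ->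
  Iw nu (fun x => reduced alpha rho mu x * gegen n nu x) (lhs_value n alpha nu rho mu).
Proof. intros Hn Hr. unfold lhs_value, Cthe. apply epsilon_spec. now apply integral_exists. Qed.

(** The remainder bounds of the integrand are uniform in [x], so they can be
    integrated.  This holds at every order, exceptional or not. *)
Lemma tay_lhs_value n (alpha mu : C) (nu rho : R) : (-1 / 2 < nu)%R -> (0 < rho < 1)%R ->
  exists d M, tay (lhs_value n alpha nu rho) mu d M.
Proof.
  intros Hn Hr.
  destruct (tay_hreg 0 alpha 2 (- alpha) (1 / 2) mu rho ltac:(lra)) as [D [M1 [L [HL [HT HD]]]]].
  set (lg := RtoC (ln (rho / 2))).
  set (K := fun u => Cpower (RtoC (rho / 2)) (u - 1 / 2)).
  assert (TK : exists dK M0, tay K mu dK M0).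
  { do 2 eexists. eapply tay_ext; [|apply (tay_Cexp lg (- (1 / 2) * lg))]. intros u. unfold K. rewrite Cpower_pos by lra. f_equal. unfold lg. ring. }
  destruct TK as [dK [M0 TK]].
  set (F := fun u w => hreg (0 * u + alpha) (2 * u + - alpha) (u + 1 / 2) w) in *.
  assert (FE : forall u w, hreg alpha (2 * u - alpha) (u + 1 / 2) w = F u w).
  { intros u w. unfold F. f_equal; ring. }
  assert (CG : cdiff (gegen n nu)). { apply (cdiff_mult (fun _ => _)); [apply cdiff_const|apply cdiff_gpoly]. }
  destruct (cdiff_bounded _ CG) as [M2 HM2].
  set (dR := fun x => (dK * F mu (svar rho x) + K mu * D (svar rho x)) * F mu (tvar rho x) + (K mu * F mu (svar rho x)) * D (tvar rho x)).
  set (d := fun x => dR x * gegen n nu x).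
  set (MM := (M0 * M1 * M1 * M2)%R).
  assert (TX : forall x, (-1 < x < 1)%R -> tay (fun u => reduced alpha rho u x * gegen n nu x) mu (d x) MM).
  { intros x Hx. destruct (stvar_bounds rho x Hr Hx) as [B1 [B2 _]].
    assert (T1 := HT (RtoC (svar rho x)) ltac:(rewrite Cmod_R; apply Rabs_le; lra)).
    assert (T2 := HT (RtoC (tvar rho x)) ltac:(rewrite Cmod_R; apply Rabs_le; lra)).
    pose proof (tay_mult _ _ _ _ _ _ _ (tay_mult _ _ _ _ _ _ _ TK T1) T2) as T3.
    eapply tay_ext; [|eapply tay_deq; [|eapply tay_weaken; [|apply (tay_mult _ _ _ _ _ _ _ T3 (tay_const (gegen n nu x) mu))]]].
    - intros u. cbv beta. unfold reduced. rewrite !FE. unfold K, F. reflexivity.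
    - cbv beta. unfold d, dR, F. ring.
    - unfold MM. apply Rmult_le_compat_l; [apply (tay_pos _ _ _ _ T3)|]. apply HM2. lra. }
  assert (CC : forall x, (-1 < x < 1)%R -> ccont d x).
  { intros x Hx. destruct (hreg_lipschitz (0 * mu + alpha) (2 * mu + - alpha) (mu + 1 / 2) rho ltac:(lra)) as [LF [HLF HF]].
    destruct (ccont_stvar _ LF rho x Hr HLF HF Hx) as [F1 F2]. destruct (ccont_stvar _ L rho x Hr HL HD Hx) as [D1 D2].
    apply (ccont_mult dR); [|now apply cdiff_ccont]. unfold dR, F.
    apply ccont_plus; apply ccont_mult; auto.
    - apply ccont_plus; apply ccont_mult; auto using ccont_const.
    - apply ccont_mult; auto using ccont_const. }
  destruct (Iw_ex nu d MM Hn CC) as [dl Hdl].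
  { intros x Hx. destruct (TX x Hx) as [T _]. cbv beta in T. pose proof (Cmod_ge_0 (reduced alpha rho mu x * gegen n nu x)). lra. }
  assert (MP : (0 <= MM)%R) by (apply (tay_pos _ _ _ _ (TX 0%R ltac:(lra)))).
  pose proof (wint_pos nu Hn) as WP.
  assert (NN : (0 <= 2 * (MM * wint nu))%R) by (apply Rmult_le_pos; [lra|now apply Rmult_le_pos]).
  set (v := lhs_value n alpha nu rho) in *.
  exists dl, (Cmod (v mu) + Cmod dl + 2 * (MM * wint nu))%R. split; [lra|].
  intros h Hh.
  replace ((Cmod (v mu) + Cmod dl + 2 * (MM * wint nu) - Cmod (v mu) - Cmod dl) * Cmod h ^ 2)%R with (2 * ((MM * Cmod h ^ 2) * wint nu))%R by ring.
  apply (Iw_bound nu (fun x => reduced alpha rho (mu + h) x * gegen n nu x - reduced alpha rho mu x * gegen n nu x - h * d x)); auto.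
  - apply Iw_minus; [apply Iw_minus; apply lhs_value_spec; auto|]. now apply Iw_scal.
  - intros x Hx. destruct (TX x Hx) as [T1 T2]. specialize (T2 h Hh). cbv beta in T1, T2. eapply Rle_trans; [exact T2|].
    apply Rmult_le_compat_r; [apply pow2_ge_0|]. pose proof (Cmod_ge_0 (reduced alpha rho mu x * gegen n nu x)). pose proof (Cmod_ge_0 (d x)). lra.
Qed.

Lemma ex_derive_eps (g : C -> C) z : ex_derive (K := C_AbsRing) (V := C_NormedModule) g z ->
  forall eps, (0 < eps)%R -> exists del, (0 < del)%R /\ forall u, (Cmod (u - z) < del)%R -> (Cmod (g u - g z) < eps)%R.
Proof.
  intros H eps He. pose proof (ex_derive_continuous g z H) as HC.
  assert (LOC : locally (g z : C) (fun w => (Cmod (w - g z) < eps)%R)) by (apply locally_Cmod; exists eps; auto).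
  destruct (HC _ LOC) as [d Hd]. exists d. split; [apply cond_pos|]. intros u Hu. apply Hd. exact Hu.
Qed.

(** The exceptional orders are isolated, so continuity alone determines the
    continuation there. *)
Lemma rhs_lhs_value n (alpha mu : C) (nu rho : R) : (-1 / 2 < nu)%R -> nu <> 0%R -> (0 < rho < 1)%R ->
  rhs n alpha nu rho mu = lhs_value n alpha nu rho mu.
Proof.
  intros Hn Hn0 Hr.
  assert (GEN : forall m, ~ nonpos_int (2 * m) -> rhs_formula n alpha nu rho m = lhs_value n alpha nu rho m).
  { intros m Hm. eapply Iw_unique; [now apply generic_integral|now apply lhs_value_spec]. }
  assert (HOL : forall m, ex_derive (K := C_AbsRing) (V := C_NormedModule) (lhs_value n alpha nu rho) m).
  { intros m. destruct (tay_lhs_value n alpha m nu rho Hn Hr) as [d [M T]]. exists d. eapply tay_is_derive. exact T. }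
  unfold rhs, analytic_ext. destruct (excluded_middle_informative _) as [H|H]; [now apply GEN|].
  apply Cthe_unique.
  - exists (lhs_value n alpha nu rho). split; [intros z _; apply HOL|]. split; auto. intros u Hu _. symmetry. now apply GEN.
  - intros w [g [Hg [Ha Hw]]]. subst w. apply Csub_eq. apply Cmod_zero_le. apply Rnot_lt_le. intros HP.
    set (v := lhs_value n alpha nu rho) in *. set (e := (Cmod (g mu - v mu) / 2)%R).
    assert (He : (0 < e)%R) by (unfold e; lra).
    destruct (ex_derive_eps g mu (Hg mu I) e He) as [d1 [Hd1 E1]]. destruct (ex_derive_eps v mu (HOL mu) e He) as [d2 [Hd2 E2]].
    set (del := Rmin (1 / 4) (Rmin (d1 / 2) (d2 / 2))).
    assert (Hd : (0 < del)%R) by (unfold del; repeat apply Rmin_glb_lt; lra).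
    assert (L1 : (del <= 1 / 4)%R) by apply Rmin_l.
    assert (L2 : (del <= d1 / 2)%R) by (eapply Rle_trans; [apply Rmin_r|apply Rmin_l]).
    assert (L3 : (del <= d2 / 2)%R) by (eapply Rle_trans; [apply Rmin_r|apply Rmin_r]).
    set (u := mu + RtoC del). assert (Eu : Cmod (u - mu) = del).
    { unfold u. replace (mu + RtoC del - mu) with (RtoC del) by ring. apply Cmod_RtoC_pos. lra. }
    (* [2 * u] differs from the integer [2 * mu] by [2 * del], less than 1 *)
    assert (Hu : ~ nonpos_int (2 * u)).
    { intros [a Ea]. apply NNPP in H. destruct H as [b Eb].
      assert (X : RtoC (2 * del) = RtoC (INR b - INR a)).
      { rewrite RtoC_mult, RtoC_minus. transitivity (2 * u - 2 * mu); [unfold u; ring|]. rewrite Ea, Eb. ring. }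
      apply RtoC_inj in X. rewrite !INR_IZR_INZ, <- minus_IZR in X.
      assert (Y1 : (0 < IZR (Z.of_nat b - Z.of_nat a))%R) by lra. assert (Y2 : (IZR (Z.of_nat b - Z.of_nat a) < 1)%R) by lra.
      apply lt_IZR in Y1, Y2. lia. }
    specialize (E1 u ltac:(lra)). specialize (E2 u ltac:(lra)).
    rewrite (Ha u Hu I), GEN in E1 by auto. fold v in E1.
    pose proof (Cmod_triangle (v u - v mu) (- (v u - g mu))) as T. rewrite Cmod_opp in T.
    replace (v u - v mu + - (v u - g mu)) with (g mu - v mu) in T by ring. unfold e in *. lra.
Qed.

Theorem corollary17 (n : nat) (alpha mu : C) (nu rho : R)
  (hnu : (-1 / 2 < nu)%R) (hnu0 : nu <> 0%R) (hrho : (0 < rho < 1)%R) :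
  is_RInt_gen (V := C_R_NormedModule) (integrand n alpha mu nu rho)
    (at_right (-1)%R) (at_left 1%R) (rhs n alpha nu rho mu).
Proof.
  rewrite rhs_lhs_value by auto.
  pose proof (Iw_is_RInt_gen _ _ _ (lhs_value_spec n alpha mu nu rho hnu hrho)) as H.
  refine (is_RInt_gen_ext (V := C_R_NormedModule) (Fa := at_right (-1)) (Fb := at_left 1) _ _ _ _ H).
  apply ends_filter. exists (1 / 2)%R. split; [lra|].
  intros a b Ha Hb x. simpl. rewrite Rmin_left, Rmax_right by lra. intros Hx.
  rewrite integrand_reduced by (auto; lra). reflexivity.
Qed.
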